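(* Let $m\ge1$, $d\ge0$, $k=\mathbb{F}_q$ and $R=R_{2,2m+1}=k[[X,Y]]/(Y^2-X^{2m+1})$. With $t:=q^{-s}$, $$\nu^R_{R^d}(s)=\sum_{\lambda,\mu}g^{(m^d)}_\lambda(q)\,g^\lambda_\mu(q)\,(t;q)_{d-\lambda'_m}\,t^{|\lambda|}\,(q^dt)^{|\mu|},$$ where the sum is over all partitions $\lambda,\mu$ (only those with $\mu\subseteq\lambda\subseteq(m^d)$ contribute).
   Context: Let $\widetilde{R}\simeq k[[T]]$ be the normalization of $R$ ($X=T^2$, $Y=T^{2m+1}$). $\zeta^R_{R^d}(s)=\sum_N|R^d/N|^{-s}$ is the sum over finite-index $R$-submodules $N\subseteq R^d$, $\zeta^{\widetilde{R}}_{\widetilde{R}^d}(s)=\sum_N|\widetilde{R}^d/N|^{-s}$ is the sum over finite-index $\widetilde{R}$-submodules $N\subseteq\widetilde{R}^d$, and $\nu^R_{R^d}(s)=\zeta^R_{R^d}(s)/\zeta^{\widetilde{R}}_{\widetilde{R}^d}(s)$. $(a;q)_n=\prod_{j=0}^{n-1}(1-aq^j)$. For a partition $\lambda$: $|\lambda|$ is its size, $\lambda'$ its conjugate (so $\lambda'_i$ is the number of parts $\ge i$), $\mu\subseteq\lambda$ is containment of Young diagrams, and $(m^d)=(m,\dots,m)$ ($d$ parts). The skew Hall polynomial $g^\lambda_\mu(q)$ is the number of submodules of type $\mu$ in a fixed module of type $\lambda$ over a DVR $(V,\pi)$ with residue field $\mathbb{F}_q$ (type $\lambda$ means isomorphic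 to $\bigoplus_iV/\pi^{\lambda_i}V$). Explicitly, $$g^\lambda_\mu(q)=q^{\sum_{i\ge1}\mu'_i(\lambda'_i-\mu'_i)}\prod_{i\ge1}\genfrac{[}{]}{0pt}{}{\lambda'_i-\mu'_{i+1}}{\lambda'_i-\mu'_i}_{q^{-1}},\qquad \genfrac{[}{]}{0pt}{}{n}{k}_q=\frac{(q;q)_n}{(q;q)_k(q;q)_{n-k}},$$ and it is zero unless $\mu\subseteq\lambda$. *)

(* Defs.v *)
From HB Require Import structures.
From mathcomp Require Import all_boot all_order all_algebra.
From mathcomp Require Import generic_quotient ring_quotient finmap.
From mathcomp Require Import all_classical all_reals all_analysis.
From mathcomp Require summability.
From mathcomp Require Export complex.
Set Implicit Arguments.
Unset Strict Implicit.
Unset Printing Implicit Defensive.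
Import Order.TTheory GRing.Theory Num.Theory.
Import numFieldNormedType.Exports.
Local Open Scope ring_scope.
Local Open Scope complex_scope.
Local Open Scope classical_set_scope.

(* Formal power series A[[T]].  The record (rather than a bare function type)
   keeps the Cauchy product apart from the pointwise ring structure that
   MathComp-Analysis puts on [nat -> A]. *)
Record fps (A : Type) := FPS { fcoef : nat -> A }.

HB.instance Definition _ (A : Type) := gen_eqMixin (fps A).
HB.instance Definition _ (A : Type) := gen_choiceMixin (fps A).

Lemma fpsP (A : Type) (f g : fps A) : fcoef f =1 fcoef g -> f = g.
Proof. by case: f => f; case: g => g /= fg; congr FPS; apply/funext. Qed.

Section FpsRing.
Variable A : comNzRingType.
Implicit Types f g h : fps A.

Definition fps_zero : fps A := FPS (fun=> 0).
Definition fps_opp f : fps A := FPS (fun n => - fcoef f n).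
Definition fps_add f g : fps A := FPS (fun n => fcoef f n + fcoef g n).
Definition fps_const (a : A) : fps A := FPS (fun n => if n == 0%N then a else 0).
Definition fps_var : fps A := FPS (fun n => if n == 1%N then 1 else 0).
Definition fps_mul f g : fps A :=
  FPS (fun n => \sum_(i < n.+1) fcoef f i * fcoef g (n - i)%N).

Fact fps_addA : associative fps_add.
Proof. by move=> f g h; apply: fpsP => n /=; rewrite addrA. Qed.

Fact fps_addC : commutative fps_add.
Proof. by move=> f g; apply: fpsP => n /=; rewrite addrC. Qed.

Fact fps_add0 : left_id fps_zero fps_add.
Proof. by move=> f; apply: fpsP => n /=; rewrite add0r. Qed.

Fact fps_addN : left_inverse fps_zero fps_opp fps_add.
Proof. by move=> f; apply: fpsP => n /=; rewrite addNr. Qed.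

HB.instance Definition _ :=
  GRing.isZmodule.Build (fps A) fps_addA fps_addC fps_add0 fps_addN.

Fact fps_mul_rev f g n :
  fcoef (fps_mul f g) n = \sum_(i < n.+1) fcoef f (n - i)%N * fcoef g i.
Proof.
rewrite /= (reindex_inj rev_ord_inj) /=.
by apply: eq_bigr => j _; rewrite (sub_ordK j).
Qed.

Fact fps_mulC : commutative fps_mul.
Proof.
move=> f g; apply: fpsP => n; rewrite fps_mul_rev /=.
by apply: eq_bigr => i _; rewrite mulrC.
Qed.

Fact fps_mulA : associative fps_mul.
Proof.
move=> p q r; apply: fpsP => i; rewrite [RHS]fps_mul_rev.
pose coef3 j k := fcoef p j * (fcoef q (i - j - k)%N * fcoef r k).
transitivity (\sum_(j < i.+1) \sum_(k < i.+1 | (k <= i - j)%N) coef3 j k).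
  apply: eq_bigr => /= j _.
  rewrite -[X in _ * X]/(fcoef (fps_mul q r) (i - j)%N) fps_mul_rev big_distrr /=.
  by rewrite (big_ord_narrow_leq (leq_subr _ _)).
rewrite (exchange_big_dep predT) //=; apply: eq_bigr => k _.
transitivity (\sum_(j < i.+1 | (j <= i - k)%N) coef3 j k).
  apply: eq_bigl => j; rewrite -ltnS -(ltnS j) -!subSn ?leq_ord //.
  by rewrite -subn_gt0 -(subn_gt0 j) -!subnDA addnC.
rewrite (big_ord_narrow_leq (leq_subr _ _)) big_distrl /=.
by apply: eq_bigr => j _; rewrite /coef3 -!subnDA addnC mulrA.
Qed.

Fact fps_mul1 : left_id (fps_const 1) fps_mul.
Proof.
move=> f; apply: fpsP => n /=; rewrite big_ord_recl subn0 mul1r.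
by rewrite big1 ?addr0 // => i _; rewrite mul0r.
Qed.

Fact fps_mulDl : left_distributive fps_mul fps_add.
Proof.
move=> f g h; apply: fpsP => n /=; rewrite -big_split /=.
by apply: eq_bigr => i _; rewrite mulrDl.
Qed.

Fact fps_1_neq0 : fps_const 1 != 0 :> fps A.
Proof.
by apply/eqP => /(congr1 (fun f => fcoef f 0%N)) /eqP /=; rewrite oner_eq0.
Qed.

HB.instance Definition _ := GRing.Zmodule_isComNzRing.Build (fps A)
  fps_mulA fps_mulC fps_mul1 fps_mulDl fps_1_neq0.

End FpsRing.

(* k[[X, Y]] is k[[X]][[Y]]. *)
Section CuspRing.
Variables (k : fieldType) (m : nat).

Definition fpsXY := fps (fps k).
HB.instance Definition _ := GRing.ComNzRing.on fpsXY.

Definition varX : fpsXY := fps_const (fps_var k).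
Definition varY : fpsXY := fps_var (fps k).
Definition cusp_eqn : fpsXY := varY ^+ 2 - varX ^+ (2 * m + 1).

Definition cusp_ideal (f : fpsXY) : bool := `[< exists g, f = g * cusp_eqn >].

Fact cusp_eqn_const : fcoef (fcoef cusp_eqn 0%N) 0%N = 0.
Proof.
rewrite /cusp_eqn expr2 addn1 exprS /=.
by rewrite !big_ord1 /= !(mul0r, big_ord1, subr0, oppr0, addr0).
Qed.

Fact cusp_mul_const (f g : fpsXY) : fcoef (fcoef (f * g) 0%N) 0%N =
  fcoef (fcoef f 0%N) 0%N * fcoef (fcoef g 0%N) 0%N.
Proof. by rewrite /= big_ord1 /= big_ord1. Qed.

Fact cusp_idealr_closed : idealr_closed cusp_ideal.
Proof.
split.
- by apply/asboolP; exists 0; rewrite mul0r.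
- apply/asboolP => -[g /(congr1 (fun f => fcoef (fcoef f 0%N) 0%N))].
  by rewrite cusp_mul_const cusp_eqn_const mulr0 => /eqP; rewrite /= oner_eq0.
- move=> a u v /asboolP[gu ->] /asboolP[gv ->].
  by apply/asboolP; exists (a * gu + gv); rewrite mulrDl mulrA.
Qed.

HB.instance Definition _ := isIdealr.Build fpsXY cusp_ideal cusp_idealr_closed.

Definition cusp_ring := {ideal_quot (cusp_ideal : idealr fpsXY)}.
HB.instance Definition _ := GRing.ComNzRing.on cusp_ring.

(* The normalization k[[T]], the extension being X = T^2, Y = T^(2m+1). *)
Definition cusp_normalization := fps k.
HB.instance Definition _ := GRing.ComNzRing.on cusp_normalization.

End CuspRing.

Section SolomonZeta.
Variables (Rl : realType) (A : comNzRingType) (M : lmodType A).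

Definition is_submodule (N : set M) : Prop :=
  N 0 /\ forall (a : A) (u v : M), N u -> N v -> N (a *: u + v).

Definition cosets (N : set M) : set (set M) :=
  range (fun x : M => [set y | N (y - x)]).

Definition finite_index_submodule :=
  {N : set M | `[< is_submodule N /\ finite_set (cosets N) >]}.

(* The cardinality of M/N, for N of finite index. *)
Definition index_in (N : set M) : nat := #|` fset_set (cosets N)|%fset.

Definition expC (z : Rl[i]) : Rl[i] :=
  (expR (complex.Re z) * cos (complex.Im z)) +i* (expR (complex.Re z) * sin (complex.Im z)).

(* n ^ s = exp (s log n), for n > 0 *)
Definition natpowC (n : nat) (s : Rl[i]) : Rl[i] := expC (s * (ln n%:R)%:C).

Definition zeta_term (s : Rl[i]) (N : finite_index_submodule) : Rl[i] :=
  natpowC (index_in (sval N)) (- s).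

(* Convergence of the net of finite partial sums, i.e. unconditional
   (equivalently, in C, absolute) convergence. *)
Definition zeta_converges (s : Rl[i]) : Prop :=
  cvg (summability.partial_sum (zeta_term s : _ -> Rl[i]^o) @ summability.totally).

Definition zeta (s : Rl[i]) : Rl[i] :=
  summability.sum (zeta_term s : _ -> Rl[i]^o).

End SolomonZeta.

Arguments zeta_converges {Rl A} M s.
Arguments zeta {Rl A} M s.

Definition nu_cusp (Rl : realType) (k : fieldType) (m d : nat) (s : Rl[i]) : Rl[i] :=
  zeta 'rV[cusp_ring k m]_d s / zeta 'rV[cusp_normalization k]_d s.

Definition is_partition (la : seq nat) := sorted geq la && (0%N \notin la).
Definition int_partition := {la : seq nat | is_partition la}.

(* Column lengths and containment; la and mu are weakly decreasing sequences,
   and i is counted from 1. *)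
Definition conj_part (la : seq nat) (i : nat) : nat := count (leq i) la.
Definition part_sub (mu la : seq nat) : bool :=
  all (fun i => nth 0 mu i <= nth 0 la i)%N (iota 0%N (size mu)).

Section SkewHall.
Variable F : fieldType.

Definition qpoch (a q : F) (n : nat) : F := \prod_(j < n) (1 - a * q ^+ j).

Definition qbinom (n r : nat) (q : F) : F :=
  qpoch q q n / (qpoch q q r * qpoch q q (n - r)).

(* The sum and the product over i >= 1 stop at the largest part la_1: beyond it
   all column lengths vanish. *)
Definition skew_hall (la mu : seq nat) (q : F) : F :=
  if part_sub mu la then
    q ^+ (\sum_(1 <= i < (head 0 la).+1)
            conj_part mu i * (conj_part la i - conj_part mu i))%N
    * \prod_(1 <= i < (head 0%N la).+1)
        qbinom (conj_part la i - conj_part mu i.+1)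
               (conj_part la i - conj_part mu i) q^-1
  else 0.

End SkewHall.

(* Main.v *)
Require Import Defs.
From HB Require Import structures.
From mathcomp Require Import all_boot all_order all_algebra all_field.
From mathcomp Require Import generic_quotient ring_quotient finmap.
From mathcomp Require Import all_classical all_reals all_analysis.
From mathcomp Require summability.
From mathcomp Require Import zify ring.

(** Let V = k[[X]] with X = T^2, so that k[[T]] = V + TV and R = V + T X^m V. An
    R-submodule of finite index in R^d is then a V-lattice in V^d + T X^m V^d
    stable under T^(2m+1), its index is a power of q, and both zeta functions are
    power series in t whose n-th coefficient counts lattices of codimension n.
    With D = prod_(j < d) (1 - q^j t), two identities of formal power series give
    the theorem: D times the series of k[[T]]^d is 1 ([normal_gf]), and D times
    the series of R^d, which is therefore nu, is a finite sum over pairs of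
    submodules ([order_gf]).

    Both identities rest on one recursion ([fam_rec]). Let F_J(n) be the number
    of lattices of codimension n in some family whose constant terms map onto the
    coordinates in J. If such a lattice is not onto J + {i}, its elements satisfy
    f_i(0) = sum_(a in J) l_a f_a(0) for a unique row l supported on J. The
    lattice of all f with this property has index q and is the image of the whole
    module under an injective linear map [hyp i l]. Pulling back gives
    F_J(n) = F_(J+i)(n) + q^|J| F_J(n-1), so multiplication of the generating
    series by 1 - q^|J| t adds i to J. For k[[T]]-lattices one starts with J
    empty; at the other end only the whole module is left, by Nakayama's lemma.

    For R, sort the lattices N by the submodule W of (V/X^m)^d that their even
    parts span modulo X^m. Let la be the type of (V/X^m)^d / W. A Smith normal
    form identifies the preimage of W in V^d with V^d, and X^m V^d with the
    lattice C = sum of the X^(c_i) V. In these coordinates N is automatically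
    onto the coordinates with c_i > 0, so the recursion starts from that set J0
    and leaves the factor prod_(j < |J0|) (1 - q^j t); as m - c_i are the parts
    of la, this is (t;q)_(d - la'_m). The lattices that remain are
    {u + T v : v - Phi(u) in B}, with X^m V^d <= B <= C a V-submodule and Phi a
    V-linear map from V^d to C/B; each B contributes q^(d dim(C/B)) of them
    ([ncard_cusp_fam]). Finally S = C/X^m V^d is isomorphic to (V/X^m)^d / W
    ([quotient_map]), hence has type la, and |la| is the codimension of W. If
    mu is the type of C/B, then |mu| = dim(C/B), whence t^|la| (q^d t)^|mu|.

    It remains to see that W and B are counted by skew Hall polynomials. The
    number of submodules B of S with S/B of given type follows from the recursion
    B |-> B \cap XS, in which each fibre is a set of subspaces meeting a fixed
    subspace in a fixed way ([card_meeting], [card_cotype_set]).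

    Convergence: dividing by 1 - q^j t preserves absolute convergence as soon as
    |q^j t| < 1, so the series of R^d and k[[T]]^d converge absolutely when
    Re s > d - 1. Whenever the zeta sums converge, they are the limits of these
    series, and the formal identities can be evaluated at t. *)

Set Implicit Arguments.
Unset Strict Implicit.
Unset Printing Implicit Defensive.
Import Order.TTheory GRing.Theory Num.Theory.
Local Open Scope ring_scope.

(** * Subspaces that meet a given subspace trivially *)

(** Subspaces are encoded as matrices in normal form, so over a finite field they
    make up a finite type. *)
Section FinVspace.
Import VectorInternalTheory.
HB.instance Definition _ (k : finFieldType) (E : vectType k) :=
  [Countable of {vspace E} by <:].
HB.instance Definition _ (k : finFieldType) (E : vectType k) :=
  [Finite of {vspace E} by <:].
End FinVspace.

Section SubspaceCount.
Variables (k : finFieldType) (E : vectType k).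
Implicit Types (B Q P U V W : {vspace E}).
Let fE : finType := finvect_type E.

Lemma card_vspaceE U : #|[pred v : fE | v \in U]| = (#|k| ^ \dim U)%N.
Proof.
rewrite /fE; case: E U => T c U.
exact: (@card_vspace k (finvect_type (Vector.Pack c)) c U).
Qed.

Definition meeting B Q P (e : nat) : {set {vspace E}} :=
  [set U : {vspace E} | [&& (B <= U)%VS, (U <= P)%VS, (U :&: Q == B)%VS &
     \dim U == (e + \dim B)%N]].

Lemma dim_add_line U (v : E) : v \notin U -> \dim (U + <[v]>)%VS = (\dim U).+1.
Proof.
move=> vU; have v0 : v != 0 by apply: contraNneq vU => ->; rewrite mem0v.
rewrite dimv_disjoint_sum ?dim_vline ?v0 ?addn1 //.
apply/eqP; rewrite -subv0; apply/subvP => w /memv_capP[wU /vlineP[c wc]].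
rewrite memv0 wc; case: (eqVneq c 0) => [->|c0]; first by rewrite scale0r.
by case/negP: vU; rewrite -[v](scalerK c0) -wc memvZ.
Qed.

(** Adjoining v to both B and Q turns the condition that v lies in U into an
    inclusion and lowers the relative dimension of U by one. *)
Lemma meeting_line B Q P e (v : E) : (B <= Q)%VS -> v \in P -> v \notin Q ->
  [set U in meeting B Q P e.+1 | v \in U] =
  meeting (B + <[v]>) (Q + <[v]>) P e.
Proof.
move=> BQ vP vQ; have vB : v \notin B by apply: contra vQ; apply: subvP.
apply/setP => U; rewrite !inE dim_add_line // addSnnS.
apply/idP/idP.
  case/andP => /and4P[BU UP /eqP UQ ->] vU.
  have vU' : (<[v]> <= U)%VS by rewrite -memvE.
  by rewrite UP subv_add BU vU' -vspace_modr // UQ eqxx.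
case/and4P => BvU -> /eqP UQ ->; rewrite /= andbT.
move: BvU; rewrite subv_add -memvE => /andP[BU vU]; rewrite BU vU /= andbT.
rewrite eqEsubv subv_cap BU BQ /= !andbT; apply/subvP => w /memv_capP[wU wQ].
have : w \in (U :&: (Q + <[v]>))%VS.
  by rewrite memv_cap wU; apply: subvP wQ; apply: addvSl.
rewrite UQ => /memv_addP[b bB [u /vlineP[c ->]] wE].
case: (eqVneq c 0) => [c0|c0]; first by rewrite wE c0 scale0r addr0.
case/negP: vQ; have -> : v = c^-1 *: (w - b) by rewrite wE addrC addKr scalerK.
by rewrite memvZ // memvB // (subvP BQ).
Qed.

(** Double count of the pairs (U, v) with v in U outside Q. Each U has
    q^(e+1+dim B) - q^(dim B) such v; each of the q^(dim P) - q^(dim Q)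
    vectors v of P outside Q leaves the count for e with B and Q enlarged by
    v. *)
Lemma card_meeting (R : comNzRingType) e : forall B Q P, (B <= Q)%VS -> (Q <= P)%VS ->
  let q : R := #|k|%:R in
  #|meeting B Q P e|%:R * \prod_(i < e) (q ^+ (e + \dim B) - q ^+ (\dim B + i))
  = \prod_(i < e) (q ^+ \dim P - q ^+ (\dim Q + i)).
Proof.
elim: e => [|e IHe] B Q P BQ QP /=.
  rewrite !big_ord0 mulr1 (_ : meeting _ _ _ _ = [set B]) ?cards1 //.
  apply/setP => U; rewrite !inE add0n; apply/idP/eqP => [|->]; last first.
    by rewrite subvv (subv_trans BQ) //= eqxx andbT; apply/eqP/capv_idPl.
  case/and4P => BU _ _ dU; apply/esym/eqP.
  by rewrite eqEdim BU (eqP dU) leqnn.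
set q : R := #|k|%:R.
have cardE U : (#|[pred v : fE | v \in U]|)%:R = q ^+ \dim U.
  by rewrite card_vspaceE natrX.
have diffE U V : (V <= U)%VS ->
    (#|[pred v : fE | (v \in U) && (v \notin V)]|)%:R = q ^+ \dim U - q ^+ \dim V.
  move/subvP => VU; rewrite -!cardE; apply/esym/eqP; rewrite subr_eq; apply/eqP.
  rewrite -natrD addnC; congr (_ %:R).
  rewrite -(cardID [pred v : fE | v \in V] [pred v : fE | v \in U]).
  congr (_ + _)%N; apply: eq_card => v; rewrite !inE; last exact: andbC.
  by apply/andP/idP => [[]//|vV]; split=> //; apply: VU.
have step : #|meeting B Q P e.+1|%:R * (q ^+ (e.+1 + \dim B) - q ^+ \dim B)
   * \prod_(i < e) (q ^+ (e + (\dim B).+1) - q ^+ ((\dim B).+1 + i))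
  = (q ^+ \dim P - q ^+ \dim Q) *
    \prod_(i < e) (q ^+ \dim P - q ^+ ((\dim Q).+1 + i)).
  transitivity ((\sum_(U in meeting B Q P e.+1) \sum_(v : fE | (v \in P) && (v \notin Q))
     (v \in U : nat))%:R * \prod_(i < e) (q ^+ (e + (\dim B).+1) - q ^+ ((\dim B).+1 + i))).
    congr (_ * _); rewrite -sum1_card !natr_sum mulr_suml; apply: eq_bigr => U.
    rewrite inE => /and4P[BU UP /eqP UQ /eqP dU]; rewrite mul1r -dU -diffE //.
    congr (_ %:R); rewrite -sum1_card big_mkcond [RHS]big_mkcond /=.
    apply: eq_bigr => v _; rewrite !inE.
    case vU : (v \in U) => /=; last by rewrite if_same.
    rewrite (subvP UP _ vU) /=; congr (if ~~ _ then _ else _).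
    by have := @memv_cap k E v U Q; rewrite UQ vU /= => ->.
  rewrite exchange_big /= natr_sum mulr_suml -diffE // -sum1_card natr_sum mulr_suml.
  apply: eq_big => [v|v /andP[vP vQ]]; first by rewrite inE.
  pose w : E := v; have wB : w \notin B by apply: contra vQ; apply: subvP.
  have -> : (\sum_(U in meeting B Q P e.+1) (w \in U : nat))%N =
            #|meeting (B + <[w]>) (Q + <[w]>) P e|.
    rewrite -meeting_line // -sum1_card big_mkcond [RHS]big_mkcond /=.
    by apply: eq_bigr => U _; rewrite !inE; case: ifP => //= _; case: (w \in U).
  have := IHe (B + <[w]>)%VS (Q + <[w]>)%VS P; rewrite !dim_add_line // mul1r; apply.
    by rewrite addvS.
  by rewrite subv_add QP -memvE.
rewrite !big_ord_recl /= !addn0 mulrA.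
under [X in _ * X = _]eq_bigr do rewrite /bump leq0n add1n !addSnnS.
under [X in _ = _ * X]eq_bigr do rewrite /bump leq0n add1n -addSnnS.
rewrite -step; congr (_ * _); apply: eq_bigr => i _.
by rewrite !addSnnS.
Qed.

End SubspaceCount.

(** * Submodules of given cotype *)

Section HallCount.
Variables (k : finFieldType) (E : vectType k) (x : 'End(E)).
Implicit Types (B Q P U V S : {vspace E}).

Definition stable S := (x @: S <= S)%VS.
Definition img_iter j S := iter j (fun U => x @: U)%VS S.
(** Let X act through x. This is the column length la'_(j+1) of the type la of
    S. *)
Definition mod_type S j := (\dim (img_iter j S) - \dim (img_iter j.+1 S))%N.
(** The same column length for the quotient of S by B. *)
Definition mod_cotype S B j :=
  (\dim (img_iter j S + B) - \dim (img_iter j.+1 S + B))%N.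

Lemma img_iterSr j S : img_iter j.+1 S = img_iter j (x @: S)%VS.
Proof. exact: iterSr. Qed.

Lemma img_iter_sub j S : stable S -> (img_iter j S <= S)%VS.
Proof.
move=> Sst; elim: j => [|j IHj]; first exact: subvv.
exact: subv_trans (limgS _ IHj) Sst.
Qed.

Lemma limg_cap_preim S B : (x @: (S :&: x @^-1: B) = x @: S :&: B)%VS.
Proof.
apply/vspaceP => v; apply/memv_imgP/memv_capP.
  case=> u /memv_capP[uS uB] ->; split; first exact: memv_img.
  by rewrite memv_preim.
case=> /memv_imgP[u uS ->] uB; exists u => //.
by rewrite memv_cap uS -memv_preim.
Qed.

Lemma dim_cap_preim S B :
  (\dim (S :&: x @^-1: B) = (\dim S - \dim (x @: S)) + \dim (x @: S :&: B))%N.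
Proof.
rewrite -(limg_ker_dim x) limg_cap_preim; congr (_ + _)%N.
rewrite -(limg_ker_dim x S) addnK -capvA; congr (\dim (_ :&: _))%VS.
apply/capv_idPr; apply/subvP => v; rewrite memv_ker -memv_preim => /eqP->.
exact: mem0v.
Qed.

Lemma dim_add_cap U B S : (U <= S)%VS ->
  (\dim (U + B) + \dim (B :&: S) = \dim (U + B :&: S) + \dim B)%N.
Proof.
move=> US; have := dimv_sum_cap U B; have := dimv_sum_cap U (B :&: S).
have -> : (U :&: (B :&: S) = U :&: B)%VS.
  by rewrite [(B :&: S)%VS]capvC capvA (capv_idPl US).
lia.
Qed.

Definition cotype_set S m (b : nat -> nat) : {set {vspace E}} :=
  [set B : {vspace E} | [&& (B <= S)%VS, stable B &
     [forall j : 'I_m, mod_cotype S B j == b j]]].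

(** The columns after the first of the type of S/B are the columns of the type
    of X(S/B), which is XS / (B \cap XS). *)
Lemma mod_cotypeS S B j : stable S ->
  mod_cotype S B j.+1 = mod_cotype (x @: S) (B :&: x @: S) j.
Proof.
move=> Sst; rewrite /mod_cotype !img_iterSr -/(img_iter _ _).
have S'st : stable (x @: S)%VS by apply: limgS.
have := dim_add_cap B (img_iter_sub j S'st).
have := dim_add_cap B (img_iter_sub j.+1 S'st).
rewrite !img_iterSr; lia.
Qed.

(** A subspace B with B \cap XS = B' is stable exactly when XB lies in B',
    that is when B lies in the preimage of B'. So the fibre over B' consists
    of the subspaces between B' and that preimage which meet XS in B'. *)
Lemma cotype_fiber S B' (e : nat) : stable S -> stable B' ->
  (B' <= x @: S)%VS ->
  [set B : {vspace E} | [&& (B <= S)%VS, stable B, (B :&: x @: S == B')%VS &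
     \dim B == (e + \dim B')%N]] =
  meeting B' (x @: S :&: x @^-1: B') (S :&: x @^-1: B') e.
Proof.
move=> Sst B'st B'S; apply/setP => B; rewrite !inE.
have preimP U V : (U <= x @^-1: V)%VS = (x @: U <= V)%VS.
  apply/subvP/subvP => h v.
    by case/memv_imgP => u uU ->; rewrite memv_preim h.
  by move=> vU; rewrite -memv_preim; apply/h/memv_img.
apply/idP/idP.
  case/and4P => BS Bst /eqP BB' ->; rewrite andbT.
  have B'B : (B' <= B)%VS by rewrite -BB' capvSl.
  have BP : (B <= x @^-1: B')%VS.
    by rewrite preimP -BB' subv_cap limgS // andbT.
  by rewrite B'B subv_cap BS BP capvA BB' /=; apply/eqP/capv_idPl; rewrite preimP.
case/and4P => B'B; rewrite subv_cap => /andP[-> BP] /eqP BQ ->; rewrite andbT /=.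
apply/andP; split; first by apply: subv_trans B'B; rewrite -preimP.
by rewrite -{1}(capv_idPl BP) -capvA [(x @^-1: _ :&: _)%VS]capvC BQ.
Qed.

(** The number of (a - b)-dimensional subspaces of an a-dimensional space that
    meet a given b'-dimensional subspace trivially. *)
Definition hall_factor (F : fieldType) (q : F) (a b b' : nat) : F :=
  if (b <= a)%N then
    \prod_(i < a - b) (q ^+ a - q ^+ (b' + i)) / \prod_(i < a - b) (q ^+ (a - b) - q ^+ i)
  else 0.

(** The first two columns of the type of S/B fix the dimensions in
    [cotype_fiber]: modulo B' the ambient space has dimension la'_1, the
    subspace to be avoided has dimension b 1, and B has dimension la'_1 - b 0.
    *)
Lemma card_cotype_fiber (F : numFieldType) S B' m b :
    stable S -> B' \in cotype_set (x @: S) m (fun j => b j.+1) ->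
    img_iter m (x @: S) = 0%VS -> (forall j, (m < j)%N -> b j = 0%N) ->
  #|[set B in cotype_set S m.+1 b | (B :&: x @: S == B')%VS]|%:R
  = hall_factor (#|k|%:R : F) (mod_type S 0) (b 0%N) (b 1%N).
Proof.
set q : F := #|k|%:R => Sst; rewrite inE => /and3P[B'S B'st /forallP cB'] S0 b0.
have S'S : (x @: S <= S)%VS := Sst.
have cB'0 : mod_cotype (x @: S) B' 0 = b 1%N.
  case: m cB' S0 b0 => [|m] cB' S0 b0; last by have /eqP := cB' ord0.
  rewrite b0 // /mod_cotype /=; move: S0 => /= S0.
  by rewrite S0 limg0 subnn.
have dQ : \dim (x @: S :&: x @^-1: B') = (\dim B' + b 1%N)%N.
  rewrite dim_cap_preim -cB'0 /mod_cotype /=.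
  have -> : (x @: S + B' = x @: S)%VS by apply/addv_idPl.
  have := dimv_sum_cap (x @: (x @: S)) B'.
  have : (\dim (x @: (x @: S) + B') <= \dim (x @: S))%N.
    by apply: dimvS; rewrite subv_add B'S limgS.
  have : (\dim (x @: (x @: S)) <= \dim (x @: S))%N by apply: dimvS; rewrite limgS.
  lia.
have dP : \dim (S :&: x @^-1: B') = (\dim B' + mod_type S 0)%N.
  rewrite dim_cap_preim (capv_idPr B'S) addnC; congr (_ + _)%N.
have cot0 B : (B <= S)%VS -> (B :&: x @: S = B')%VS ->
   (mod_cotype S B 0 + \dim B = mod_type S 0 + \dim B')%N.
  move=> BS BB'; rewrite /mod_cotype /mod_type /=.
  have -> : (S + B = S)%VS by apply/addv_idPl.
  have := dimv_sum_cap (x @: S) B; rewrite capvC BB'.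
  have : (\dim (x @: S + B) <= \dim S)%N by apply: dimvS; rewrite subv_add S'S BS.
  have := dimvS S'S; lia.
have q_gt1 : 1 < q by rewrite ltr1n finNzRing_gt1.
have q0 : q != 0 by rewrite gt_eqF // (lt_trans ltr01).
have qX i j : (i < j)%N -> q ^+ j - q ^+ i != 0.
  by move=> ij; rewrite subr_eq0 gt_eqF // ltr_eXn2l.
set A := [set _ in _ | _].
have AE : A = if (b 0%N <= mod_type S 0)%N then
    meeting B' (x @: S :&: x @^-1: B') (S :&: x @^-1: B') (mod_type S 0 - b 0%N)
  else finset.set0.
  rewrite -cotype_fiber //; case: ifP => ba; apply/setP => B; rewrite !inE.
    rewrite -!andbA; apply/idP/idP.
      case/and4P => BS -> /forallP cB /eqP BB'; rewrite BS BB' eqxx /=.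
      have := cot0 B BS BB'; have /eqP /= -> := cB ord0 => dB; apply/eqP.
      move: dB ba; set dd := \dim B; lia.
    case/and4P => BS Bst /eqP BB' /eqP dB; rewrite BS Bst BB' eqxx andbT /=.
    apply/forallP => -[[|j] jm]; rewrite /=.
      have := cot0 B BS BB'; rewrite dB => h; apply/eqP; move: h ba; lia.
    by rewrite mod_cotypeS // BB'; have := cB' (Ordinal (jm : (j < m)%N)).
  apply/negP => /andP[/and3P[BS Bst /forallP cB] /eqP BB'].
  have := cot0 B BS BB'; have /eqP /= -> := cB ord0.
  have : (\dim B' <= \dim B)%N by rewrite -BB' dimvS // capvSl.
  move: ba; lia.
rewrite AE /hall_factor; case: ifP => ba; last by rewrite cards0.
set e := (_ - _)%N.
have B'p : (B' <= x @^-1: B')%VS.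
  apply/subvP => v vB'; rewrite -memv_preim; apply: (subvP B'st); exact: memv_img.
have B'Q : (B' <= x @: S :&: x @^-1: B')%VS by rewrite subv_cap B'S.
have QP : (x @: S :&: x @^-1: B' <= S :&: x @^-1: B')%VS.
  by rewrite subv_cap capvSr (subv_trans (capvSl _ _) S'S).
have := @card_meeting k E F e _ _ _ B'Q QP; rewrite /= -/q dP dQ => H.
apply: (canRL (mulfK _)).
  by apply/prodf_neq0 => i _; apply: qX.
apply: (mulfI (_ : q ^+ \dim B' ^+ e != 0)); first by rewrite !expf_neq0.
have pullE (f g : nat -> nat) : q ^+ \dim B' ^+ e * \prod_(i < e) (q ^+ f i - q ^+ g i)
    = \prod_(i < e) (q ^+ (\dim B' + f i) - q ^+ (\dim B' + g i)).
  rewrite -[X in _ ^+ X * _](card_ord e) -prodr_const -big_split /=.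
  by apply: eq_bigr => i _; rewrite mulrBr -!exprD.
rewrite mulrCA (pullE (fun=> e) id) (pullE (fun=> mod_type S 0) (addn (b 1%N))) /=.
under eq_bigr do rewrite [(\dim B' + e)%N]addnC.
by under [RHS]eq_bigr do rewrite addnA.
Qed.

(** Induction along B |-> B \cap XS, which deletes the first column of both
    types; all fibres have the same size. *)
Theorem card_cotype_set (F : numFieldType) m : forall S b,
    stable S -> img_iter m S = 0%VS -> (forall j, (m <= j)%N -> b j = 0%N) ->
  #|cotype_set S m b|%:R
  = \prod_(j < m) hall_factor (#|k|%:R : F) (mod_type S j) (b j) (b j.+1).
Proof.
elim: m => [|m IHm] S b Sst S0 b0.
  rewrite big_ord0 (_ : cotype_set _ _ _ = [set 0%VS]) ?cards1 //.
  apply/setP => B; rewrite !inE; move: S0 => /= ->; rewrite subv0.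
  case: (eqVneq B 0%VS) => //= ->; rewrite /stable limg0 subvv.
  by apply/forallP => -[].
rewrite big_ord_recl /=.
have S'st : stable (x @: S)%VS by apply: limgS.
have S'0 : img_iter m (x @: S) = 0%VS by rewrite -img_iterSr.
transitivity (\sum_(B' in cotype_set (x @: S) m (fun j => b j.+1))
   hall_factor (#|k|%:R : F) (mod_type S 0) (b 0%N) (b 1%N)).
  rewrite -sum1_card (partition_big (fun B => (B :&: x @: S)%VS)
     (mem (cotype_set (x @: S) m (fun j => b j.+1)))) /=.
    rewrite natr_sum; apply: eq_bigr => B' B'A.
    rewrite -(card_cotype_fiber F Sst B'A) // -sum1_card; congr (_ %:R).
    by apply: eq_bigl => B; rewrite [in RHS]inE.
  move=> B; rewrite !inE => /and3P[BS Bst /forallP cB].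
  rewrite capvSr /=; apply/andP; split.
    rewrite /stable subv_cap (subv_trans (limgS _ (capvSl _ _)) Bst) /=.
    by rewrite limgS // (subv_trans (capvSl _ _) BS).
  apply/forallP => j; rewrite -mod_cotypeS //.
  by have := cB (lift ord0 j); rewrite /= /bump leq0n add1n.
rewrite sumr_const -[LHS]mulr_natr mulrC IHm //; last by move=> j mj; apply: b0.
rewrite mulrC; congr (_ * _); apply: eq_bigr => j _; rewrite /bump leq0n add1n.
by rewrite /mod_type !img_iterSr.
Qed.

End HallCount.

(** * Partitions and skew Hall polynomials *)

Section Partitions.
Local Open Scope nat_scope.
Implicit Types la mu : seq nat.

(** Both sides say that the cell in row i and column j belongs to the diagram.
    *)
Lemma leq_nth_conj la j i : sorted geq la -> 0 < j ->
  (j <= nth 0 la i) = (i < conj_part la j).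
Proof.
move=> + j0; rewrite /conj_part; elim: la i => [|x s IHs] i /=.
  by rewrite nth_nil leqNgt j0.
move=> xs; have ss := path_sorted xs.
case jx : (j <= x).
  by case: i => [|i] /=; rewrite ?jx // add1n ltnS IHs.
have sx : all (fun y => y < j) s.
  apply/allP => y ys; have /allP/(_ y ys) /= := order_path_min (rev_trans leq_trans) xs.
  by move=> yx; rewrite (leq_ltn_trans yx) // ltnNge jx.
have -> : count (leq j) s = 0.
  apply/eqP; rewrite -leqn0 leqNgt -has_count; apply/hasPn => y /(allP sx).
  by rewrite -ltnNge.
rewrite addn0 /= ltn0.
case: i => [|i] /=; first by rewrite jx.
apply/negbTE; rewrite -ltnNge; case: (ltnP i (size s)) => si.
  by apply: (allP sx); apply: mem_nth.
by rewrite nth_default.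
Qed.

Lemma part_subP la mu : sorted geq la -> sorted geq mu ->
  reflect (forall j, 0 < j -> conj_part mu j <= conj_part la j) (part_sub mu la).
Proof.
move=> sla smu; apply: (iffP allP) => [h j j0|h i _].
  rewrite leqNgt -leq_nth_conj //; apply/negP => jm.
  have := jm; rewrite leq_nth_conj // => lam.
  have imu : conj_part la j \in iota 0 (size mu).
    by rewrite mem_iota add0n /=; apply: leq_trans lam (count_size _ _).
  have := leq_trans jm (h _ imu); by rewrite leq_nth_conj // ltnn.
case: (posnP (nth 0 mu i)) => [->//|m0].
rewrite leq_nth_conj //; apply: leq_trans (h _ m0).
by rewrite -leq_nth_conj.
Qed.

Lemma conj_part1 la : is_partition la -> conj_part la 1 = size la.
Proof.
case/andP => _ n0; rewrite -[RHS]count_predT; apply/eq_in_count => x xla.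
by rewrite lt0n; apply: contraNneq n0 => <-.
Qed.

Lemma conj_part_inj la mu : is_partition la -> is_partition mu ->
  (forall j, conj_part la j.+1 = conj_part mu j.+1) -> la = mu.
Proof.
move=> pla pmu h; have [/andP[sla _] /andP[smu _]] := (pla, pmu).
apply: (@eq_from_nth _ 0); first by rewrite -!conj_part1.
move=> i _; apply/eqP; rewrite eqn_leq; apply/andP; split.
  by case E: (nth 0 la i) => [//|j]; rewrite leq_nth_conj // -h -leq_nth_conj // E.
by case E: (nth 0 mu i) => [//|j]; rewrite leq_nth_conj // h -leq_nth_conj // E.
Qed.

(** Lengthen every row of the partition with columns b 1, b 2, ... by one cell
    and add b 0 - b 1 rows of length one. *)
Lemma conj_part_exists m (b : nat -> nat) : (forall j, b j.+1 <= b j) ->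
  (forall j, m <= j -> b j = 0) ->
  exists2 la, is_partition la & forall j, conj_part la j.+1 = b j.
Proof.
elim: m b => [|m IHm] b bS b0; first by exists [::] => // j; rewrite b0.
have [] := IHm (fun j => b j.+1) => [j|j jm|la pla cla]; rewrite ?bS ?b0 //.
have [/andP[sla n0la]] := pla.
exists ([seq i.+1 | i <- la] ++ nseq (b 0 - b 1) 1); last first.
  move=> j; rewrite /conj_part count_cat count_map count_nseq.
  case: j => [|j] /=; last by rewrite mul0n addn0 -cla; apply: eq_count => i.
  rewrite (eq_count (a2 := predT)) // count_predT -conj_part1 // cla mul1n.
  by rewrite subnKC.
apply/andP; split; last first.
  by rewrite mem_cat mem_nseq negb_or andbF andbT; apply/mapP => -[].
rewrite (sorted_pairwise (rev_trans leq_trans)) pairwise_cat; apply/and3P; split.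
- apply/allrelP => i j /mapP[i' _ ->] /nseqP[-> _] //.
- rewrite -(sorted_pairwise (rev_trans leq_trans)) sorted_map.
  by apply: sub_sorted sla => i j.
- rewrite -(sorted_pairwise (rev_trans leq_trans)); case: (b 0 - b 1) => //= n.
  by elim: n => //= n ->.
Qed.

Lemma sumn_conj m la : all (fun i => i <= m) la ->
  sumn la = \sum_(j < m) conj_part la j.+1.
Proof.
elim: la => [|x s IHs] /=; first by rewrite big1.
case/andP => xm /IHs ->; rewrite -{1}[x](subnKC (leq0n x)) subn0.
rewrite [in RHS]/conj_part big_split /=; congr (_ + _).
rewrite -{1}(minn_idPr xm); elim: m {IHs xm} => [|m IHm]; first by rewrite big_ord0 min0n.
by rewrite big_ord_recr /= -IHm; case: (ltnP m x); lia.
Qed.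

Lemma all_leq_conj m la : all (fun i => i <= m) la <->
  (forall j, m <= j -> conj_part la j.+1 = 0).
Proof.
split=> [/allP h j mj|h].
  apply/eqP; rewrite -leqn0 leqNgt -has_count; apply/hasPn => i /h im.
  by rewrite -ltnNge ltnS; apply: leq_trans mj.
apply/allP => i ila; rewrite leqNgt; apply/negP => mi.
have := h m (leqnn m); apply/eqP; rewrite -lt0n -has_count; apply/hasP.
by exists i.
Qed.

End Partitions.

Section SkewHallProduct.
Variables (F : numFieldType) (q : F).
Hypothesis q_gt1 : 1 < q.

Let q0 : q != 0. Proof. by rewrite gt_eqF // (lt_trans ltr01). Qed.
Let qX i j : (i < j)%N -> q ^+ j - q ^+ i != 0.
Proof. by move=> ij; rewrite subr_eq0 gt_eqF // ltr_eXn2l. Qed.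

Lemma qpoch_inv_neq0 n : qpoch q^-1 q^-1 n != 0.
Proof.
apply/prodf_neq0 => i _; rewrite -exprS exprVn -[1](mulfV (expf_neq0 i.+1 q0)).
by rewrite -{2}[_^-1]mul1r -mulrBl mulf_neq0 ?invr_eq0 ?expf_neq0 // -[1](expr0 q) qX.
Qed.

Lemma prod_qpoch_inv N e : (e <= N)%N ->
  \prod_(i < e) (q ^+ N - q ^+ i) * qpoch q^-1 q^-1 (N - e)
  = q ^+ (N * e) * qpoch q^-1 q^-1 N.
Proof.
elim: e => [|e IHe] eN; first by rewrite big_ord0 subn0 muln0 expr0.
rewrite mulnSr exprD mulrAC -IHe 1?ltnW // big_ord_recr /= -!mulrA.
congr (_ * _); have -> : (N - e = (N - e.+1).+1)%N by lia.
rewrite [in RHS]/qpoch big_ord_recr /= -/(qpoch _ _ _) mulrC -mulrA.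
congr (_ * _); rewrite -exprS exprVn mulrBl mul1r; congr (_ - _).
have {2}-> : N = ((N - e.+1).+1 + e)%N by lia.
by rewrite exprD mulKf ?expf_neq0.
Qed.

(** Both sides count the same subspaces; passing from q to q^-1 extracts the
    power of q from the Gaussian binomial. *)
Lemma hall_factorE a b b' : (b' <= b)%N -> (b <= a)%N ->
  hall_factor q a b b' = q ^+ (b * (a - b)) * qbinom (a - b') (a - b) q^-1.
Proof.
move=> bb ba; rewrite /hall_factor ba /qbinom.
set e := (a - b)%N; set n := (a - b')%N.
have en : (e <= n)%N by rewrite /e /n; lia.
have den0 : \prod_(i < e) (q ^+ e - q ^+ i) != 0.
  by apply/prodf_neq0 => i _; apply: qX.
apply: (canLR (mulfK den0)); rewrite mulrA mulrAC.
apply: (canRL (mulfK _)); first by rewrite mulf_neq0 ?qpoch_inv_neq0.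
have := prod_qpoch_inv (leqnn e); rewrite subnn [qpoch _ _ 0]big_ord0 mulr1 => ->.
have -> : \prod_(i < e) (q ^+ a - q ^+ (b' + i)) =
   q ^+ (b' * e) * \prod_(i < e) (q ^+ n - q ^+ i).
  rewrite exprM -[X in _ ^+ X * _](card_ord e) -prodr_const -big_split /=.
  apply: eq_bigr => i _; rewrite mulrBr -!exprD; congr (_ ^+ _ - _).
  by rewrite /n; lia.
have := prod_qpoch_inv en; set Pr := \prod_(i < e) _ => PrE.
have expE : q ^+ (b' * e) * q ^+ (n * e) = q ^+ (b * e) * q ^+ (e * e).
  by rewrite -!exprD; congr (_ ^+ _); rewrite /n /e; nia.
move: expE PrE; move: (q ^+ (b' * e)) (q ^+ (n * e)) (q ^+ (b * e)) (q ^+ (e * e)).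
move: Pr (qpoch _ _ e) (qpoch _ _ n) (qpoch _ _ (n - e)) => Pr pe pn pd x1 x2 x3 x4 h1 h2.
transitivity (x1 * pe * (Pr * pd)); first by ring.
rewrite h2; transitivity (x1 * x2 * pe * pn); first by ring.
by rewrite h1; ring.
Qed.

Lemma conj_partS mu j : (conj_part mu j.+1 <= conj_part mu j)%N.
Proof. by apply: sub_count => i; apply: ltnW. Qed.

(** Beyond the largest part of la the factors are 1, so the product may run up
    to any common bound m. If mu is not contained in la, some column of mu is
    longer than that of la and its factor vanishes. *)
Lemma skew_hall_prod m la mu : sorted geq la -> sorted geq mu ->
  all (fun i => i <= m)%N la -> all (fun i => i <= m)%N mu ->
  skew_hall la mu q = \prod_(j < m)
    hall_factor q (conj_part la j.+1) (conj_part mu j.+1) (conj_part mu j.+2).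
Proof.
move=> sla smu lam mum; rewrite /skew_hall.
case: part_subP => // [h|/existsNP[j /not_implyP[j0 /negP]]]; last first.
  rewrite -ltnNge => lt; have jm : (j.-1 < m)%N.
    rewrite ltnNge; apply/negP => mj.
    have /all_leq_conj/(_ _ mj) : all (fun i => i <= m)%N mu by [].
    by rewrite prednK // => mu0; rewrite mu0 in lt.
  rewrite (bigD1 (Ordinal jm)) //= /hall_factor prednK //.
  by rewrite leqNgt lt mul0r.
set n := head 0%N la; have nm : (n <= m)%N.
  by rewrite /n; case: (la) lam => //= x s /andP[].
have lan j : (n <= j)%N -> conj_part la j.+1 = 0%N.
  move=> nj; apply/eqP; rewrite -leqn0 leqNgt -leq_nth_conj // nth0 -ltnNge.
  by rewrite ltnS.
rewrite !big_add1 /= -prodrXr -big_split /=.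
rewrite -[RHS](big_mkord predT (fun j => hall_factor q (conj_part la j.+1)
   (conj_part mu j.+1) (conj_part mu j.+2))) [RHS](big_cat_nat _ (n := n)) //=.
rewrite [X in _ = _ * X]big_nat_cond [X in _ = _ * X]big1 ?mulr1; last first.
  move=> i /andP[/andP[ni _] _].
  have := h i.+1 isT; rewrite lan // leqn0 => /eqP ->.
  have := h i.+2 isT; rewrite lan ?leqn0 1?leqW // => /eqP ->.
  by rewrite /hall_factor subnn !big_ord0 divr1.
by apply: eq_bigr => i _; rewrite hall_factorE ?conj_partS ?h.
Qed.

End SkewHallProduct.

(** * Summing over partitions and summing over submodules *)

Section CotypeMono.
Variables (k : finFieldType) (E : vectType k) (x : 'End(E)).
Implicit Types (B U V S W : {vspace E}).

Lemma dim_img_add U V B : (U <= V)%VS ->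
  (\dim (x @: V + B) - \dim (x @: U + B) <= \dim V - \dim U)%N.
Proof.
move=> UV; pose C := (V :\: U)%VS.
have dC : (\dim U + \dim C = \dim V)%N by rewrite -(dimv_cap_compl V U) (capv_idPr UV).
have VE : (V = C + U)%VS by rewrite /C addv_diff (addv_idPl UV).
have : (\dim (x @: V + B) <= \dim (x @: U + B) + \dim (x @: C))%N.
  rewrite VE limgD -addvA; apply: leq_trans (dimv_add_leqif _ _).1 _.
  by rewrite addnC.
have : (\dim (x @: C) <= \dim C)%N by rewrite -(limg_ker_dim x C) leq_addl.
by move: dC; clear; lia.
Qed.

(** Multiplication by X maps each layer of S/B onto the next one. *)
Lemma mod_cotype_decr S B j : stable x S -> stable x B ->
  (mod_cotype x S B j.+1 <= mod_cotype x S B j)%N.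
Proof.
elim: j S B => [|j IHj] S B Sst Bst; last first.
  have S'st : stable x (x @: S) by apply: limgS.
  rewrite [in leqRHS]mod_cotypeS // mod_cotypeS // IHj //.
  rewrite /stable subv_cap (subv_trans (limgS _ (capvSl _ _)) Bst) /=.
  by apply: limgS; apply: subv_trans (capvSr _ _) Sst.
rewrite /mod_cotype /=.
have := @dim_img_add (x @: S + B) (S + B) B.
rewrite !limgD -!addvA (addv_idPr Bst) => -> //.
by rewrite addvS.
Qed.

Lemma img_iter_ge0 S m j : img_iter x m S = 0%VS -> (m <= j)%N -> img_iter x j S = 0%VS.
Proof.
move=> S0; elim: j => [|j IHj]; first by case: m S0.
rewrite leq_eqVlt => /orP[/eqP <- //|/IHj jS].
by rewrite /img_iter iterS -/(img_iter x j S) jS limg0.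
Qed.

Lemma img_iter_mono U V j : (U <= V)%VS -> (img_iter x j U <= img_iter x j V)%VS.
Proof. by move=> UV; elim: j => // j IHj; apply: limgS. Qed.

Lemma mod_cotype0 S B m j : img_iter x m S = 0%VS -> (m <= j)%N ->
  mod_cotype x S B j = 0%N.
Proof.
by move=> S0 mj; rewrite /mod_cotype !(img_iter_ge0 S0) ?subnn // leqW.
Qed.

Lemma mod_cotype_partition S B m : stable x S -> stable x B ->
  img_iter x m S = 0%VS ->
  exists2 la, is_partition la & forall j, conj_part la j.+1 = mod_cotype x S B j.
Proof.
move=> Sst Bst S0; apply: (@conj_part_exists m) => j.
  exact: mod_cotype_decr.
exact: mod_cotype0.
Qed.

Lemma sum_mod_cotype S B m : stable x S ->
  (\sum_(j < m) mod_cotype x S B j = \dim (S + B) - \dim (img_iter x m S + B))%N.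
Proof.
move=> Sst; elim: m => [|m IHm]; first by rewrite big_ord0 subnn.
rewrite big_ord_recr /= IHm /mod_cotype addnBA ?subnK //.
  by apply: dimvS; rewrite addvS // img_iter_sub.
by apply: dimvS; rewrite addvS //= -[(x @: _)%VS]/(img_iter x m.+1 S) img_iterSr
  -/(img_iter x m S); apply: img_iter_mono.
Qed.

End CotypeMono.

Section HallSum.
Variables (k : finFieldType) (E : vectType k) (x : 'End(E)) (F : numFieldType).
Variables (m d : nat) (SW : {vspace E} -> {vspace E}).
Hypothesis x_nilp : img_iter x m fullv = 0%VS.
Hypothesis mod_type_full : forall j, (j < m)%N -> mod_type x fullv j = d.
Hypothesis SW_stable : forall W, stable x W -> stable x (SW W).
Hypothesis SW_type : forall W, stable x W ->
  forall j, mod_type x (SW W) j = mod_cotype x fullv W j.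
Let q : F := #|k|%:R.

Let q_gt1 : 1 < q. Proof. by rewrite ltr1n finNzRing_gt1. Qed.

Let nilp S : img_iter x m S = 0%VS.
Proof.
apply/eqP; rewrite -subv0 -x_nilp; elim: m => [|j IHj]; first exact: subvf.
exact: limgS.
Qed.

(** The columns of mu describe the quotient S/B rather than B. Over a discrete
    valuation ring the two counts agree by duality; the quotients are what
    lattices provide. *)
Lemma card_cotype_skew S la mu : stable x S ->
  sorted geq la -> sorted geq mu ->
  (forall j, conj_part la j.+1 = mod_type x S j) ->
  all (fun i => i <= m)%N mu ->
  #|cotype_set x S m (fun j => conj_part mu j.+1)|%:R = skew_hall la mu q.
Proof.
move=> Sst pla pmu laS mum; have mu0 := (all_leq_conj m mu).1 mum.
have lam : all (fun i => i <= m)%N la.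
  apply/all_leq_conj => j mj; rewrite laS /mod_type.
  by rewrite !(img_iter_ge0 (nilp S)) ?subnn // leqW.
rewrite (card_cotype_set F Sst (nilp S) mu0) (skew_hall_prod q_gt1 pla pmu lam mum).
by apply: eq_bigr => j _; rewrite laS.
Qed.

(** Group the pairs (W, B) by their cotypes (la, mu). The whole space has type
    (m^d) and SW W has the cotype of W as its type, so the number of pairs
    with given cotypes is the product of the two skew Hall polynomials. *)
Lemma sum_partition_cotype (Wt : seq nat -> seq nat -> F)
    (Wt' : {vspace E} -> {vspace E} -> F) :
  (forall W B la mu, stable x W -> (B <= SW W)%VS -> stable x B ->
     is_partition la -> is_partition mu ->
     (forall j, conj_part la j.+1 = mod_cotype x fullv W j) ->
     (forall j, conj_part mu j.+1 = mod_cotype x (SW W) B j) -> Wt la mu = Wt' W B) ->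
  \sum_(p \in [set: int_partition * int_partition]%classic)
     skew_hall (nseq d m) (sval p.1) q * skew_hall (sval p.1) (sval p.2) q
       * Wt (sval p.1) (sval p.2)
  = \sum_(W | stable x W) \sum_(B | (B <= SW W)%VS && stable x B) Wt' W B.
Proof.
move=> WtE; pose T : finType := ({vspace E} * {vspace E})%type.
pose valid (y : T) := [&& stable x y.1, (y.2 <= SW y.1)%VS & stable x y.2].
pose good (y : T) (p : int_partition * int_partition) :=
  (forall j, conj_part (sval p.1) j.+1 = mod_cotype x fullv y.1 j) /\
  (forall j, conj_part (sval p.2) j.+1 = mod_cotype x (SW y.1) y.2 j).
have fullst : stable x fullv by apply: subvf.
have pex y : exists p, valid y -> good y p.
  case vy : (valid y); last by exists (exist _ [::] isT, exist _ [::] isT).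
  case/and3P: vy => y1 _ y2.
  have [la pla cla] := mod_cotype_partition fullst y1 x_nilp.
  have [mu pmu cmu] := mod_cotype_partition (SW_stable y1) y2 (nilp _).
  by exists (exist _ la pla, exist _ mu pmu).
have [tau tauP] := choice pex.
have svalK (p p' : int_partition) : sval p = sval p' -> p = p'.
  by case: p p' => [p pp] [p' pp'] /= e; subst p'; congr exist; apply: bool_irrelevance.
have tau_uniq y p : valid y -> good y p -> tau y = p.
  move=> vy [g1 g2]; have [t1 t2] := tauP y vy.
  case: (tau y) p g1 g2 t1 t2 => [a b] [a' b'] /= g1 g2 t1 t2; congr pair.
    by apply/svalK/conj_part_inj => [||j]; [exact: (svalP a)|exact: (svalP a')|rewrite g1 t1].
  by apply/svalK/conj_part_inj => [||j]; [exact: (svalP b)|exact: (svalP b')|rewrite g2 t2].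
have cardP (p : int_partition * int_partition) :
    skew_hall (nseq d m) (sval p.1) q * skew_hall (sval p.1) (sval p.2) q
    = \sum_(y : T | valid y && (tau y == p)) 1.
  case: p => [[la pla] [mu pmu]] /=.
  have dm_sorted : sorted geq (nseq d m) by elim: (d) => //= n; case: n => //= n ->; rewrite leqnn.
  have pnseq : all (fun i => i <= m)%N (nseq d m) by rewrite all_nseq leqnn orbT.
  have conj0 la' mu' : sorted geq la' -> sorted geq mu' ->
      all (fun i => i <= m)%N la' -> ~~ all (fun i => i <= m)%N mu' ->
      skew_hall la' mu' q = 0.
    move=> s1 s2 l1 /negP l2; rewrite /skew_hall.
    case: part_subP => // h; case: l2; apply/all_leq_conj => j mj.
    by apply/eqP; rewrite -leqn0 -(proj1 (all_leq_conj m la') l1 j mj) h.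
  have goodm y p : valid y -> good y p ->
      all (fun i => i <= m)%N (sval p.1) && all (fun i => i <= m)%N (sval p.2).
    move=> vy [g1 g2]; apply/andP; split; apply/all_leq_conj => j mj.
      by rewrite g1 (mod_cotype0 _ x_nilp).
    by rewrite g2 (mod_cotype0 _ (nilp _)).
  case lam : (all (fun i => i <= m)%N la); last first.
    rewrite (conj0 (nseq d m) la) ?lam ?mul0r //; last by case/andP: pla.
    rewrite big_pred0 // => y; apply/negP => /andP[vy /eqP ty].
    by have := goodm y _ vy (tauP y vy); rewrite ty /= lam.
  case mum : (all (fun i => i <= m)%N mu); last first.
    have [sla smu] : sorted geq la /\ sorted geq mu by case/andP: pla; case/andP: pmu.
    rewrite (conj0 la mu) ?mum ?mulr0 // big_pred0 // => y.
    apply/negP => /andP[vy /eqP ty].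
    by have := goodm y _ vy (tauP y vy); rewrite ty /= lam mum.
  have [sla smu] : sorted geq la /\ sorted geq mu by case/andP: pla; case/andP: pmu.
  have la0 := (all_leq_conj m la).1 lam; have mu0 := (all_leq_conj m mu).1 mum.
  rewrite -(card_cotype_skew fullst) //; last first.
    move=> j; case: (ltnP j m) => jm; last first.
      by rewrite (all_leq_conj m _).1 // /mod_type !(img_iter_ge0 x_nilp) ?subnn // leqW.
    by rewrite mod_type_full // /conj_part count_nseq jm mul1n.
  rewrite -sum1_card natr_sum mulr_suml.
  transitivity (\sum_(W in cotype_set x fullv m (fun j => conj_part la j.+1))
     \sum_(B in cotype_set x (SW W) m (fun j => conj_part mu j.+1)) (1 : F)).
    apply: eq_bigr => W; rewrite inE => /and3P[_ Wst /forallP cW].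
    rewrite mul1r -(card_cotype_skew (SW_stable Wst)) ?sumr_const // => j.
    rewrite SW_type //; case: (ltnP j m) => jm.
      by have /eqP -> := cW (Ordinal jm).
    by rewrite la0 // (mod_cotype0 _ x_nilp).
  rewrite pair_big_dep /=; apply: eq_bigl => -[W B] /=; rewrite !inE subvf /=.
  apply/idP/idP.
    case/andP=> /andP[Wst /forallP cW] /and3P[BS Bst /forallP cB].
    have vy : valid (W, B) by rewrite /valid /= Wst BS Bst.
    rewrite vy /=; apply/eqP/tau_uniq => //; split=> j /=; case: (ltnP j m) => jm.
    - by have /eqP -> := cW (Ordinal jm).
    - by rewrite la0 // (mod_cotype0 _ x_nilp).
    - by have /eqP -> := cB (Ordinal jm).
    - by rewrite mu0 // (mod_cotype0 _ (nilp _)).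
  case/andP => vy /eqP ty; have := tauP _ vy; rewrite ty => -[/= g1 g2].
  case/and3P: vy => /= Wst BS Bst; rewrite Wst BS Bst /=.
  by apply/andP; split; apply/forallP => j; rewrite ?g1 ?g2.
rewrite (fsbigE (undup [seq tau y | y <- enum valid])) ?undup_uniq //; last first.
  move=> p _; rewrite mem_undup => /mapP pnin; rewrite cardP big_pred0 ?mul0r // => y.
  apply/negP => /andP[vy /eqP ty]; apply: pnin; exists y => //.
  by rewrite mem_enum.
under eq_bigl do rewrite in_setT.
under eq_bigr do rewrite cardP mulr_suml.
rewrite (exchange_big_dep valid) /=; last by move=> p y _ /andP[].
rewrite [RHS](eq_bigr (fun W => \sum_(B | valid (W, B)) Wt' W B)); last first.
  by move=> W Wst; apply: eq_bigl => B; rewrite /valid /= Wst.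
rewrite pair_big_dep /=; apply: eq_big => [[W B]|[W B] vy] /=.
  by rewrite /valid /=; case: (stable x W).
rewrite vy /= -big_filter.
have -> : [seq p <- undup [seq tau y | y <- enum valid] | tau (W, B) == p] = [:: tau (W, B)].
  rewrite (eq_filter (a2 := pred1 (tau (W, B)))); last by move=> p; rewrite /= eq_sym.
  apply: filter_pred1_uniq; first exact: undup_uniq.
  by rewrite mem_undup; apply/mapP; exists (W, B) => //; rewrite mem_enum.
rewrite big_seq1 mul1r; have [g1 g2] := tauP _ vy; case/and3P: vy => /= Wst BS Bst.
by apply: WtE => //; [exact: (svalP (tau (W, B)).1)|exact: (svalP (tau (W, B)).2)].
Qed.

End HallSum.

(** * Formal power series and coordinates on the cusp *)

Section FpsCoef.
Variable R : comNzRingType.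
Implicit Types (f g : fps R).

Lemma fcoefD f g n : fcoef (f + g) n = fcoef f n + fcoef g n. Proof. by []. Qed.
Lemma fcoefN f n : fcoef (- f) n = - fcoef f n. Proof. by []. Qed.
Lemma fcoefMn f j n : fcoef (f *+ j) n = fcoef f n *+ j.
Proof. by elim: j => [//|j IHj]; rewrite !mulrS fcoefD IHj. Qed.
Lemma fcoef_natM j f n : fcoef (j%:R * f) n = j%:R * fcoef f n.
Proof. by rewrite !mulr_natl fcoefMn. Qed.
Lemma fcoef_sum (I : Type) (r : seq I) (P : pred I) (F : I -> fps R) n :
  fcoef (\sum_(i <- r | P i) F i) n = \sum_(i <- r | P i) fcoef (F i) n.
Proof. by apply: (big_morph (fun f => fcoef f n)). Qed.
Lemma fcoef_varM f n : fcoef (fps_var R * f) n = if n is n'.+1 then fcoef f n' else 0.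
Proof.
rewrite /= ; case: n => [|n]; first by rewrite big_ord1 /= mul0r.
rewrite big_ord_recl /= mul0r add0r big_ord_recl /= mul1r subn1 big1 ?addr0 //.
by move=> i _; rewrite mul0r.
Qed.
Lemma fcoef_varXM f j n : fcoef (fps_var R ^+ j * f) n = if (j <= n)%N then fcoef f (n - j)%N else 0.
Proof.
elim: j n => [|j IHj] n; first by rewrite expr0 mul1r subn0.
rewrite exprS -mulrA fcoef_varM; case: n => [//|n]; rewrite IHj.
by rewrite ltnS subSS.
Qed.
Lemma fcoef_varX j n : fcoef (fps_var R ^+ j) n = (n == j)%:R.
Proof.
rewrite -[_ ^+ j]mulr1 fcoef_varXM /=; case: (ltngtP n j) => // [jn|->].
  by rewrite subn_eq0 leqNgt jn.
by rewrite subnn.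
Qed.

Lemma fps_varX_inj j : injective (fun f => fps_var R ^+ j * f).
Proof.
move=> f g e; apply: fpsP => n.
have : fcoef (fps_var R ^+ j * f) (n + j) = fcoef (fps_var R ^+ j * g) (n + j).
  by congr (fcoef _ _); exact: e.
by rewrite !fcoef_varXM leq_addl addnK.
Qed.
End FpsCoef.

Lemma Y_mul_identity (R : comNzRingType) (a b x y : R) :
  y * (a + b * y) = x * b + a * y + b * (y ^+ 2 - x).
Proof. by ring. Qed.

Section CuspStructure.
Local Open Scope quotient_scope.
Variables (k : fieldType) (m : nat).
Local Notation V := (fps k).
Local Notation p := (2 * m + 1)%N.
Local Notation XY := (fpsXY k).

Definition cusp_pi (f : XY) : cusp_ring k m :=
  \pi_{ideal_quot (cusp_ideal m : idealr XY)} f.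

Lemma cusp_piD f g : cusp_pi (f + g) = cusp_pi f + cusp_pi g.
Proof. exact: Quotient.pi_add. Qed.

Lemma cusp_piM f g : cusp_pi (f * g) = cusp_pi f * cusp_pi g.
Proof. exact: Quotient.pi_mul. Qed.

Lemma cusp_pi_eq f g : cusp_pi f = cusp_pi g <-> exists h, f = g + h * cusp_eqn k m.
Proof.
have idE u : (u \in (cusp_ideal m : idealr XY)) = cusp_ideal m u by [].
have := Quotient.idealrBE (cusp_ideal m : idealr XY) f g; rewrite idE => e.
split=> [fg|[h fE]].
  have : cusp_ideal m (f - g) by rewrite e; apply/eqP.
  by move=> /asboolP[h hE]; exists h; rewrite -hE addrC subrK.
have : cusp_ideal m (f - g) by apply/asboolP; exists h; rewrite fE addrC addKr.
by rewrite e => /eqP.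
Qed.

Lemma cusp_pi_surj r : exists f, cusp_pi f = r.
Proof. by exists (repr r); rewrite /cusp_pi reprK. Qed.

Lemma cusp_pi1 : cusp_pi 1 = 1.
Proof. by have [f fE] := cusp_pi_surj 1; rewrite -[LHS]mulr1 -fE -cusp_piM mul1r. Qed.

Lemma fps_constM (R : comNzRingType) (a : R) (f : fps R) n :
  fcoef (fps_const a * f) n = a * fcoef f n.
Proof.
rewrite /= big_ord_recl /= subn0 big1 ?addr0 // => i _.
by rewrite mul0r.
Qed.

Lemma fps_const_mul (R : comNzRingType) (a b : R) : fps_const (a * b) = fps_const a * fps_const b.
Proof. by apply: fpsP => n; rewrite fps_constM /=; case: eqP; rewrite ?mulr0. Qed.

Lemma fps_constD (R : comNzRingType) (a b : R) : fps_const (a + b) = fps_const a + fps_const b.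
Proof. by apply: fpsP => n; rewrite fcoefD /=; case: eqP; rewrite ?addr0. Qed.

Lemma fps_const1 (R : comNzRingType) : fps_const 1 = 1 :> fps R. Proof. by []. Qed.

Lemma fps_const0 (R : comNzRingType) : fps_const 0 = 0 :> fps R.
Proof. by apply: fpsP => n /=; case: eqP. Qed.

Lemma fps_constX (R : comNzRingType) (a : R) n : fps_const (a ^+ n) = fps_const a ^+ n.
Proof. by elim: n => [|n IHn]; rewrite ?fps_const1 // !exprS fps_const_mul IHn. Qed.

Definition emb (a b : V) : XY := fps_const a + fps_const b * fps_var V.

Lemma fcoef_emb a b n : fcoef (emb a b) n = if n == 0%N then a else if n == 1%N then b else 0.
Proof. by rewrite /emb fcoefD fps_constM; case: n => [|[|n]] /=; rewrite ?mulr0 ?mulr1 ?addr0 ?add0r. Qed.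

Lemma fcoef_mul_eqn (g : XY) n : fcoef (g * cusp_eqn k m) n =
  (if (2 <= n)%N then fcoef g (n - 2) else 0) - fps_var k ^+ p * fcoef g n.
Proof.
rewrite /cusp_eqn mulrBr [g * _]mulrC [g * varX k ^+ _]mulrC fcoefD fcoefN.
by rewrite fcoef_varXM /varX -fps_constX fps_constM.
Qed.

(** A relation a + bY = a' + b'Y + h (Y^2 - X^(2m+1)) forces h_j = X^(2m+1)
    h_(j+2) for the coefficients of h, so every power of X divides them. *)
Lemma emb_uniq a b a' b' : cusp_pi (emb a b) = cusp_pi (emb a' b') -> a = a' /\ b = b'.
Proof.
move=> /cusp_pi_eq[h].
move: (fcoef_emb a b) (fcoef_emb a' b'); move: (emb a b) (emb a' b') => e e' eE e'E hE.
have hrec j : fcoef h j = fps_var k ^+ p * fcoef h j.+2.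
  have : fcoef e j.+2 = fcoef (e' + h * cusp_eqn k m) j.+2 by rewrite -hE.
  rewrite [in RHS]fcoefD eE e'E fcoef_mul_eqn /= add0r subn2 /= => /esym/eqP.
  by rewrite subr_eq0 => /eqP.
have h0 n : forall j, fcoef (fcoef h j) n = 0.
  have [N] := ubnP n; elim: N n => // N IHN n; rewrite ltnS => nN j.
  rewrite hrec fcoef_varXM; case: ifP => // pn; apply: IHN.
  by move: pn nN; clear; lia.
have hz : h = 0 by apply: fpsP => j; apply: fpsP => n; apply: h0.
have ee : e = e' by rewrite hE hz mul0r addr0.
have e0 : fcoef e 0 = fcoef e' 0 by rewrite ee.
have e1 : fcoef e 1 = fcoef e' 1 by rewrite ee.
by rewrite eE e'E in e0; rewrite eE e'E in e1.
Qed.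

(** Weierstrass division by Y^2 - X^(2m+1): the quotient h has to satisfy h_j
    = f_(j+2) + X^(2m+1) h_(j+2), which is solved X-adically by h_j = sum_i
    X^((2m+1)i) f_(j+2+2i). *)
Lemma emb_exists f : exists a b, cusp_pi f = cusp_pi (emb a b).
Proof.
pose term j n i := if (p * i <= n)%N then fcoef (fcoef f (j + 2 + 2 * i)) (n - p * i)%N else 0.
pose G j n := \sum_(0 <= i < n.+1) term j n i.
have Gwide j n N : (n < N)%N -> G j n = \sum_(0 <= i < N) term j n i.
  move=> nN; rewrite [RHS](@big_cat_nat _ _ _ n.+1) //= [X in _ + X]big_nat_cond [X in _ + X]big1 ?addr0 //.
  move=> i /andP[/andP[ni _] _]; rewrite /term ifF //; apply/negbTE.
  by rewrite -ltnNge; move: ni; clear; nia.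
pose h : XY := FPS (fun j => FPS (G j)).
have hrec j : fcoef h j = fcoef f j.+2 + fps_var k ^+ p * fcoef h j.+2.
  apply: fpsP => n; rewrite fcoefD fcoef_varXM; cbn [fcoef h].
  rewrite {1}/G big_nat_recl // {1}/term muln0 subn0 leq0n addn0 addn2; congr (_ + _).
  case: leqP => pn.
    rewrite (@Gwide _ _ n); last by move: pn; clear; lia.
    apply: eq_bigr => i _; rewrite /term.
    have -> : (p * i.+1 <= n)%N = (p * i <= n - p)%N by move: pn; clear; nia.
    case: ifP => // _; congr (fcoef (fcoef f _) _); first by lia.
    by move: pn; clear; nia.
  rewrite big1 // => i _; rewrite /term ifF //; apply/negbTE; rewrite -ltnNge.
  by move: pn; clear; nia.
clearbody h; exists (fcoef f 0%N + fps_var k ^+ p * fcoef h 0%N), (fcoef f 1%N + fps_var k ^+ p * fcoef h 1%N).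
apply/cusp_pi_eq; exists h; apply: fpsP => j; rewrite fcoefD fcoef_emb fcoef_mul_eqn.
case: j => [|[|j]] /=; rewrite ?sub0r ?addrK //.
by rewrite subn2 /= add0r hrec addrK.
Qed.

Lemma cusp_coords r : exists ab, r = cusp_pi (emb ab.1 ab.2).
Proof.
have [f <-] := cusp_pi_surj r; have [a [b ->]] := emb_exists f.
by exists (a, b).
Qed.

(** The coordinates of an element of R in its basis 1, Y over k[[X]]. *)
Definition crd (r : cusp_ring k m) : V * V := sval (cid (cusp_coords r)).

Lemma crdK r : cusp_pi (emb (crd r).1 (crd r).2) = r.
Proof. by rewrite /crd; case: cid. Qed.

Lemma crd_pi a b : crd (cusp_pi (emb a b)) = (a, b).
Proof.
have := crdK (cusp_pi (emb a b)); case: (crd _) => a' b' /=.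
by move/emb_uniq => [-> ->].
Qed.

Lemma crd_inj r r' : crd r = crd r' -> r = r'.
Proof. by move=> e; rewrite -(crdK r) e crdK. Qed.

Lemma crdD r r' : crd (r + r') = ((crd r).1 + (crd r').1, (crd r).2 + (crd r').2).
Proof.
rewrite -{1}(crdK r) -{1}(crdK r') -cusp_piD -[RHS]crd_pi; congr (crd (cusp_pi _)).
by rewrite /emb !fps_constD mulrDl addrACA.
Qed.

Lemma crd0 : crd 0 = (0, 0).
Proof.
have := crdD 0 0; rewrite addr0; case: (crd 0) => a b /= [e1 e2].
by congr pair; [apply: (addrI a)|apply: (addrI b)]; rewrite addr0.
Qed.

Lemma crdN r : crd (- r) = (- (crd r).1, - (crd r).2).
Proof.
have := crdD r (- r); rewrite subrr crd0.
case: (crd r) => a b; case: (crd (- r)) => a' b' e.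
have e1 : 0 = a + a' by have := congr1 fst e.
have e2 : 0 = b + b' by have := congr1 snd e.
by congr pair; [apply: (addrI a)|apply: (addrI b)]; rewrite subrr.
Qed.

Definition cuspC (a : V) : cusp_ring k m := cusp_pi (emb a 0).
Definition Ygen : cusp_ring k m := cusp_pi (emb 0 1).

Lemma crd_cuspCM a r : crd (cuspC a * r) = (a * (crd r).1, a * (crd r).2).
Proof.
rewrite -{1}(crdK r) -cusp_piM -[RHS]crd_pi; congr (crd (cusp_pi _)).
by rewrite /emb fps_const0 mul0r addr0 mulrDr mulrA !fps_const_mul.
Qed.

Lemma crd_YM r : crd (Ygen * r) = (fps_var k ^+ p * (crd r).2, (crd r).1).
Proof.
rewrite -{1}(crdK r) -cusp_piM -[RHS]crd_pi; congr crd.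
apply/cusp_pi_eq; exists (fps_const (crd r).2).
case: (crd r) => a b /=.
rewrite /emb fps_const0 add0r fps_const1 mul1r /cusp_eqn /varX /varY.
rewrite fps_const_mul fps_constX.
by move: (fps_const a) (fps_const b) (fps_const _ ^+ _) (fps_var V); apply: Y_mul_identity.
Qed.

Lemma cuspC_Y_decomp r : r = cuspC (crd r).1 + cuspC (crd r).2 * Ygen.
Proof.
have crdC : crd (cuspC (crd r).1) = ((crd r).1, 0) by apply: crd_pi.
have crdY : crd Ygen = (0, 1) by apply: crd_pi.
apply: crd_inj; rewrite crdD crd_cuspCM.
move: (cuspC _) Ygen crdC crdY => c y -> ->.
case: (crd r) => a b; congr (_, _); first by rewrite mulr0 addr0.
by rewrite mulr1 add0r.
Qed.

Lemma cuspC1 : cuspC 1 = 1.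
Proof. by rewrite /cuspC /emb fps_const1 fps_const0 mul0r addr0 cusp_pi1. Qed.

Lemma cuspCM a b : cuspC (a * b) = cuspC a * cuspC b.
Proof. by apply: crd_inj; rewrite crd_cuspCM /cuspC !crd_pi /= mulr0. Qed.

Lemma cuspCX a n : cuspC (a ^+ n) = cuspC a ^+ n.
Proof. by elim: n => [|n IHn]; rewrite ?cuspC1 // !exprS cuspCM IHn. Qed.

Lemma cuspCB a b : cuspC (a - b) = cuspC a - cuspC b.
Proof. by apply: crd_inj; rewrite crdD crdN /cuspC !crd_pi /= subr0. Qed.

End CuspStructure.

Local Open Scope classical_set_scope.

(** * Indices of subgroups *)

Section Index.
Implicit Types G H : zmodType.

Definition subgroup G (N : set G) : Prop :=
  N 0 /\ forall u v, N u -> N v -> N (u - v).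

Definition has_index G (N : set G) (n : nat) : Prop :=
  exists (I : finType) (s : I -> G), [/\ #|I| = n,
    forall x, exists i, N (x - s i) & forall i j, N (s i - s j) -> i = j].

Lemma subgroupD G (N : set G) u v : subgroup N -> N u -> N v -> N (u + v).
Proof.
by move=> [N0 NB] Nu Nv; rewrite -[v]opprK -[- v]add0r; apply: (NB) => //; rewrite sub0r -sub0r; apply: NB.
Qed.

Lemma has_index_leq G (N N' : set G) n n' : subgroup N -> subgroup N' -> N `<=` N' ->
  has_index N n -> has_index N' n' -> (n' <= n)%N.
Proof.
move=> gN gN' NN' [I [s [<- sT sI]]] [J [t [<- tT tI]]].
have [f fP] := choice (fun j => sT (t j)).
apply: (@leq_card _ _ f) => j j' e; apply: tI.
have -> : t j - t j' = (t j - s (f j)) - (t j' - s (f j')) by rewrite e opprB addrC addrA subrK addrC.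
by apply: gN'.2; apply: NN'.
Qed.

Lemma has_index_uniq G (N : set G) n n' : subgroup N ->
  has_index N n -> has_index N n' -> n = n'.
Proof.
by move=> gN h h'; apply/eqP; rewrite eqn_leq (has_index_leq gN gN _ h h') ?(has_index_leq gN gN _ h' h).
Qed.

(** If the indices were equal, representatives modulo N would remain
    inequivalent modulo N', and N' would be contained in N. *)
Lemma has_index_ltn G (N N' : set G) n n' : subgroup N -> subgroup N' -> N `<=` N' ->
  ~ (N' `<=` N) -> has_index N n -> has_index N' n' -> (n' < n)%N.
Proof.
move=> gN gN' NN' N'N hn hn'; rewrite ltn_neqAle (has_index_leq gN gN' NN' hn hn') andbT.
apply/eqP => nn'; apply: N'N => x N'x; subst n'.
have [[I [s [sn sT sI]]] [J [t [tn tT tI]]]] := (hn, hn').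
have [f fP] := choice (fun j => sT (t j)).
have f_inj : injective f.
  move=> j j' e; apply: tI.
  have -> : t j - t j' = (t j - s (f j)) - (t j' - s (f j')) by rewrite e opprB addrC addrA subrK addrC.
  by apply: gN'.2; apply: NN'.
have f_surj i : exists j, f j = i.
  have /codomP[j ->] : i \in codom f by apply: (inj_card_onto f_inj); rewrite sn tn.
  by exists j.
have sepN' i i' : N' (s i - s i') -> i = i'.
  have [[j <-] [j' <-]] := (f_surj i, f_surj i') => h; congr f; apply: tI.
  have -> : t j - t j' = (t j - s (f j)) + (s (f j) - s (f j')) - (t j' - s (f j')).
    by rewrite [X in _ = X - _]addrA subrK opprB addrA subrK.
  by apply: gN'.2; [apply: subgroupD => //; apply: NN'|apply: NN'].
have [[i xi] [i0 xi0]] := (sT x, sT 0).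
have ii0 : i = i0.
  apply: sepN'; have -> : s i - s i0 = x - (x - s i) + (0 - s i0).
    by rewrite opprB sub0r [x + _]addrC subrK.
  by apply: subgroupD => //; [apply: gN'.2 => //|]; apply: NN'.
have -> : x = (x - s i) - (0 - s i0) by rewrite ii0 sub0r opprK subrK.
exact: gN.2.
Qed.

Lemma has_index_image G H (f : G -> H) (N : set G) a b :
  (forall u v, f (u - v) = f u - f v) -> injective f ->
  has_index N a -> has_index (range f) b -> has_index (f @` N) (b * a).
Proof.
move=> fB finj [I [s [<- sT sI]]] [J [t [<- tT tI]]].
exists (J * I)%type, (fun p => t p.1 + f (s p.2)); split; first by rewrite card_prod.
  move=> x; have [j [y _ yE]] := tT x; have [i Ni] := sT y; exists (j, i) => /=.
  by exists (y - s i) => //; rewrite fB yE opprD addrA.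
move=> [j i] [j' i'] /= [y Ny] e.
have jj' : j = j'.
  apply: tI; exists (y - (s i - s i')) => //; rewrite !fB e.
  by rewrite opprD addrACA addrK.
congr pair => //; apply: sI; suff <- : y = s i - s i' by [].
by apply: finj; rewrite e fB jj' opprD addrACA subrr add0r.
Qed.

End Index.

(** * Lattices of power series vectors *)

Section Sequences.
Variables (k : finFieldType) (d : nat).
Local Notation Q := (nat -> 'rV[k]_d).
Implicit Types (f g u v : Q) (N D : set Q).

(** A sequence f stands for the vector of power series sum_n f_n T^n, and sh
    is multiplication by T. *)
Definition sh f : Q := fun n => if n is n'.+1 then f n' else 0.
Definition vanish K : set Q := [set f | forall n, (n < K)%N -> f n = 0].
(** Only k-linearity and openness are required here: lattices over k[[T]],
    over k[[X]] and over the cusp all occur, and differ by the powers of T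
    that preserve them. *)
Definition lattice N := is_submodule (N : set (nat -> 'rV[k]_d)) /\
  exists K, vanish K `<=` N.
Definition sh_stable (r : nat) N := forall f, N f -> N (iter r sh f).
(** The injective k[T]-linear maps; they are automatically T-adically
    continuous ([shlin_vanish]). *)
Definition shlin (g : Q -> Q) := [/\ forall a u v, g (a *: u + v) = a *: g u + g v,
  forall f, g (sh f) = sh (g f) & injective g].

Lemma submodD N u v : is_submodule N -> N u -> N v -> N (u + v).
Proof. by move=> [_ NP] Nu Nv; rewrite -[u]scale1r; apply: NP. Qed.
Lemma submodZ N a u : is_submodule N -> N u -> N (a *: u).
Proof. by move=> [N0 NP] Nu; rewrite -[_ *: u]addr0; apply: NP. Qed.
Lemma submodN N u : is_submodule N -> N u -> N (- u).
Proof. by move=> NP Nu; rewrite -scaleN1r; apply: submodZ. Qed.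
Lemma submodB N u v : is_submodule N -> N u -> N v -> N (u - v).
Proof. by move=> NP Nu Nv; apply: submodD => //; apply: submodN. Qed.
Lemma submod_subgroup N : is_submodule N -> subgroup N.
Proof. by move=> NP; split; [case: NP|move=> u v; apply: submodB]. Qed.
Lemma submod_sum N (I : Type) (r : seq I) (P : pred I) (F : I -> Q) :
  is_submodule N -> (forall i, P i -> N (F i)) -> N (\sum_(i <- r | P i) F i).
Proof.
move=> NP h; elim/big_ind: _ => //; first by case: NP.
by move=> u v; apply: submodD.
Qed.

Lemma sh_lin a u v : sh (a *: u + v) = a *: sh u + sh v.
Proof. by apply/funext => -[|n] /=; rewrite !fctE /= ?scaler0 ?addr0. Qed.

Lemma sh0 : sh 0 = 0.
Proof. by apply/funext => -[]. Qed.

Lemma iter_shE r f n : iter r sh f n = if (n < r)%N then 0 else f (n - r)%N.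
Proof.
elim: r n => [|r IHr] n; first by rewrite subn0.
by case: n => [|n] //=; rewrite IHr.
Qed.

Lemma iter_sh_lin r a u v : iter r sh (a *: u + v) = a *: iter r sh u + iter r sh v.
Proof. by elim: r => //= r ->; rewrite sh_lin. Qed.

Lemma vanishP K f : vanish K f <-> exists f', f = iter K sh f'.
Proof.
split=> [h|[f' ->] n nK]; last by rewrite iter_shE nK.
exists (fun n => f (n + K)%N); apply/funext => n; rewrite iter_shE.
by case: ltnP => nK; [apply: h|rewrite subnK].
Qed.

Lemma vanish_submod K : is_submodule (vanish K).
Proof.
split=> [n _ //|a u v hu hv n nK].
by rewrite !fctE /= hu // hv // scaler0 addr0.
Qed.

Lemma vanish_le K K' : (K <= K')%N -> vanish K' `<=` vanish K.
Proof. by move=> KK f h n nK; apply: h; apply: leq_trans nK _. Qed.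

Lemma iter_sh_inj r : injective (iter r sh).
Proof.
move=> u v /(congr1 (fun f : Q => fun n => f (n + r)%N)) /funeqP e; apply/funext => n.
by have := e n; rewrite !iter_shE ltnNge leq_addl /= addnK.
Qed.

Lemma sh_stable_iter r N j f : sh_stable r N -> N f -> N (iter (r * j) sh f).
Proof.
move=> Nst Nf; elim: j => [|j IHj]; first by rewrite muln0.
by rewrite mulnS iterD; apply: Nst.
Qed.

Section Shlin.
Variable g : Q -> Q.
Hypothesis gP : shlin g.
Lemma shlinP a u v : g (a *: u + v) = a *: g u + g v. Proof. by case: gP. Qed.
Lemma shlin_sh f : g (sh f) = sh (g f). Proof. by case: gP. Qed.
Lemma shlin_inj : injective g. Proof. by case: gP. Qed.
Lemma shlin0 : g 0 = 0.
Proof. by have := shlinP (-1) 0 0; rewrite scaler0 addr0 scaleN1r addNr. Qed.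
Lemma shlinD u v : g (u + v) = g u + g v.
Proof. by have := shlinP 1 u v; rewrite !scale1r. Qed.
Lemma shlinZ a u : g (a *: u) = a *: g u.
Proof. by have := shlinP a u 0; rewrite shlin0 !addr0. Qed.
Lemma shlinB u v : g (u - v) = g u - g v.
Proof. by rewrite shlinD -scaleN1r shlinZ scaleN1r. Qed.
Lemma shlin_iter r f : g (iter r sh f) = iter r sh (g f).
Proof. by elim: r => //= r <-; rewrite shlin_sh. Qed.

Lemma shlin_image_submod N : is_submodule N -> is_submodule (g @` N).
Proof.
move=> [N0 NP]; split; first by exists 0; rewrite ?shlin0.
by move=> a _ _ [u Nu <-] [v Nv <-]; exists (a *: u + v); [apply: NP|rewrite shlinP].
Qed.

Lemma shlin_preimage_submod N : is_submodule N -> is_submodule (g @^-1` N).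
Proof.
move=> [N0 NP]; split; first by rewrite /preimage /= shlin0.
by move=> a u v; rewrite /preimage /= => Nu Nv; rewrite shlinP; apply: NP.
Qed.

Lemma shlin_vanish K f : vanish K f -> vanish K (g f).
Proof.
by move=> /vanishP[f' ->]; apply/vanishP; exists (g f'); rewrite shlin_iter.
Qed.

Lemma shlin_image_lattice N : lattice (range g) -> lattice N -> lattice (g @` N).
Proof.
move=> [_ [K gK]] [Nsub [K' NK']]; split; first exact: shlin_image_submod.
exists (K + K')%N => f /vanishP[f' ->]; rewrite addnC iterD.
have [|f'' _ fE] := gK (iter K sh f'); first by apply/vanishP; exists f'.
exists (iter K' sh f''); last by rewrite shlin_iter fE.
by apply: NK'; apply/vanishP; exists f''.
Qed.

Lemma shlin_preimage_lattice N : lattice N -> lattice (g @^-1` N).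
Proof.
move=> [Nsub [K NK]]; split; first exact: shlin_preimage_submod.
by exists K => f /shlin_vanish h; apply: NK.
Qed.

Lemma shlin_image_stable r N : sh_stable r (g @` N) <-> sh_stable r N.
Proof.
split=> st f.
  move=> Nf; have [|f' Nf' e] := st (g f); first by exists f.
  by move: e; rewrite -shlin_iter => /shlin_inj <-.
by move=> [f' Nf' <-]; exists (iter r sh f'); [apply: st|rewrite shlin_iter].
Qed.

Lemma shlin_preimage_stable r N : sh_stable r N -> sh_stable r (g @^-1` N).
Proof. by move=> st f Nf; rewrite /preimage /= shlin_iter; apply: st. Qed.
End Shlin.

Lemma shlin_id : shlin id. Proof. by split. Qed.
Lemma shlin_comp (g g' : Q -> Q) : shlin g -> shlin g' -> shlin (g \o g').
Proof.
move=> gP gP'; split=> [a u v|f|u v] /=.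
- by rewrite (shlinP gP') (shlinP gP).
- by rewrite (shlin_sh gP') (shlin_sh gP).
- by move=> /(shlin_inj gP) /(shlin_inj gP').
Qed.

Lemma latticeT : lattice setT. Proof. by split; [|exists 0%N]. Qed.

(** For J full this is surjectivity of N onto k[[T]]^d modulo T. *)
Definition onto N (J : {set 'I_d}) := forall y : 'rV[k]_d,
  exists2 f, N f & forall i, i \in J -> f 0%N 0 i = y 0 i.

(** Nakayama's lemma. Approximate f by elements of N one coefficient at a
    time, until the error lies in T^K k[[T]]^d, hence in N. *)
Lemma onto_full N : lattice N -> sh_stable 1 N -> onto N finset.setT -> N = setT.
Proof.
move=> [Nsub [K NK]] Nst Non; apply/seteqP; split=> // f _.
have app n : exists2 h, N h & vanish n (f - h).
  elim: n => [|n [h Nh /vanishP[f' fE]]]; first by exists 0 => //; case: Nsub.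
  have [h' Nh' h'E] := Non (f' 0%N).
  exists (h + iter n sh h').
    by apply: submodD => //; rewrite -[n]mul1n; apply: sh_stable_iter.
  move=> j; rewrite ltnS => jn; rewrite opprD addrA fE.
  have -> : iter n sh f' - iter n sh h' = iter n sh (f' - h').
    by rewrite addrC [f' - h']addrC -!scaleN1r iter_sh_lin.
  rewrite iter_shE; case: ltnP => // nj; have -> : j = n by apply/eqP; rewrite eqn_leq jn.
  rewrite subnn; apply/rowP => i; have := h'E i (finset.in_setT i).
  by rewrite !fctE !mxE => ->; rewrite subrr.
have [h Nh /NK fh] := app K.
by rewrite -[f](subrK h); apply: submodD.
Qed.

End Sequences.
Arguments sh {k d} f _.

(** * Hyperplane lattices and the Smith normal form *)

Section Hyperplane.
Variables (k : finFieldType) (d : nat).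
Local Notation Q := (nat -> 'rV[k]_d).
Implicit Types (f g u v : Q) (N D : set Q) (l : 'rV[k]_d).

(** An element of N whose constant term vanishes on J but not at i would make
    N onto J and i. So the i-th constant term is determined by those in J,
    linearly. *)
Lemma graph_form N (J : {set 'I_d}) i : is_submodule N -> i \notin J ->
  onto N J -> ~ onto N (i |: J)%SET ->
  exists2 l : 'rV[k]_d, (forall a, a \notin J -> l 0 a = 0) &
    forall f, N f -> f 0%N 0 i = \sum_a l 0 a * f 0%N 0 a.
Proof.
move=> Nsub iJ Non NnonI.
have key f : N f -> (forall a, a \in J -> f 0%N 0 a = 0) -> f 0%N 0 i = 0.
  move=> Nf fJ; apply/eqP/negP => /negP fi; apply: NnonI => y.
  have [h Nh hy] := Non y.
  exists (h + ((y 0 i - h 0%N 0 i) / f 0%N 0 i) *: f).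
    by apply: submodD => //; apply: submodZ.
  move=> a; rewrite finset.in_setU1 ?fctE !mxE => /orP[/eqP ->|aJ].
    by rewrite divfK // addrC subrK.
  by rewrite (fJ a) // mulr0 addr0 hy.
have [h hP] := choice (fun a : 'I_d => let: ex_intro2 f Nf fE := Non (delta_mx 0 a) in
  ex_intro (fun f => N f /\ forall b, b \in J -> f 0%N 0 b = (delta_mx 0 a : 'rV[k]_d) 0 b) f (conj Nf fE)).
exists (\row_a (if a \in J then h a 0%N 0 i else 0)) => [a aJ|f Nf].
  by rewrite mxE (negPf aJ).
pose s := \sum_(a in J) f 0%N 0 a *: h a.
have sE b : s 0%N 0 b = \sum_(a in J) f 0%N 0 a * h a 0%N 0 b.
  rewrite /s; elim/big_rec2: _ => [|a x y _ <-]; first by rewrite mxE.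
  by rewrite ?fctE !mxE.
have Ns : N s by apply: submod_sum => // a _; apply: submodZ => //; case: (hP a).
have /key : N (f - s) by apply: submodB.
rewrite ?fctE !mxE sE => e; apply/eqP; rewrite -subr_eq0.
rewrite [X in _ - X](_ : _ = \sum_(a in J) f 0%N 0 a * h a 0%N 0 i).
  rewrite e // => b bJ; rewrite ?fctE !mxE sE (bigD1 b) //= (hP b).2 // mxE !eqxx mulr1.
  rewrite big1 ?addr0 ?subrr // => a /andP[aJ ab].
  by rewrite (hP a).2 // mxE eqxx eq_sym (negPf ab) mulr0.
rewrite [RHS]big_mkcond; apply: eq_bigr => a _; rewrite mxE.
by case: ifP => _; rewrite ?mul0r // mulrC.
Qed.

(** The substitution f_i |-> T f_i + sum_b l_b f_b on the i-th coordinate. If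
    l_i = 0, its image is the lattice of all f with f_i(0) = l(f(0)). *)
Definition hyp (i : 'I_d) l f : Q := fun n => \row_a
  (if a == i then sh f n 0 i + \sum_b l 0 b * f n 0 b else f n 0 a).

Section Hyp.
Variables (i : 'I_d) (l : 'rV[k]_d).
Hypothesis li : l 0 i = 0.

Lemma hyp_shlin : shlin (hyp i l).
Proof.
split.
- move=> a u v; apply/funext => n; apply/rowP => b; rewrite {1}/hyp mxE sh_lin ?fctE !mxE.
  case: ifP => // _; rewrite mulrDr addrACA; congr (_ + _).
  rewrite mulr_sumr -big_split /=; apply: eq_bigr => j _.
  by rewrite !mxE mulrDr mulrCA.
- move=> f; apply/funext => -[|n]; apply/rowP => b; rewrite !mxE //=.
  by case: ifP => // _; rewrite big1 ?addr0 ?mxE // => j _; rewrite mxE mulr0.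
- move=> u v uv; have off n b : b != i -> u n 0 b = v n 0 b.
    by move=> bi; have := congr1 (fun f : Q => f n 0 b) uv; rewrite !mxE (negPf bi).
  apply/funext => n; apply/rowP => b; case: (eqVneq b i) => [->|]; last exact: off.
  have := congr1 (fun f : Q => f n.+1 0 i) uv; rewrite !mxE eqxx /=.
  rewrite (eq_bigr (fun b => l 0 b * v n.+1 0 b)) => [/addIr //|j _].
  by case: (eqVneq j i) => [->|ji]; rewrite ?li ?mul0r // off.
Qed.

Lemma hyp_range f :
  range (hyp i l) f <-> f 0%N 0 i = \sum_b l 0 b * f 0%N 0 b.
Proof.
split.
  move=> [u _ <-]; rewrite mxE eqxx /= mxE add0r; apply: eq_bigr => b _.
  by rewrite mxE; case: (eqVneq b i) => [->|//]; rewrite li !mul0r.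
move=> fi; pose u : Q := fun n => \row_b (if b == i then
  f n.+1 0 i - \sum_b l 0 b * f n.+1 0 b else f n 0 b).
have lu n : \sum_b l 0 b * u n 0 b = \sum_b l 0 b * f n 0 b.
  by apply: eq_bigr => b _; rewrite mxE; case: (eqVneq b i) => [->|//]; rewrite li !mul0r.
exists u => //; apply/funext => n; apply/rowP => b; rewrite mxE lu.
case: (eqVneq b i) => [->|bi]; last by rewrite mxE (negPf bi).
by case: n => [|n] /=; rewrite mxE ?eqxx ?subrK // add0r.
Qed.

Lemma hyp_range_lattice : lattice (range (hyp i l)).
Proof.
split; first by apply: shlin_image_submod; [exact: hyp_shlin|].
exists 1%N => f f0; apply/hyp_range; rewrite f0 // mxE big1 // => b _.
by rewrite mxE mulr0.
Qed.

Lemma hyp_index : has_index (range (hyp i l)) #|k|.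
Proof.
pose s (c : k) : Q := fun n => if n == 0%N then c *: delta_mx 0 i else 0.
have sE c b : s c 0%N 0 b = if b == i then c else 0.
  by rewrite /s !mxE eqxx /=; case: eqP; rewrite ?mulr1 ?mulr0.
have xsE (x : Q) c b : (x - s c) 0%N 0 b = x 0%N 0 b - (if b == i then c else 0).
  by rewrite -sE ?fctE !mxE.
exists k, s; split=> // [x|c c' /hyp_range].
  exists (x 0%N 0 i - \sum_b l 0 b * x 0%N 0 b); apply/hyp_range.
  rewrite xsE eqxx opprB addrC subrK; apply: eq_bigr => b _.
  by rewrite xsE; case: eqP => [->|_]; rewrite ?li ?mul0r ?subr0.
rewrite xsE sE eqxx big1 => [/eqP|b _]; first by rewrite subr_eq0 => /eqP.
by rewrite xsE sE; case: eqP => [->|_]; rewrite ?li ?mul0r ?subrr ?mulr0.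
Qed.

Lemma hyp_onto N (J : {set 'I_d}) : i \notin J -> onto (hyp i l @` N) J <-> onto N J.
Proof.
move=> iJ; have off f b : b \in J -> hyp i l f 0%N 0 b = f 0%N 0 b.
  by move=> bJ; rewrite mxE; case: eqP bJ => // ->; rewrite (negPf iJ).
split=> h y; have [f Nf fy] := h y.
  by case: Nf fy => f' Nf' <- fy; exists f' => // b bJ; rewrite -fy ?off.
by exists (hyp i l f); [exists f|move=> b bJ; rewrite off // fy].
Qed.
End Hyp.

(** The direct sum of the lattices T^(c_i) k[[T]]. *)
Definition Lam (c : 'I_d -> nat) : set Q := [set f | forall n i, (n < c i)%N -> f n 0 i = 0].

Lemma Lam_submod c : is_submodule (Lam c).
Proof.
split=> [n i _|a u v hu hv n i ni]; first by rewrite mxE.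
by rewrite ?fctE !mxE hu // hv // mulr0 addr0.
Qed.

Lemma Lam_lattice c : lattice (Lam c).
Proof.
split; first exact: Lam_submod.
exists (\max_i c i) => f h n i ni; rewrite h ?mxE //.
by apply: leq_trans ni _; apply: leq_bigmax.
Qed.

Lemma Lam_stable c : sh_stable 1 (Lam c).
Proof.
move=> f h [|n] i ni /=; first by rewrite mxE.
by apply: h; apply: ltnW.
Qed.

Lemma Lam_const m : Lam (fun=> m) = @vanish k d m.
Proof.
apply/seteqP; split=> f h n; last by move=> i nm; rewrite h // mxE.
by move=> nm; apply/rowP => i; rewrite h // mxE.
Qed.

Lemma onto0 N : is_submodule N -> onto N finset.set0.
Proof. by move=> [N0 _] y; exists 0 => // i; rewrite finset.in_set0. Qed.

(** A free basis of D in which the sublattice Lam c becomes diagonal again. If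
    D is not everything, it lies in the image of some [hyp i l], and pulling
    back along this map lowers c_i by one. For the pullback of Lam c to stay
    diagonal, l may only involve coordinates b with c_b >= c_i. *)
Lemma smith_form n : forall c D, is_submodule D -> sh_stable 1 D -> Lam c `<=` D ->
  (\sum_i c i <= n)%N ->
  exists (g : Q -> Q) (c' : 'I_d -> nat), [/\ shlin g, range g = D, forall f, Lam c (g f) <-> Lam c' f &
    forall i, (c' i <= c i)%N].
Proof.
elim: n => [|n IHn] c D Dsub Dst cD cn.
all: have Dlat : lattice D by split=> //; have [_ [K KP]] := Lam_lattice c; exists K => f /KP; apply: cD.
all: have [Don|Dnon] := pselect (onto D finset.setT).
1,3: exists id, c; split=> //; [exact: shlin_id|].
1,2: by rewrite (onto_full Dlat Dst Don); apply/seteqP; split=> // f _; exists f.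
  case: Dnon; have -> : D = setT.
    apply/seteqP; split=> // f _; apply: cD => j i; move: cn.
    by rewrite leqn0 sum_nat_eq0 => /forallP/(_ i)/eqP ->.
  move=> y; exists (fun=> y) => //.
(* J: a largest set, upward closed for c, on which D is onto; i: a coordinate
   outside J with c_i largest. *)
pose up (J : {set 'I_d}) := [forall a in J, forall b in ~: J, c b <= c a]%N.
pose good (J : {set 'I_d}) := `[< onto D J >] && up J.
have good0 : good finset.set0.
  apply/andP; split; first by apply/asboolP; apply: onto0.
  by apply/forall_inP => a; rewrite finset.in_set0.
case: (@arg_maxnP _ finset.set0 good (fun J => #|J|) good0) => J /andP[/asboolP Jon /forall_inP Jup] Jmax.
have [i0 i0J] : exists i, i \in (~: J)%SET.
  apply: contrapT => noi; apply: Dnon; suff -> : [set: 'I_d]%SET = J by exact: Jon.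
  apply/setP => i; rewrite inE; apply/esym/negPn/negP => iJ.
  by apply: noi; exists i; rewrite inE.
case: (@arg_maxnP _ i0 (mem (~: J)%SET) c i0J) => i /= iJ imax.
have iJ' : i \notin J by rewrite -finset.in_setC.
have Dnoti : ~ onto D (i |: J)%SET.
  move=> oi; have /Jmax : good (i |: J)%SET.
    apply/andP; split; first exact/asboolP.
    apply/forall_inP => a; rewrite finset.in_setU1 => aJ; apply/forall_inP => b.
    rewrite !inE negb_or => /andP[bi bJ]; have bJ' : b \in (~: J)%SET by rewrite inE.
    by case/orP: aJ => [/eqP ->|aJ]; [apply: imax|have /forall_inP := Jup a aJ; apply].
  by rewrite /= cardsU1 iJ' add1n ltnn.
have [l lJ lD] := graph_form Dsub iJ' Jon Dnoti.
have li : l 0 i = 0 by apply: lJ.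
have hP := hyp_shlin li.
have ci0 : (0 < c i)%N.
  rewrite lt0n; apply/eqP => ci; apply: Dnoti => y.
  have [h Dh hy] := Jon y.
  pose e : Q := fun n => if n == 0%N then (y 0 i - h 0%N 0 i) *: delta_mx 0 i else 0.
  exists (h + e).
    apply: submodD => //; apply: cD => j a jc; rewrite /e; case: eqP => _; rewrite !mxE //.
    by rewrite eqxx; case: eqP jc => [->|_]; rewrite ?ci ?mulr0.
  move=> a; rewrite finset.in_setU1 ?fctE /e eqxx !mxE eqxx /=.
  case: (eqVneq a i) => [->|ai] /= aJ; first by rewrite mulr1 addrC subrK.
  by rewrite mulr0 addr0 hy.
pose c1 a := if a == i then (c i).-1 else c a.
have c1P f : Lam c (hyp i l f) <-> Lam c1 f.
  split=> h j a ja.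
    have off b j' : b != i -> (j' < c b)%N -> f j' 0 b = 0.
      by move=> bi jb; have := h j' b jb; rewrite mxE (negPf bi).
    move: ja; rewrite /c1; case: (eqVneq a i) => [-> ji|ai ja]; last exact: off.
    have ji' : (j.+1 < c i)%N by rewrite -(prednK ci0) ltnS.
    have := h j.+1 i ji'; rewrite mxE eqxx /= big1 ?addr0 // => b _.
    case: (boolP (b \in J)) => bJ; last by rewrite lJ ?mul0r.
    rewrite off ?mulr0 //; first by apply: contraNneq iJ' => <-.
    by apply: leq_trans ji' _; have /forall_inP := Jup b bJ; apply.
  rewrite mxE; move: ja; case: (eqVneq a i) => [->|ai] ja; last first.
    by apply: h; rewrite /c1 (negPf ai).
  rewrite big1 => [|b _]; last first.
    case: (boolP (b \in J)) => bJ; last by rewrite lJ ?mul0r.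
    rewrite h ?mulr0 // /c1 ifN; last by apply: contraNneq iJ' => <-.
    by apply: leq_trans ja _; have /forall_inP := Jup b bJ; apply.
  rewrite addr0; case: j ja => [|j] ja /=; first by rewrite mxE.
  by apply: h; rewrite /c1 eqxx -ltnS prednK.
have [] := IHn c1 (hyp i l @^-1` D).
- exact: shlin_preimage_submod.
- exact: shlin_preimage_stable.
- by move=> f /c1P /cD.
- have c1E : (\sum_(a | a != i) c1 a = \sum_(a | a != i) c a)%N.
    by apply: eq_bigr => a ai; rewrite /c1 (negPf ai).
  move: cn; rewrite (bigD1 i) //= => cn; rewrite (bigD1 i) //= c1E.
  by rewrite /c1 eqxx -ltnS -addSn prednK.
move=> g [c' [gP gr gc cc]]; exists (hyp i l \o g), c'; split.
- exact: shlin_comp.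
- apply/seteqP; split=> [_ [f _ <-]|f Df] /=.
    have gf : range g (g f) by exists f.
    by move: gf; rewrite gr.
  have [f' _ f'E] : range (hyp i l) f by apply/(hyp_range li); apply: lD.
  have : (hyp i l @^-1` D) f' by rewrite /preimage /= f'E.
  by rewrite -gr => -[f'' _ f''E]; exists f'' => //; rewrite f''E.
- by move=> f /=; rewrite c1P gc.
- move=> a; apply: leq_trans (cc a) _; rewrite /c1; case: eqP => // ->.
  exact: leq_pred.
Qed.

End Hyperplane.

(** * Finiteness of the set of lattices of given codimension *)

Section Ncard.
Variable T : choiceType.
Implicit Types A B : set T.

Definition ncard A : nat := #|` fset_set A|%fset.

Lemma ncardE (I : finType) (s : I -> T) A : injective s -> range s = A ->
  finite_set A /\ ncard A = #|I|.
Proof.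
move=> s_inj <-; have -> : range s = [set` [fset x in [seq s i | i <- enum I]]%fset].
  apply/seteqP; split=> x /=; rewrite !inE /=.
    by case=> i _ <-; apply: map_f; rewrite mem_enum.
  by case/mapP => i _ ->; exists i.
split; first exact: finite_fset.
have us : uniq [seq s i | i <- enum I] by rewrite map_inj_uniq ?enum_uniq.
by rewrite /ncard set_fsetK card_fseq undup_id // size_map cardE.
Qed.

Lemma ncard_enum A : finite_set A ->
  exists (I : finType) (s : I -> T), [/\ injective s, range s = A & #|I| = ncard A].
Proof.
move=> fA; exists (fset_sub_type (fset_set A)), val; split; [exact: val_inj| |].
  apply/seteqP; split=> [_ [x _ <-]|x Ax].
    by have := fsvalP x; rewrite in_fset_set // inE.
  have xA : x \in fset_set A by rewrite in_fset_set // inE.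
  by exists [` xA]%fset.
by rewrite /ncard cardfE.
Qed.

Lemma ncard0 A : (forall x, ~ A x) -> ncard A = 0%N.
Proof. by move=> h; rewrite /ncard (_ : A = set0) ?fset_set0 //; apply/seteqP; split=> x // /h. Qed.

End Ncard.

Section Truncation.
Variables (k : finFieldType) (d : nat).
Local Notation Q := (nat -> 'rV[k]_d).
Implicit Types (f g u v : Q) (N D : set Q).

Section Level.
Variable K : nat.
Local Notation E := 'M[k]_(K, d).
Implicit Types (U W : {vspace E}) (A : E).

Definition trunc f : E := \matrix_(i, j) f i 0 j.
Definition ext A : Q := fun n => if insub n is Some i then row i A else 0.
Definition sh_mx : 'End(E) := linfun (mulmx (\matrix_(i < K, j < K) (i == j.+1 :> nat)%:R)).

Lemma trunc_lin a u v : trunc (a *: u + v) = a *: trunc u + trunc v.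
Proof. by apply/matrixP => i j; rewrite !mxE. Qed.

Lemma truncB u v : trunc (u - v) = trunc u - trunc v.
Proof. by apply/matrixP => i j; rewrite !mxE. Qed.

Lemma ext_lin a A B : ext (a *: A + B) = a *: ext A + ext B.
Proof.
apply/funext => n; rewrite ?fctE /ext; case: insub => [i|]; last by rewrite scaler0 addr0.
by rewrite linearP.
Qed.

Lemma ext0 : ext 0 = 0.
Proof. by apply/funext => n; rewrite /ext; case: insub => [i|//]; apply: linear0. Qed.

Lemma extK : cancel ext trunc.
Proof. by move=> A; apply/matrixP => i j; rewrite mxE /ext valK mxE. Qed.

Lemma trunc_eq0 f : trunc f = 0 <-> vanish K f.
Proof.
split=> [e n nK|h]; last by apply/matrixP => i j; rewrite !mxE h // mxE.
apply/rowP => j; have := congr1 (fun A : E => A (Ordinal nK) j) e.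
by rewrite !mxE.
Qed.

Lemma vanish_ext_trunc f : vanish K (f - ext (trunc f)).
Proof. by apply/trunc_eq0; rewrite truncB extK subrr. Qed.

Lemma trunc_sh f : trunc (sh f) = sh_mx (trunc f).
Proof.
rewrite lfunE /=; apply/matrixP => i j; rewrite !mxE.
case: i => -[|i] iK /=.
  by rewrite mxE big1 // => l _; rewrite mxE mul0r.
rewrite (bigD1 (Ordinal (ltnW iK))) //= !mxE eqxx mul1r big1 ?addr0 // => l li.
by rewrite mxE eqSS eq_sym (negPf (li : _ != _ :> nat)) mul0r.
Qed.

(** Matrices with K rows are sequences modulo T^K. The subspaces of matrices
    correspond to the lattices that contain T^K k[[T]]^d ([V_ofK],
    [preim_ofK]). *)
Definition V_of N : {vspace E} := <<[seq v <- enum {: E} | `[< N (ext v) >]]>>%VS.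
Definition preim_of U : set Q := [set f | trunc f \in U].

Lemma mem_V_of N A : is_submodule N -> (A \in V_of N) <-> N (ext A).
Proof.
move=> [N0 NP]; split; last first.
  move=> NA; apply: memv_span; rewrite mem_filter; apply/andP; split; last by rewrite mem_enum memvf.
  exact/asboolP.
rewrite /V_of; set X := [seq _ <- _ | _] => /(@coord_span _ _ _ (in_tuple X)) ->.
elim/big_ind: _ => [|u v Nu Nv|i _].
- by rewrite ext0.
- by rewrite -[u]scale1r ext_lin; apply: NP.
- have /allP/(_ _ (mem_nth 0 (ltn_ord i))) : all (fun B : E => `[< N (ext B) >]) X by exact: filter_all.
  by move/asboolP => NX; rewrite -[_ *: _]addr0 ext_lin ext0; apply: NP.
Qed.

Lemma mem_V_of_trunc N f : is_submodule N -> vanish K `<=` N ->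
  (trunc f \in V_of N) <-> N f.
Proof.
move=> Nsub NK; rewrite mem_V_of //; have := NK _ (vanish_ext_trunc f) => h.
by split=> hf; [rewrite -[f](subrK (ext (trunc f)))|rewrite -[ext _](subKr f)];
  [apply: submodD|apply: submodB].
Qed.

Lemma preim_of_submod U : is_submodule (preim_of U).
Proof.
split; first by rewrite /preim_of /= (_ : trunc 0 = 0) ?mem0v //; apply/trunc_eq0.
by move=> a u v; rewrite /preim_of /= trunc_lin => hu hv; rewrite memvD // memvZ.
Qed.

Lemma vanish_preim_of U : vanish K `<=` preim_of U.
Proof. by move=> f /trunc_eq0; rewrite /preim_of /= => ->; rewrite mem0v. Qed.

Lemma V_ofK N : is_submodule N -> vanish K `<=` N -> preim_of (V_of N) = N.
Proof. by move=> Nsub NK; apply/seteqP; split=> f /mem_V_of_trunc; apply. Qed.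

Lemma preim_ofK U : V_of (preim_of U) = U.
Proof.
apply/vspaceP => A; apply/idP/idP.
  by move/(mem_V_of _ (preim_of_submod U)); rewrite /preim_of /= extK.
by move=> AU; apply/(mem_V_of _ (preim_of_submod U)); rewrite /preim_of /= extK.
Qed.

Lemma preim_of_inj U W : preim_of U = preim_of W -> U = W.
Proof. by move=> e; rewrite -(preim_ofK U) e preim_ofK. Qed.

Lemma preim_of_sub U W : (preim_of U `<=` preim_of W) <-> (U <= W)%VS.
Proof.
split=> [h|/subvP h f]; last exact: h.
by apply/subvP => A AU; have := h (ext A); rewrite /preim_of /= extK; apply.
Qed.

Lemma preim_of_stable U : sh_stable 1 (preim_of U) <-> stable sh_mx U.
Proof.
split=> [h|/subvP h f fU]; last first.
  by rewrite /preim_of /= trunc_sh; apply: h; apply: memv_img.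
apply/subvP => _ /memv_imgP[A AU ->].
have := h (ext A); rewrite /preim_of /= trunc_sh extK; exact.
Qed.

Lemma preim_of_index U : has_index (preim_of U) (#|k| ^ (K * d - \dim U)).
Proof.
pose I : finType := {v : finvect_type E | (v : E) \in (U^C)%VS}.
exists I, (fun w : I => ext (val w)); split.
- have dimE : \dim {: E} = (K * d)%N by rewrite dimvf dim_matrix.
  rewrite card_sig -dimE -dimv_compl -card_vspaceE.
  by apply: eq_card => v.
- move=> x; pose v := trunc x - projv U (trunc x).
  have vC : v \in (U^C)%VS by apply: memv_projC.
  exists (exist _ v vC); rewrite /preim_of /= truncB extK /v subKr.
  exact: memv_proj.
- move=> [v vC] [w wC]; rewrite /preim_of /= truncB !extK => vwU.
  apply: val_inj => /=; apply/eqP; rewrite -subr_eq0 -memv0 -(capv_compl U).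
  by rewrite memv_cap vwU memvB.
Qed.

End Level.

Lemma iter_sh0 r : iter r sh (0 : Q) = 0.
Proof. by apply/funext => n; rewrite iter_shE if_same. Qed.

Definition codim N n := has_index N (#|k| ^ n).

Lemma codim_preim_of K (U : {vspace 'M[k]_(K, d)}) : codim (preim_of U) (K * d - \dim U).
Proof. exact: preim_of_index. Qed.

Lemma codim_uniq N n n' : is_submodule N -> codim N n -> codim N n' -> n = n'.
Proof.
move=> /submod_subgroup Nsub h h'; have := has_index_uniq Nsub h h'.
by apply: expnI; apply: finNzRing_gt1.
Qed.

Lemma codim_ex N : lattice N -> exists n, codim N n.
Proof.
move=> [Nsub [K NK]]; exists (K * d - \dim (V_of K N))%N.
by rewrite -{1}(V_ofK Nsub NK); apply: codim_preim_of.
Qed.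

Lemma codim_image (g : Q -> Q) N a b : shlin g ->
  codim N a -> codim (range g) b -> codim (g @` N) (b + a).
Proof.
move=> gP ha hb; rewrite /codim expnD; apply: has_index_image => //.
  by move=> u v; rewrite shlinB.
exact: shlin_inj.
Qed.

(** The lattices {f : T^(rj) f in N} increase with j, strictly so until they
    stop at the whole module, and each strict step lowers the index. Hence at
    most q^n steps occur, a bound that depends on N only through its index. *)
Lemma vanish_sub_of_codim r N n : (0 < r)%N -> lattice N -> sh_stable r N -> codim N n ->
  vanish (r * #|k| ^ n) `<=` N.
Proof.
move=> r0 Nlat Nst; have [Nsub [K NK]] := Nlat; rewrite /codim; move: (_ ^ _)%N => b hb.
pose Nj j : set Q := [set f | N (iter (r * j) sh f)].
have Njsub j : is_submodule (Nj j).
  split; first by rewrite /Nj /= iter_sh0; case: Nsub.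
  by move=> a u v; rewrite /Nj /= iter_sh_lin => hu hv; case: Nsub => _; apply.
have NjS j : Nj j `<=` Nj j.+1.
  by move=> f; rewrite /Nj /= mulnS iterD; apply: Nst.
have Nj0 : Nj 0%N = N by apply/seteqP; split=> f; rewrite /Nj /= muln0.
have NjT j : (K <= r * j)%N -> Nj j = setT.
  move=> Kj; apply/seteqP; split=> // f _; apply: NK.
  by apply: (vanish_le Kj); apply/vanishP; exists f.
have Njlat j : lattice (Nj j).
  split=> //; exists K => f fK; elim: j => [|j]; first by rewrite Nj0; apply: NK.
  exact: NjS.
have ind j b' : has_index (Nj j) b' -> forall l, (b' <= l)%N -> Nj (j + l)%N = setT.
  move=> hj l; elim: l j b' hj => [|l IHl] j b' hj bl.
    case: hj => I [s [Ib' sT _]]; have [i _] := sT 0.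
    have : (0 < #|I|)%N by apply/card_gt0P; exists i.
    by rewrite Ib' ltnNge bl.
  have [same|diff] := pselect (Nj j.+1 `<=` Nj j).
    have stab i : Nj (j + i)%N `<=` Nj j.
      elim: i => [|i IHi]; first by rewrite addn0.
      move=> f; rewrite addnS /Nj /= mulnSr iterD => h; apply: same.
      by rewrite /Nj /= mulnSr iterD; apply: IHi.
    have NjT' : Nj j = setT.
      apply/seteqP; split=> // f _; apply: (stab K); rewrite NjT //.
      by rewrite (leq_trans (leq_addl j K)) // leq_pmull.
    apply/seteqP; split=> // f _; elim: (l.+1) => [|i]; first by rewrite addn0 NjT'.
    by rewrite addnS; apply: NjS.
  have [n' hn'] := codim_ex (Njlat j.+1).
  rewrite addnS -addSn; apply: (IHl j.+1 _ hn').
  have := has_index_ltn (submod_subgroup (Njsub j)) (submod_subgroup (Njsub j.+1)) (@NjS j) diff hj hn'.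
  by move=> /leq_trans/(_ bl); rewrite ltnS.
have := ind 0%N b; rewrite Nj0 => /(_ hb b (leqnn _)) NbT f /vanishP[f' ->].
by have : Nj (0 + b)%N f' by rewrite NbT.
Qed.

Lemma finite_lattices r n : (0 < r)%N ->
  finite_set [set N | [/\ lattice N, sh_stable r N & codim N n]].
Proof.
move=> r0; pose K := (r * #|k| ^ n)%N.
apply: (@sub_finite_set _ _ (@preim_of K @` setT)).
  move=> N [[Nsub Nlat] Nst Nn]; exists (V_of K N) => //; apply: V_ofK => //.
  exact: vanish_sub_of_codim Nst Nn.
by apply: finite_image; apply: finite_finset.
Qed.

End Truncation.

(** * The hyperplane recursion *)

Section Family.
Variables (k : finFieldType) (d : nat).
Local Notation Q := (nat -> 'rV[k]_d).
Implicit Types (f g u v : Q) (N D : set Q) (J : {set 'I_d}).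
Variables (P : set (set Q)) (r : nat) (J0 : {set 'I_d}).
Hypothesis r_gt0 : (0 < r)%N.
Hypothesis P_lat : forall N, P N -> lattice N /\ sh_stable r N.
Hypothesis P_hyp : forall i (l : 'rV[k]_d) N, i \notin J0 -> l 0 i = 0 ->
  lattice N -> P (hyp i l @` N) <-> P N.

(** The set J0 collects the coordinates along which P need not be stable under
    the maps [hyp i l]; the recursion adds the other coordinates to J one at a
    time. *)
Definition fam J n : set (set Q) := [set N | [/\ P N, codim N n & onto N J]].

Lemma fam_finite J n : finite_set (fam J n).
Proof.
apply: sub_finite_set (@finite_lattices k d r n r_gt0).
by move=> N [/P_lat[]].
Qed.

Definition supp_in J : finType := {l : 'rV[k]_d | [forall a, (a \notin J) ==> (l 0 a == 0)]}.

Lemma supp_inP J (l : supp_in J) a : a \notin J -> val l 0 a = 0.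
Proof. by move=> aJ; case: l => l /= /forallP/(_ a)/implyP/(_ aJ)/eqP. Qed.

Lemma card_supp_in J : #|supp_in J| = (#|k| ^ #|J|)%N.
Proof.
pose E (y : {ffun {a | a \in J} -> k}) : 'rV[k]_d :=
  \row_a (if insub a is Some a' then y a' else 0).
have Einj : injective E.
  move=> y z /rowP e; apply/ffunP => a; have := e (val a).
  by rewrite !mxE valK.
have -> : #|J| = #|{: {a | a \in J}}| by rewrite card_sig; apply: eq_card.
rewrite -card_ffun -(card_codom Einj) card_sig; apply: eq_card => l; rewrite !inE.
apply/forallP/codomP => [h|[y ->] a].
  exists [ffun a => l 0 (val a)]; apply/rowP => a; rewrite mxE.
  case: insubP => [a' _ <-|aJ]; first by rewrite ffunE.
  by have /implyP/(_ aJ)/eqP := h a.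
by apply/implyP => aJ; rewrite mxE insubN.
Qed.

Lemma hyp_image_inj i (l : 'rV[k]_d) N N' : l 0 i = 0 ->
  hyp i l @` N = hyp i l @` N' -> N = N'.
Proof.
move=> li; have sub A B : hyp i l @` A = hyp i l @` B -> A `<=` B.
  move=> e f Af; have : (hyp i l @` A) (hyp i l f) by exists f.
  by rewrite e => -[f' Bf' /(shlin_inj (hyp_shlin li)) <-].
by move=> e; apply/seteqP; split; apply: sub.
Qed.

(** A member of P that is onto J is either onto J and i, or the image under
    [hyp i l] of a member of codimension one less, for a unique row l
    supported on J; there are q^|J| such rows. *)
Lemma fam_rec J i n : J0 \subset J -> i \notin J ->
  ncard (fam J n) = (ncard (fam (i |: J)%SET n) +
    #|k| ^ #|J| * (if n is n'.+1 then ncard (fam J n') else 0))%N.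
Proof.
move=> J0J iJ; have iJ0 : i \notin J0 by apply: contra iJ; apply: (fintype.subsetP J0J).
pose A1 : set (set Q) := if n is n'.+1 then fam J n' else set0.
have A1fin : finite_set A1 by rewrite /A1; case: (n) => // n'; apply: fam_finite.
have -> : (if n is n'.+1 then ncard (fam J n') else 0)%N = ncard A1.
  by rewrite /A1; case: (n) => //; rewrite ncard0 // => x.
have [I0 [s0 [s0_inj s0r <-]]] := ncard_enum (@fam_finite (i |: J)%SET n).
have [I1 [s1 [s1_inj s1r <-]]] := ncard_enum A1fin.
rewrite -card_supp_in -card_prod -card_sum.
pose s (x : I0 + supp_in J * I1) : set Q := match x with
  | inl a => s0 a | inr p => hyp i (val p.1) @` s1 p.2 end.
have li (l : supp_in J) : val l 0 i = 0 by apply: supp_inP.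
have s0P a : fam (i |: J)%SET n (s0 a) by rewrite -s0r; exists a.
have s1P b : exists2 n', n = n'.+1 & fam J n' (s1 b).
  have : A1 (s1 b) by rewrite -s1r; exists b.
  by rewrite /A1; case: (n) => // n' h; exists n'.
have hypnon (l : supp_in J) N : ~ onto (hyp i (val l) @` N) (i |: J)%SET.
  move=> /(_ (delta_mx 0 i))[_ [f Nf <-] h].
  have : range (hyp i (val l)) (hyp i (val l) f) by exists f.
  rewrite hyp_range // h ?finset.setU11 // mxE !eqxx big1 => [/eqP|b _].
    by rewrite oner_eq0.
  case: (boolP (b \in J)) => bJ; last by rewrite supp_inP ?mul0r.
  rewrite h ?finset.setU1r // mxE eqxx /= (_ : (b == i) = false) ?mulr0 //.
  by apply/negbTE; apply: contraNneq iJ => <-.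
have Jonto b (l : supp_in J) : onto (hyp i (val l) @` s1 b) J.
  by apply/hyp_onto => //; have [n' _ []] := s1P b.
refine (proj2 (ncardE (s := s) _ _)).
  move=> [a|[l b]] [a'|[l' b']] /= e.
  - by rewrite (s0_inj _ _ e).
  - by case: (hypnon l' (s1 b')); rewrite -e; have [] := s0P a.
  - by case: (hypnon l (s1 b)); rewrite e; have [] := s0P a'.
  - (* The row l is recovered from elements whose constant term on J is a unit
       vector. *)
    have ll' : l = l'.
      apply: val_inj; apply/rowP => a.
      case: (boolP (a \in J)) => aJ; last by rewrite !supp_inP.
      have [f Nf fE] := Jonto b l (delta_mx 0 a).
      have formE (l1 : supp_in J) b1 : (hyp i (val l1) @` s1 b1) f -> f 0%N 0 i = val l1 0 a.
        case=> f' _ f'E; have : range (hyp i (val l1)) f by exists f'.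
        rewrite hyp_range // => ->; rewrite (bigD1 a) //= fE // mxE !eqxx mulr1.
        rewrite big1 ?addr0 // => c ca.
        case: (boolP (c \in J)) => cJ; last by rewrite supp_inP ?mul0r.
        by rewrite fE // mxE eqxx (negPf ca) mulr0.
      by rewrite -(formE l b) // -(formE l' b') // -e.
    by subst l'; rewrite (s1_inj _ _ (hyp_image_inj (li l) e)).
apply/seteqP; split.
  move=> _ [[a|[l b]] _ <-] /=.
    have [PN cN oN] := s0P a; split=> // y; have [f Nf fE] := oN y.
    by exists f => // c cJ; apply: fE; rewrite finset.setU1r.
  have [n' nn' [PN cN oN]] := s1P b; split; last exact: Jonto.
    by apply/(P_hyp iJ0 (li l)) => //; case: (P_lat PN).
  rewrite nn' -[n'.+1]/(1 + n')%N; apply: codim_image => //; first exact: (hyp_shlin (li l)).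
  by rewrite /codim expn1; apply: (hyp_index (li l)).
move=> N [PN cN oN].
have [oi|noi] := pselect (onto N (i |: J)%SET).
  have : fam (i |: J)%SET n N by [].
  by rewrite -s0r => -[a _ <-]; exists (inl a).
have [Nlat Nst] := P_lat PN; have Nsub := Nlat.1.
have [l lJ lN] := graph_form Nsub iJ oN noi.
have lS : [forall a, (a \notin J) ==> (l 0 a == 0)].
  by apply/forallP => a; apply/implyP => /lJ ->.
pose l' : supp_in J := exist _ l lS; have hP := hyp_shlin (li l').
pose N' := hyp i l @^-1` N.
have NN' : N = hyp i l @` N'.
  apply/seteqP; split=> [f Nf|_ [f Nf <-] //].
  have [f' _ f'E] : range (hyp i l) f by apply/(hyp_range (li l')); apply: lN.
  by exists f' => //; rewrite /N' /preimage /= f'E.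
have N'lat : lattice N' by apply: shlin_preimage_lattice.
have [n' cN'] := codim_ex N'lat.
have nE : n = n'.+1.
  apply: (codim_uniq Nsub cN); rewrite NN' -[n'.+1]/(1 + n')%N; apply: codim_image => //.
  by rewrite /codim expn1; apply: hyp_index; apply: (li l').
have : A1 N'.
  rewrite /A1 nE; split=> //.
    by rewrite NN' in PN; move: PN => /(P_hyp iJ0 (li l') N'lat).
  by rewrite NN' in oN; move: oN => /hyp_onto; apply.
by rewrite -s1r => -[b _ bE]; exists (inr (l', b)) => //=; rewrite bE NN'.
Qed.

Variable R : comNzRingType.

Definition fam_gf J : fps R := FPS (fun n => (ncard (fam J n))%:R).

Lemma fam_gf_rec J i : J0 \subset J -> i \notin J ->
  (1 - #|k|%:R ^+ #|J| * fps_var R) * fam_gf J = fam_gf (i |: J)%SET.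
Proof.
move=> J0J iJ; apply: fpsP => n; rewrite mulrBl mul1r fcoefD fcoefN -mulrA -natrX.
rewrite fcoef_natM fcoef_varM; cbn [fcoef fam_gf]; rewrite (fam_rec n J0J iJ) natrD natrM natrX.
by case: n => [|n]; rewrite addrK.
Qed.

Lemma fam_gf_prod J : J0 \subset J ->
  \prod_(#|J| <= j < d) (1 - #|k|%:R ^+ j * fps_var R) * fam_gf J = fam_gf finset.setT.
Proof.
have [n] := ubnP (d - #|J|)%N; elim: n J => // n IHn J; rewrite ltnS => dJ J0J.
have Jd : (#|J| <= d)%N by have := max_card (mem J); rewrite card_ord.
have cT : #|[set: 'I_d]%SET| = d by rewrite finset.cardsT card_ord.
have [JT|] := eqVneq #|J| d.
  rewrite JT big_geq // mul1r; congr fam_gf; apply/eqP; rewrite finset.eqEcard finset.subsetT.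
  by rewrite cT JT leqnn.
rewrite neq_ltn [(d < _)%N]ltnNge Jd orbF => Jltd.
have [i iJ] : exists i, i \notin J.
  apply: contrapT => noi; move: Jltd; rewrite ltnNge => /negP; apply; apply: leq_trans (eq_leq (esym cT)) _.
  apply: subset_leq_card; apply/fintype.subsetP => i _.
  by apply/negPn/negP => iJ; apply: noi; exists i.
rewrite big_ltn // mulrAC (fam_gf_rec J0J iJ) mulrC.
have cJ : #|(i |: J)%SET| = #|J|.+1 by rewrite cardsU1 iJ.
rewrite -cJ IHn //; first by rewrite cJ; move: dJ Jltd; clear; lia.
by apply: fintype.subset_trans J0J (finset.subsetUr _ _).
Qed.

End Family.

(** * Lattices over the normalization; even and odd parts *)

Section NormFamily.
Variables (k : finFieldType) (d : nat) (R : comNzRingType).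
Local Notation Q := (nat -> 'rV[k]_d).
Implicit Types (f g u v : Q) (N D : set Q) (J : {set 'I_d}).

Definition normal_lattices n : set (set Q) :=
  [set N | [/\ lattice N, sh_stable 1 N & codim N n]].

Lemma codimT : codim [set: Q] 0.
Proof.
exists unit, (fun=> 0); split; first by rewrite card_unit.
  by move=> x; exists tt.
by move=> [] [].
Qed.

(** Every k[[T]]-lattice is onto the empty set of coordinates, and only the
    whole module is onto all of them. *)
Lemma normal_gf : \prod_(0 <= j < d) (1 - #|k|%:R ^+ j * fps_var R) *
  FPS (fun n => (ncard (normal_lattices n))%:R) = 1.
Proof.
pose P N := lattice N /\ sh_stable 1 N.
have P_lat N : P N -> lattice N /\ sh_stable 1 N by [].
have P_hyp i (l : 'rV[k]_d) N : i \notin finset.set0 -> l 0 i = 0 ->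
    lattice N -> P (hyp i l @` N) <-> P N.
  move=> _ li Nlat; split=> -[_ st]; split=> //.
  - by apply/(shlin_image_stable (hyp_shlin li)).
  - by apply: shlin_image_lattice; [exact: hyp_shlin|exact: hyp_range_lattice|].
  - by apply/(shlin_image_stable (hyp_shlin li)).
have := fam_gf_prod (ltn0Sn 0) P_lat P_hyp R (finset.sub0set finset.set0).
rewrite finset.cards0.
have -> : fam_gf P R finset.set0 = FPS (fun n => (ncard (normal_lattices n))%:R).
  apply: fpsP => n /=; congr (ncard _)%:R; apply/seteqP; split=> N.
    by move=> [[Nl Ns] cN _].
  by move=> [Nl Ns cN]; split=> //; apply: onto0; case: Nl.
move=> ->; apply: fpsP => n /=.
case: n => [|n] /=; last first.
  rewrite ncard0 // => N [[Nl Ns] cN oN].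
  by move: cN; rewrite (onto_full Nl Ns oN) => /(codim_uniq _ codimT) e; have := e (latticeT k d).1.
have [] // := @ncardE _ unit (fun=> setT) (fam P finset.setT 0).
  by move=> [] [].
2: by move=> _ ->; rewrite card_unit.
apply/seteqP; split=> [_ [_ _ <-]|N [[Nl Ns] _ oN]].
  split; [split; [exact: latticeT|by []]|exact: codimT|].
  by move=> y; exists (fun=> y).
by exists tt => //; rewrite (onto_full Nl Ns oN).
Qed.

End NormFamily.

Section EvenOdd.
Variables (k : finFieldType) (d : nat).
Local Notation Q := (nat -> 'rV[k]_d).
Implicit Types (f g u v : Q).

(** The two components of k[[T]] = k[[X]] + T k[[X]] for X = T^2, read as
    sequences in the variable X; a shift by two becomes a shift of both. *)
Definition ev f : Q := fun n => f n.*2.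
Definition od f : Q := fun n => f n.*2.+1.
Definition join u v : Q := fun n => if odd n then v n./2 else u n./2.

Lemma ev_join u v : ev (join u v) = u.
Proof. by apply/funext => n; rewrite /ev /join odd_double doubleK. Qed.
Lemma od_join u v : od (join u v) = v.
Proof. by apply/funext => n; rewrite /od /join /= odd_double /= uphalf_double. Qed.
Lemma join_evod f : join (ev f) (od f) = f.
Proof.
apply/funext => n; rewrite /join /ev /od -{4}[n]odd_double_half.
by case: (odd n) => /=; rewrite ?add1n ?add0n.
Qed.
Lemma evodP f g : ev f = ev g -> od f = od g -> f = g.
Proof. by move=> e o; rewrite -[f]join_evod -[g]join_evod e o. Qed.
Lemma ev_lin a u v : ev (a *: u + v) = a *: ev u + ev v. Proof. by []. Qed.
Lemma od_lin a u v : od (a *: u + v) = a *: od u + od v. Proof. by []. Qed.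
Lemma evB u v : ev (u - v) = ev u - ev v. Proof. by []. Qed.
Lemma odB u v : od (u - v) = od u - od v. Proof. by []. Qed.
Lemma ev_sh f : ev (sh f) = sh (od f). Proof. by apply/funext => -[]. Qed.
Lemma od_sh f : od (sh f) = ev f. Proof. by []. Qed.
Lemma ev_iter n f : ev (iter n.*2 sh f) = iter n sh (ev f).
Proof. by elim: n => //= n <-; rewrite ev_sh od_sh. Qed.
Lemma od_iter n f : od (iter n.*2 sh f) = iter n sh (od f).
Proof. by elim: n => //= n <-; rewrite od_sh ev_sh. Qed.
Lemma sh2_join u v : iter 2 sh (join u v) = join (sh u) (sh v).
Proof. by apply: evodP; rewrite ?(ev_iter 1) ?(od_iter 1) ?ev_join ?od_join. Qed.
Lemma join_lin a u v u' v' : join (a *: u + u') (a *: v + v') = a *: join u v + join u' v'.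
Proof. by apply: evodP; rewrite ?ev_lin ?od_lin !(ev_join, od_join). Qed.
Lemma join0 : join 0 0 = 0.
Proof. by apply: evodP; rewrite ?ev_join ?od_join. Qed.
Lemma vanish_evod n f : vanish n.*2 f <-> vanish n (ev f) /\ vanish n (od f).
Proof.
split=> [h|[he ho] j jn]; first by split=> j jn; apply: h; lia.
rewrite -[f]join_evod /join; case: ifP => oj; [apply: ho|apply: he]; lia.
Qed.
Lemma join_inj u v u' v' : join u v = join u' v' -> u = u' /\ v = v'.
Proof. by move=> e; rewrite -(ev_join u v) -{2}(od_join u v) e ev_join od_join. Qed.

End EvenOdd.
Arguments ev {k d} f _. Arguments od {k d} f _.

(** * Lattices over the cusp that generate everything over the normalization *)

Section CuspFamily.
Variables (k : finFieldType) (d m : nat) (c : 'I_d -> nat).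
Hypothesis c_le : forall i, (c i <= m)%N.
Local Notation Q := (nat -> 'rV[k]_d).
Local Notation E := 'M[k]_(m, d).
Implicit Types (f g u v : Q) (N D : set Q) (B : {vspace E}).

(** A lattice over R after the Smith normal form of its even part: X^m V^d has
    become Lam c, which contains the odd parts, and modulo which the even
    parts are everything. The action of Y is the shift by 2m+1. *)
Definition cusp_lattice N : Prop :=
  [/\ lattice N, sh_stable 2 N, sh_stable m.*2.+1 N,
      forall f, N f -> Lam c (od f) &
      forall u, exists2 f, N f & Lam c (ev f - u)].

Let J0 := [set i | (0 < c i)%N]%SET.

(** If c_i = 0, a condition modulo Lam c does not see the i-th coordinate, the
    only one that [hyp i l] changes. *)
Lemma cusp_lattice_hyp i (l : 'rV[k]_d) N : i \notin J0 -> l 0 i = 0 ->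
  lattice N -> cusp_lattice (hyp i l @` N) <-> cusp_lattice N.
Proof.
rewrite inE -eqn0Ngt => /eqP ci li Nlat; have hP := hyp_shlin li.
have LamE u v : (forall n b, b != i -> u n 0 b = v n 0 b) -> Lam c u <-> Lam c v.
  move=> uv; have bi n b : (n < c b)%N -> b != i by apply: contraTneq => ->; rewrite ci.
  by split=> h n b nb; [rewrite -uv|rewrite uv]; rewrite ?h ?(bi n).
have hypE f n b : b != i -> hyp i l f n 0 b = f n 0 b.
  by move=> bi; rewrite mxE (negPf bi).
have odE f : Lam c (od (hyp i l f)) <-> Lam c (od f).
  by apply: LamE => n b bi; rewrite /od hypE.
have evE f u : Lam c (ev (hyp i l f) - u) <-> Lam c (ev f - u).
  apply: LamE => n b bi; rewrite ?fctE mxE [RHS]mxE; congr (_ + _).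
  by rewrite /ev hypE.
split=> -[_ s2 sm Nod Nev]; split=> //.
- exact/(shlin_image_stable hP).
- exact/(shlin_image_stable hP).
- by move=> f Nf; apply/odE/Nod; exists f.
- by move=> u; have [_ [f Nf <-] /evE] := Nev u; exists f.
- by apply: shlin_image_lattice => //; apply: hyp_range_lattice.
- exact/(shlin_image_stable hP).
- exact/(shlin_image_stable hP).
- by move=> _ [f Nf <-]; apply/odE/Nod.
- by move=> u; have [f Nf h] := Nev u; exists (hyp i l f); [exists f|apply/evE].
Qed.

(** Even parts are arbitrary modulo Lam c, whose elements vanish at the
    coordinates of J0 in degree zero. *)
Lemma cusp_lattice_onto N n : fam cusp_lattice J0 n N <-> cusp_lattice N /\ codim N n.
Proof.
split=> [[]//|[PN cN]]; split=> // y; have [_ _ _ _ Nev] := PN.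
have [f Nf h] := Nev (fun=> y); exists f => // i; rewrite inE => ci.
by have := h 0%N i ci; rewrite ?fctE !mxE => /eqP; rewrite subr_eq0 => /eqP.
Qed.

(** The k[[X]]-linear map that sends the i-th basis vector to y_i ([Phi_sh],
    [Phi_unit]). *)
Definition Phi (y : 'I_d -> E) u : Q :=
  fun n => \sum_(j < n.+1) \sum_i u j 0 i *: ext (y i) (n - j)%N.

Lemma Phi_lin y a u v : Phi y (a *: u + v) = a *: Phi y u + Phi y v.
Proof.
apply/funext => n; rewrite ?fctE /Phi scaler_sumr -big_split /=; apply: eq_bigr => j _.
rewrite scaler_sumr -big_split /=; apply: eq_bigr => i _.
by rewrite !mxE scalerDl scalerA.
Qed.

Lemma Phi_sh y u : Phi y (sh u) = sh (Phi y u).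
Proof.
apply/funext => -[|n]; rewrite /Phi /=.
  by rewrite big_ord1 big1 // => i _; rewrite mxE scale0r.
rewrite big_ord_recl /= big1 ?add0r => [|i _]; last by rewrite mxE scale0r.
by apply: eq_bigr => j _; apply: eq_bigr => i _; rewrite /bump leq0n add1n subSS.
Qed.

Lemma Phi0 y : Phi y 0 = 0.
Proof.
apply/funext => n; rewrite /Phi big1 // => j _; rewrite big1 // => i _.
by rewrite mxE scale0r.
Qed.

Lemma Phi_vanish y u K : vanish K u -> vanish K (Phi y u).
Proof.
move=> uK n nK; rewrite /Phi big1 // => j _; rewrite big1 // => i _.
by rewrite uK ?mxE ?scale0r // (leq_ltn_trans _ nK) // -ltnS.
Qed.

Definition unit_seq (i : 'I_d) : Q := fun n => if n == 0%N then delta_mx 0 i else 0.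

Lemma Phi_unit y i : Phi y (unit_seq i) = ext (y i).
Proof.
apply/funext => n; rewrite /Phi big_ord_recl /= subn0 (bigD1 i) //= mxE !eqxx scale1r.
rewrite big1 ?addr0 => [|a ai]; last by rewrite mxE eqxx (negPf ai) scale0r.
by rewrite big1 ?addr0 // => j _; rewrite big1 // => a _; rewrite mxE scale0r.
Qed.

Lemma Phi_Lam y u : (forall i, Lam c (ext (y i))) -> Lam c (Phi y u).
Proof.
move=> yc n a na; rewrite /Phi summxE big1 // => j _; rewrite summxE big1 // => i _.
by rewrite mxE yc ?mulr0 // (leq_ltn_trans _ na) // leq_subr.
Qed.

Definition S_of : {vspace E} := V_of m (Lam c).

Lemma vanish_Lam : @vanish k d m `<=` Lam c.
Proof. by move=> f h n i nc; rewrite h ?mxE // (leq_trans nc). Qed.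

Lemma preim_of_S : preim_of S_of = Lam c.
Proof. by apply: V_ofK; [exact: Lam_submod|exact: vanish_Lam]. Qed.

Lemma S_of_stable : stable (sh_mx k d m) S_of.
Proof. by apply/preim_of_stable; rewrite preim_of_S; apply: Lam_stable. Qed.

(** The graph of Phi modulo B. *)
Definition lat_of B (y : 'I_d -> E) : set Q :=
  [set f | preim_of B (od f - Phi y (ev f))].

(** A linear map to C/B is given by the images of the basis vectors; they are
    lifted to a complement of B so that each lattice comes from a single pair.
    *)
Definition lat_data (p : {vspace E} * {ffun 'I_d -> finvect_type E}) (n : nat) : bool :=
  [&& (p.1 <= S_of)%VS, stable (sh_mx k d m) p.1, (m * d - \dim p.1 == n)%N &
      [forall i, (p.2 i : E) \in (S_of :\: p.1)%VS]].

Lemma lat_of_codim B y n : codim (preim_of B) n -> codim (lat_of B y) n.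
Proof.
move=> [I [s [In sT sI]]]; exists I, (fun a => join 0 (s a)); split=> //.
  move=> x; have [a aP] := sT (od x - Phi y (ev x)); exists a.
  rewrite /lat_of /= odB evB od_join ev_join subr0 addrAC; exact: aP.
move=> a b; rewrite /lat_of /= odB evB !od_join !ev_join subr0 Phi0 subr0; exact: sI.
Qed.

Lemma lat_of_join B y u v : lat_of B y (join u v) <-> preim_of B (v - Phi y u).
Proof. by rewrite /lat_of /= ev_join od_join. Qed.

(** Stability under T^(2m+1) costs nothing: this raises the order in X of both
    parts to at least m, and X^m V^d lies in B and is preserved by Phi. *)
Lemma lat_of_fam p n : lat_data p n -> fam cusp_lattice finset.setT n (lat_of p.1 p.2).
Proof.
case: p => B y /and4P[/= BS Bst /eqP dB /forallP yS].
have Bsub := preim_of_submod B; have BstS : sh_stable 1 (preim_of B) by apply/preim_of_stable.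
have BK := @vanish_preim_of k d m B.
have BLam : preim_of B `<=` Lam c by rewrite -preim_of_S; apply/preim_of_sub.
have yLam i : Lam c (ext (y i)).
  rewrite -preim_of_S /preim_of /= extK; apply: (subvP (diffvSl S_of B)); exact: yS.
have PhiB a u v : Phi y (a *: u + v) = a *: Phi y u + Phi y v by apply: Phi_lin.
split; last 2 first.
- by rewrite -dB; apply: lat_of_codim; apply: codim_preim_of.
- move=> z; exists (join (fun=> z) (Phi y (fun=> z))); last by [].
  by apply/lat_of_join; rewrite subrr; case: Bsub.
split.
- split.
    split; first by rewrite /lat_of /= (_ : od 0 = 0) // (_ : ev 0 = 0) // Phi0 subr0; case: Bsub.
    move=> a u v; rewrite /lat_of /= => hu hv; rewrite ev_lin od_lin PhiB.
    have -> : a *: od u + od v - (a *: Phi y (ev u) + Phi y (ev v)) =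
       a *: (od u - Phi y (ev u)) + (od v - Phi y (ev v)).
      by rewrite scalerBr opprD addrACA.
    by case: Bsub => _; apply.
  exists m.*2 => f /vanish_evod[fe fo]; apply: BK.
  by move=> n' n'm; rewrite ?fctE fo // (Phi_vanish y fe) // subr0.
- move=> f; rewrite /lat_of /= => h; have := BstS _ h; rewrite /=.
  have -> : sh (sh f) = join (sh (ev f)) (sh (od f)).
    by rewrite -sh2_join join_evod.
  rewrite ev_join od_join Phi_sh; have := sh_lin (-1) (Phi y (ev f)) (od f).
  by rewrite !scaleN1r [- _ + _]addrC [- _ + _]addrC => ->.
- move=> f; rewrite /lat_of iterSr /= => _; rewrite od_iter ev_iter od_sh ev_sh.
  apply: BK => n' n'm; rewrite ?fctE iter_shE n'm.
  by rewrite (Phi_vanish y (K := m)) ?subr0 // => j jm; rewrite iter_shE jm.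
- move=> f; rewrite /lat_of /= => /BLam h; rewrite -[od f](subrK (Phi y (ev f))).
  by apply: submodD (Lam_submod k c) h _; apply: Phi_Lam.
- move=> u; exists (join u (Phi y u)).
    by apply/lat_of_join; rewrite subrr; case: Bsub.
  by rewrite ev_join subrr; case: (Lam_submod k c).
Qed.

(** By Nakayama N generates k[[T]]^d over k[[T]], so N + TN is everything and
    N contains T^(2m) k[[T]]^d. Again by Nakayama the even parts of N are all
    of V^d. So N is an extension of V^d by B = {b : T b in N}, split by lifts
    of the basis vectors. *)
Lemma fam_lat_of N n : fam cusp_lattice finset.setT n N ->
  exists2 p, lat_data p n & lat_of p.1 p.2 = N.
Proof.
move=> [[Nlat N2 Nm Nod Nev] cN Non]; have [Nsub [K NK]] := Nlat.
(* N + TN is stable under T, hence everything by Nakayama; both T^(2m) N and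
   T^(2m+1) N lie in N. *)
have N2m : vanish m.*2 `<=` N.
  pose M' : set Q := [set f | exists a b, [/\ N a, N b & f = a + sh b]].
  have M'T : M' = setT.
    apply: onto_full.
    - split; last by exists K => f /NK Nf; exists f, 0; split=> //; [case: Nsub|rewrite sh0 ?addr0].
      split; first by exists 0, 0; split=> //; [case: Nsub|case: Nsub|rewrite sh0 ?addr0].
      move=> t _ _ [a [b [Na Nb ->]]] [a' [b' [Na' Nb' ->]]].
      exists (t *: a + a'), (t *: b + b'); split; [by case: Nsub => _; apply|by case: Nsub => _; apply|].
      by rewrite sh_lin scalerDr addrACA.
    - move=> _ [a [b [Na Nb ->]]]; exists (iter 2 sh b), a; split=> //; first exact: N2.
      by have /= := sh_lin 1 a (sh b); rewrite !scale1r => ->; rewrite addrC.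
    - move=> y; have [f Nf fy] := Non y; exists f => //; exists f, 0; split=> //.
        by case: Nsub.
      by rewrite sh0 ?addr0.
  move=> f /vanishP[f' ->]; have : M' f' by rewrite M'T.
  move=> [a [b [Na Nb ->]]]; have := iter_sh_lin m.*2 1 a (sh b); rewrite !scale1r => ->.
  apply: submodD => //; first by rewrite -mul2n; apply: sh_stable_iter.
  by rewrite -iterSr; apply: Nm.
have evT : ev @` N = setT.
  apply: onto_full.
  - split.
      split; first by exists 0 => //; case: Nsub.
      by move=> a _ _ [u Nu <-] [v Nv <-]; exists (a *: u + v) => //; case: Nsub => _; apply.
    exists m => u um; exists (join u 0); last by rewrite ev_join.
    by apply/N2m/vanish_evod; rewrite ev_join od_join.
  - by move=> _ [f Nf <-]; exists (iter 2 sh f); [apply: N2|rewrite (ev_iter 1)].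
  - by move=> y; have [f Nf fy] := Non y; exists (ev f) => //; exists f.
pose Bs : set Q := [set b | N (join 0 b)].
have Bsub : is_submodule Bs.
  split; first by rewrite /Bs /= join0; case: Nsub.
  move=> a u v; rewrite /Bs /= => hu hv; have := join_lin a 0 u 0 v.
  by rewrite scaler0 addr0 => ->; case: Nsub => _; apply.
have BK : vanish m `<=` Bs.
  by move=> b bm; apply/N2m/vanish_evod; rewrite ev_join od_join.
have Bst : sh_stable 1 Bs.
  move=> b Nb; have := N2 _ Nb; rewrite sh2_join.
  by rewrite sh0.
pose B := V_of m Bs; have BE : preim_of B = Bs by apply: V_ofK.
have BS : (B <= S_of)%VS.
  apply/preim_of_sub; rewrite BE preim_of_S => b Nb.
  by have := Nod _ Nb; rewrite od_join.
have yex i : exists y : E, y \in (S_of :\: B)%VS /\ N (join (unit_seq i) (ext y)).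
  have [f Nf fE] : (ev @` N) (unit_seq i) by rewrite evT.
  have odS : trunc m (od f) \in S_of by have := Nod _ Nf; rewrite -{1}preim_of_S.
  have : trunc m (od f) \in (S_of :\: B + S_of :&: B)%VS by rewrite addv_diff_cap.
  move=> /memv_addP[y yS [b /memv_capP[_ bB] yb]].
  exists y; split=> //; have -> : join (unit_seq i) (ext y) = f - join 0 (od f - ext y).
    by apply: evodP; rewrite ?evB ?odB ?ev_join ?od_join ?fE ?subr0 // subKr.
  apply: submodB => //; suff : Bs (od f - ext y) by [].
  by rewrite -BE /preim_of /= truncB extK yb addrC addKr.
have [y yP] := choice yex.
pose y' : {ffun 'I_d -> finvect_type E} := [ffun i => y i : finvect_type E].
have y'P i : (y' i : E) \in (S_of :\: B)%VS /\ N (join (unit_seq i) (ext (y' i : E))).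
  by rewrite ffunE.
have NPhi u : N (join u (Phi y' u)).
  suff : [set u | N (join u (Phi y' u))] = setT by move/seteqP => [_]; apply.
  apply: onto_full.
  - split; [split|exists m].
    + by rewrite /= Phi0 join0; case: Nsub.
    + by move=> a u' v; rewrite /= => hu hv; rewrite Phi_lin join_lin; case: Nsub => _; apply.
    + move=> u' um; apply/N2m/vanish_evod; rewrite ev_join od_join; split=> //.
      exact: Phi_vanish.
  - by move=> u' /= Nu; rewrite Phi_sh -sh2_join; apply: N2.
  - move=> z; exists (\sum_i z 0 i *: unit_seq i); last first.
      move=> i _; have ev0 : {morph (fun f : Q => f 0%N 0 i) : f g / f + g} by move=> f g; rewrite mxE.
      rewrite (big_morph _ ev0 (mxE _ _ _ _)) (bigD1 i) //= !mxE !eqxx mulr1.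
      by rewrite big1 ?addr0 // => a ai; rewrite !mxE eqxx eq_sym (negPf ai) mulr0.
    have Usub : is_submodule [set u | N (join u (Phi y' u))].
      split; first by rewrite /= Phi0 join0; case: Nsub.
      by move=> a u' v; rewrite /= => hu hv; rewrite Phi_lin join_lin; case: Nsub => _; apply.
    have US i : [set u | N (join u (Phi y' u))] (z 0 i *: unit_seq i).
      by apply: (submodZ _ Usub); rewrite /= Phi_unit; case: (y'P i).
    exact: (submod_sum _ Usub (fun i _ => US i)).
have NE : lat_of B y' = N.
  have splitE f : f = join (ev f) (Phi y' (ev f)) + join 0 (od f - Phi y' (ev f)).
    rewrite -[X in _ = X + _]scale1r -join_lin !scale1r addr0.
    by rewrite [Phi _ _ + _]addrC subrK join_evod.
  apply/seteqP; split=> f; rewrite /lat_of /= -?/(preim_of _ _) BE /Bs /= => h.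
    by rewrite [f]splitE; apply: submodD.
  have -> : join 0 (od f - Phi y' (ev f)) = f - join (ev f) (Phi y' (ev f)).
    by apply: (canRL (addrK _)); rewrite addrC -splitE.
  exact: submodB.
exists (B, y') => //=.
  apply/and4P; split=> //=.
  - by apply/preim_of_stable; rewrite BE.
  - apply/eqP; apply: (codim_uniq Nsub _ cN); rewrite -NE.
    by apply: lat_of_codim; apply: codim_preim_of.
  - by apply/forallP => i; case: (y'P i).
Qed.

Lemma lat_of_inj p p' n : lat_data p n -> lat_data p' n ->
  lat_of p.1 p.2 = lat_of p'.1 p'.2 -> p = p'.
Proof.
case: p p' => [B y] [B' y'] /and4P[/= BS _ _ /forallP yS] /and4P[/= BS' _ _ /forallP yS'] e.
have BB' : B = B'.
  have setE C (z : 'I_d -> E) : preim_of C = [set b | lat_of C z (join 0 b)].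
    by apply/seteqP; split=> b /=; rewrite lat_of_join Phi0 subr0.
  by apply: (@preim_of_inj k d m); rewrite (setE B y) (setE B' y') e.
subst B'; congr pair; apply/ffunP => i; apply/eqP; rewrite -subr_eq0.
have dS : (y i : E) - y' i \in (S_of :\: B)%VS by rewrite memvB // ?yS ?yS'.
have : lat_of B y (join (unit_seq i) (ext (y' i : E))).
  by rewrite e; apply/lat_of_join; rewrite Phi_unit subrr; case: (preim_of_submod B).
move=> /lat_of_join; rewrite Phi_unit /preim_of /= truncB !extK => dB.
have : (y i : E) - y' i \in ((S_of :\: B) :&: B)%VS.
  by rewrite memv_cap dS -opprB rpredN.
by rewrite capv_diff memv0.
Qed.

Lemma ncard_cusp_fam n : ncard (fam cusp_lattice finset.setT n) =
  (\sum_(B : {vspace E} | [&& (B <= S_of)%VS, stable (sh_mx k d m) B & m * d - \dim B == n])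
     #|k| ^ (d * (\dim S_of - \dim B)))%N.
Proof.
pose I : finType := {p : {vspace E} * {ffun 'I_d -> finvect_type E} | lat_data p n}.
have -> : ncard (fam cusp_lattice finset.setT n) = #|I|.
  refine (proj2 (ncardE (s := fun p : I => lat_of (val p).1 (val p).2) _ _)).
    by move=> [p pP] [p' pP'] /= e; apply: val_inj; apply: lat_of_inj pP pP' e.
  apply/seteqP; split=> [_ [[p pP] _ <-] /=|N /fam_lat_of[p pP <-]].
    exact: lat_of_fam.
  by exists (exist _ p pP).
rewrite card_sig -sum1_card.
rewrite (eq_bigl (fun p : {vspace E} * {ffun 'I_d -> finvect_type E} =>
   [&& (p.1 <= S_of)%VS, stable (sh_mx k d m) p.1 & m * d - \dim p.1 == n]%N &&
   (p.2 \in ffun_on [pred v : finvect_type E | (v : E) \in (S_of :\: p.1)%VS]))); last first.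
  move=> p; rewrite inE /lat_data -!andbA; do 3 congr (_ && _).
rewrite -(pair_big_dep (fun B : {vspace E} => [&& (B <= S_of)%VS, stable (sh_mx k d m) B & m * d - \dim B == n]%N)
  (fun B (y : {ffun 'I_d -> finvect_type E}) => y \in ffun_on [pred v : finvect_type E | (v : E) \in (S_of :\: B)%VS])
  (fun _ _ => 1%N)) /=.
apply: eq_bigr => B /and3P[BS _ _]; rewrite sum1_card card_ffun_on card_ord card_vspaceE.
have -> : (\dim S_of - \dim B = \dim (S_of :\: B))%N.
  by rewrite -(dimv_cap_compl S_of B) (capv_idPr BS) addKn.
by rewrite -expnM mulnC.
Qed.

End CuspFamily.

(** * The quotient by the even part *)

Section CotypeViaMap.
Variables (k : finFieldType) (E : vectType k) (x tau : 'End(E)).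
Hypothesis tauC : forall v, tau (x v) = x (tau v).

Lemma img_iter_tau j (U : {vspace E}) : img_iter x j (tau @: U) = (tau @: img_iter x j U)%VS.
Proof.
elim: j => //= j ->; rewrite -!limg_comp; apply: eq_in_limg => v _.
by rewrite !comp_lfunE tauC.
Qed.

(** The map tau induces an isomorphism from the quotient by its kernel to its
    image. *)
Lemma mod_type_limg j : mod_type x (limg tau) j = mod_cotype x fullv (lker tau) j.
Proof.
rewrite /mod_type /mod_cotype !img_iter_tau.
have dimE U : (\dim (tau @: U) + \dim (lker tau) = \dim (U + lker tau))%N.
  have := limg_ker_dim tau U; have := dimv_sum_cap U (lker tau); lia.
by rewrite -!dimE; lia.
Qed.

End CotypeViaMap.

Section Diagonal.
Variables (k : finFieldType) (d m : nat).
Local Notation Q := (nat -> 'rV[k]_d).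
Local Notation E := 'M[k]_(m, d).
Local Notation x := (sh_mx k d m).
Implicit Types (f g u v : Q).

Lemma sh_mx_ext A : x A = trunc m (sh (ext A)).
Proof. by rewrite trunc_sh extK. Qed.

Lemma trunc_iter j f : trunc m (iter j sh f) = iter j x (trunc m f).
Proof. by elim: j => //= j <-; rewrite trunc_sh. Qed.

Lemma mem_img_iter j (U : {vspace E}) A :
  A \in img_iter x j U <-> exists2 B, B \in U & A = iter j x B.
Proof.
elim: j A => [|j IHj] A /=.
  by split=> [AU|[B BU ->]//]; exists A.
split=> [/memv_imgP[_ /IHj[B BU ->] ->]|[B BU ->]]; first by exists B.
by apply: memv_img; apply/IHj; exists B.
Qed.

Lemma iter_shx0 A : iter m x A = 0.
Proof.
rewrite -[A](extK); rewrite -trunc_iter; apply/trunc_eq0 => n nm.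
by rewrite iter_shE nm.
Qed.

Lemma sh_mx_nilp : img_iter x m fullv = 0%VS.
Proof.
apply/eqP; rewrite -subv0; apply/subvP => A /mem_img_iter[B _ ->].
by rewrite iter_shx0 mem0v.
Qed.

Section LastRow.
Hypothesis m_gt0 : (0 < m)%N.

Definition const_seq (y : 'rV[k]_d) : Q := fun n => if n == 0%N then y else 0.
Definition last_row (y : 'rV[k]_d) : E := trunc m (iter m.-1 sh (const_seq y)).

Let im : (m.-1 < m)%N. Proof. by rewrite prednK. Qed.

Lemma last_row_inj : injective last_row.
Proof.
move=> y y' /(congr1 (fun A : E => row (Ordinal im) A)) /rowP e; apply/rowP => i.
by have := e i; rewrite !mxE !iter_shE ltnn subnn.
Qed.

Lemma trunc_eq f g : (forall n, (n < m)%N -> f n = g n) -> trunc m f = trunc m g.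
Proof. by move=> h; apply/matrixP => i j; rewrite !mxE h. Qed.

Lemma iter_last_row A : iter m.-1 x A = last_row (ext A 0%N).
Proof.
rewrite -{1}[A]extK -trunc_iter; apply: trunc_eq => n nm; rewrite !iter_shE.
case: ltnP => // mn; have -> : n = m.-1 by apply/eqP; rewrite eqn_leq mn andbT -ltnS prednK.
by rewrite subnn.
Qed.

Lemma lker_last_row A : A \in lker x <-> exists y, A = last_row y.
Proof.
rewrite memv_ker; split=> [/eqP|[y ->]]; last first.
  rewrite /last_row -trunc_sh -iterS prednK //; apply/eqP/trunc_eq0 => n nm.
  by rewrite iter_shE nm.
rewrite sh_mx_ext => /trunc_eq0 h; exists (ext A m.-1); rewrite -[LHS]extK.
apply: trunc_eq => n nm; rewrite iter_shE; case: ltnP => mn.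
  by move: mn; rewrite ltn_predRL => /h.
have -> : n = m.-1 by apply/eqP; rewrite eqn_leq mn andbT -ltnS prednK.
by rewrite subnn.
Qed.

Lemma dim_last_row (U : {vspace E}) (J : {set 'I_d}) :
  (forall A, A \in U <-> exists2 y : 'rV[k]_d, (forall a, a \notin J -> y 0 a = 0) & A = last_row y) ->
  \dim U = #|J|.
Proof.
move=> UE; apply: (@expnI #|k|); first exact: finNzRing_gt1.
rewrite -card_vspaceE -card_supp_in.
have inj : injective (fun y : supp_in k J => last_row (val y) : finvect_type E).
  by move=> y y' /last_row_inj /val_inj.
rewrite -(card_codom inj); apply: eq_card => A; rewrite !inE.
apply/idP/codomP => [/UE[y yJ ->]|[[y yJ] ->]].
  have yS : [forall a, (a \notin J) ==> (y 0 a == 0)].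
    by apply/forallP => a; apply/implyP => /yJ ->.
  by exists (exist _ y yS).
apply/UE; exists y => //= a aJ.
by move/forallP: yJ => /(_ a)/implyP/(_ aJ)/eqP.
Qed.

(** The kernel of x on a module of type la has one dimension for each part,
    and those of its elements that lie in X^j U come from the parts larger
    than j. *)
Lemma mod_typeE U j : mod_type x U j = \dim (img_iter x j U :&: lker x)%VS.
Proof. by rewrite /mod_type /= -(limg_ker_dim x (img_iter x j U)) addnK. Qed.

Lemma mod_type_full j : (j < m)%N -> mod_type x fullv j = d.
Proof.
move=> jm; transitivity #|[set: 'I_d]%SET|; last by rewrite finset.cardsT card_ord.
rewrite mod_typeE; apply: dim_last_row => A.
rewrite memv_cap; split.
  by case/andP => _ /lker_last_row[y ->]; exists y => // a; rewrite inE.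
case=> y _ AE; apply/andP; split; last by apply/lker_last_row; exists y.
apply/mem_img_iter; exists (trunc m (iter (m.-1 - j) sh (const_seq y))); first exact: memvf.
by rewrite -trunc_iter -iterD subnKC // -ltnS prednK.
Qed.

Lemma mod_type_S_of (c : 'I_d -> nat) : (forall i, (c i <= m)%N) ->
  mod_type x (S_of k m c) m.-1 = #|[set i | c i == 0%N]%SET|.
Proof.
move=> cm; rewrite mod_typeE; apply: dim_last_row => A; rewrite memv_cap; split.
  case/andP => /mem_img_iter[B BS ->] _; rewrite iter_last_row.
  exists (ext B 0%N) => // a; rewrite inE -lt0n => ca.
  have : preim_of (S_of k m c) (ext B) by rewrite /preim_of /= extK.
  by rewrite preim_of_S //; apply.
case=> y yJ ->; apply/andP; split; last by apply/lker_last_row; exists y.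
apply/mem_img_iter; exists (trunc m (const_seq y)); last by rewrite -trunc_iter.
have : Lam c (const_seq y).
  by case=> [|n] i nc /=; rewrite ?mxE // yJ // inE -lt0n.
by rewrite -(preim_of_S k cm).
Qed.
End LastRow.

Section Smith.
Variables (g : Q -> Q) (c : 'I_d -> nat) (W : {vspace E}).
Hypotheses (gP : shlin g) (c_le : forall i, (c i <= m)%N).
Hypothesis g_range : range g = preim_of W.
Hypothesis g_Lam : forall f, vanish m (g f) <-> Lam c f.

(** The isomorphism of V^d / D with C / X^m V^d is u |-> g^-1 (X^m u): the
    inverse of g carries X^m V^d onto C and X^m D onto X^m V^d. *)
Lemma quotient_map : exists tau : 'End(E),
  [/\ forall A : E, tau (x A) = x (tau A), lker tau = W & limg tau = S_of k m c].
Proof.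
have giex u : exists f, range g u -> g f = u.
  by have [[f _ <-]|no] := pselect (range g u); [exists f|exists 0].
have [gi giP] := choice giex.
have vW u : vanish m u -> range g u by move=> um; rewrite g_range; apply: vanish_preim_of.
have giK f : gi (g f) = f by apply: (shlin_inj gP); apply: giP; exists f.
pose T u := trunc m (gi (iter m sh u)).
have rT u : range g (iter m sh u) by apply/vW/vanishP; exists u.
have gT u : exists2 f, g f = iter m sh u & T u = trunc m f.
  by have [f _ fE] := rT u; exists f => //; rewrite /T -fE giK.
have Tlin a u v : T (a *: u + v) = a *: T u + T v.
  have [[f fE ->] [h hE ->]] := (gT u, gT v).
  by rewrite /T iter_sh_lin -fE -hE -(shlinP gP) giK trunc_lin.
have Tvan u : vanish m u -> T u = 0.
  move=> /vW[f _ <-]; rewrite /T -(shlin_iter gP) giK; apply/trunc_eq0 => n nm.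
  by rewrite iter_shE nm.
have Ttr u : T (ext (trunc m u)) = T u.
  have := Tlin 1 (u - ext (trunc m u)) (ext (trunc m u)).
  rewrite !scale1r subrK => ->; rewrite (Tvan _ (vanish_ext_trunc u)) add0r //.
have Tsh u : T (sh u) = x (T u).
  have [f fE ->] := gT u; rewrite /T -iterSr iterS -fE -(shlin_sh gP) giK.
  exact: trunc_sh.
pose t (A : E) : E := T (ext A).
have tlin : linear t by move=> a A B; rewrite /t ext_lin Tlin.
pose tL : {linear E -> E} := HB.pack t (GRing.isLinear.Build k E E *:%R t tlin).
have tE A : linfun tL A = T (ext A) by rewrite lfunE.
exists (linfun tL); split.
- by move=> v; rewrite !tE sh_mx_ext Ttr Tsh.
- apply/vspaceP => A; rewrite memv_ker tE; have [f fE ->] := gT (ext A).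
  apply/eqP/idP => [/trunc_eq0/vanishP[f' f'E]|AW].
    have : preim_of W (ext A).
      rewrite -g_range; exists f' => //; apply: (@iter_sh_inj k d m).
      by rewrite -(shlin_iter gP) -f'E.
    by rewrite /preim_of /= extK.
  have : range g (ext A) by rewrite g_range /preim_of /= extK.
  case=> f' _ f'E; apply/trunc_eq0/vanishP; exists f'; apply: (shlin_inj gP).
  by rewrite (shlin_iter gP) f'E.
- apply/vspaceP => A; apply/memv_imgP/idP.
    case=> B _ ->; rewrite tE; have [f fE ->] := gT (ext B).
    have : preim_of (S_of k m c) f.
      by rewrite preim_of_S //; apply/g_Lam; rewrite fE; apply/vanishP; exists (ext B).
    exact.
  move=> AS; have : preim_of (S_of k m c) (ext A) by rewrite /preim_of /= extK.
  rewrite preim_of_S // => /g_Lam/vanishP[u uE]; exists (trunc m u); first exact: memvf.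
  by rewrite tE Ttr /T -uE giK extK.
Qed.

Lemma mod_type_Smith j : mod_type x (S_of k m c) j = mod_cotype x fullv W j.
Proof.
have [tau [tauC tauK tauI]] := quotient_map.
by rewrite -tauK -tauI; apply: mod_type_limg.
Qed.

Lemma dim_Smith : \dim (S_of k m c) = (m * d - \dim W)%N.
Proof.
have [tau [_ tauK tauI]] := quotient_map.
have dimE : \dim {: E} = (m * d)%N by rewrite dimvf dim_matrix.
by have := limg_ker_dim tau fullv; rewrite capfv tauK tauI dimE => <-; rewrite addKn.
Qed.

End Smith.

End Diagonal.

(** * The generating function of the lattices over the cusp *)

Section NcardPartition.
Variable T : choiceType.
Implicit Types A : set T.

Lemma ncard_partition (J : finType) A (Aj : J -> set T) : finite_set A ->
  (forall x, A x <-> exists j, Aj j x) ->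
  (forall j j' x, Aj j x -> Aj j' x -> j = j') ->
  ncard A = (\sum_j ncard (Aj j))%N.
Proof.
move=> Afin AE Adis.
have Ajfin j : finite_set (Aj j).
  by apply: sub_finite_set Afin => x xj; apply/AE; exists j.
have ex j : exists p : {I : finType & I -> T},
    [/\ injective (projT2 p), range (projT2 p) = Aj j & #|projT1 p| = ncard (Aj j)].
  by have [I [s h]] := ncard_enum (Ajfin j); exists (existT _ I s).
have [p pP] := choice ex.
pose I : finType := {j : J & projT1 (p j)}.
have -> : (\sum_j ncard (Aj j))%N = #|I|.
  rewrite card_tagged sumnE big_map big_enum /=.
  by apply: eq_bigr => j _; case: (pP j) => _ _ ->.
refine (proj2 (ncardE (s := fun a : I => projT2 (p (tag a)) (tagged a)) _ _)).
  have inA (a : I) : Aj (tag a) (projT2 (p (tag a)) (tagged a)).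
    by case: (pP (tag a)) => _ <- _; exists (tagged a).
  move=> a b e; have jj := Adis _ _ _ (inA a); move: (inA b); rewrite -e => /jj {}jj.
  case: a b jj e => j a [j' b] /= jj; subst j' => e; congr existT.
  by case: (pP j) => inj _ _; apply: inj.
apply/seteqP; split=> [_ [a _ <-]|x /AE[j]].
  by apply/AE; exists (tag a); case: (pP (tag a)) => _ <- _; exists (tagged a).
case: (pP j) => _ <- _ [a _ <-]; by exists (existT _ j a).
Qed.

Lemma ncard_image (U : choiceType) (F : U -> T) (A : set U) : finite_set A ->
  (forall x y, A x -> A y -> F x = F y -> x = y) -> ncard (F @` A) = ncard A.
Proof.
move=> Afin inj; have [I [s [s_inj sr <-]]] := ncard_enum Afin.
refine (proj2 (ncardE (s := fun a => F (s a)) _ _)).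
  have As a : A (s a) by rewrite -sr; exists a.
  by move=> a b /inj e; apply: s_inj; apply: e.
rewrite -sr; apply/seteqP; split=> [_ [a _ <-]|_ [_ [a _ <-] <-]].
  by exists (s a) => //; exists a.
by exists a.
Qed.

End NcardPartition.

Lemma mul_shuffle (S : comNzRingType) (t0 t1 t2 t3 tB pr qe : S) :
  t0 * tB = t1 * t2 * t3 -> t0 * (pr * (qe * tB)) = t1 * (t2 * pr * (qe * t3)).
Proof.
move=> h; transitivity (t0 * tB * pr * qe); first by ring.
by rewrite h; ring.
Qed.

Section Extend.
Variables (k : finFieldType) (d m : nat).
Local Notation Q := (nat -> 'rV[k]_d).
Local Notation E := 'M[k]_(m, d).
Local Notation x := (sh_mx k d m).
Implicit Types (f g u v : Q) (N D : set Q).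

(** The R-submodules of V^d + T X^m V^d, which is the image of R^d. *)
Definition order_lattices n : set (set Q) :=
  [set N | [/\ lattice N, sh_stable 2 N, sh_stable m.*2.+1 N,
     forall f, N f -> vanish m (od f) & codim N n]].

(** Even parts are saturated by X^m V^d so that they correspond to subspaces
    of the finite-dimensional quotient (V/X^m)^d. *)
Definition even_part N : set Q := [set u | exists2 f, N f & vanish m (ev f - u)].

Lemma order_lattices_finite n : finite_set (order_lattices n).
Proof.
apply: sub_finite_set (@finite_lattices k d 2 n isT).
by move=> N [].
Qed.

Lemma even_part_stable N n : order_lattices n N ->
  exists2 W : {vspace E}, stable x W & even_part N = preim_of W.
Proof.
move=> [[Nsub _] N2 _ _ _].
have Dsub : is_submodule (even_part N).
  split; first by exists 0; [case: Nsub|rewrite subr0; case: (@vanish_submod k d m)].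
  move=> a u v [f Nf fu] [h Nh hv]; exists (a *: f + h); first by case: Nsub => _; apply.
  rewrite ev_lin opprD addrACA -scalerBr; case: (@vanish_submod k d m) => _; exact.
have Dvan : vanish m `<=` even_part N.
  by move=> u um; exists 0; [case: Nsub|rewrite (_ : ev 0 = 0) // sub0r; apply: (submodN (@vanish_submod k d m) um)].
have Dst : sh_stable 1 (even_part N).
  move=> u [f Nf fu]; exists (iter 2 sh f); first exact: N2.
  rewrite (ev_iter 1) -[iter 1 _ (ev f)]/(sh (ev f)) -[iter 1 _ u]/(sh u).
  have := sh_lin (-1) u (ev f); rewrite !scaleN1r addrC [- sh u + _]addrC => <-.
  by move=> [|n'] n'm //=; apply: fu; apply: ltnW.
exists (V_of m (even_part N)); last by rewrite V_ofK.
by apply/preim_of_stable; rewrite V_ofK.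
Qed.

Section OneStratum.
Variables (g : Q -> Q) (c : 'I_d -> nat) (W : {vspace E}).
Hypotheses (gP : shlin g) (c_le : forall i, (c i <= m)%N).
Hypothesis g_range : range g = preim_of W.
Hypothesis g_Lam : forall f, vanish m (g f) <-> Lam c f.
Let e := (m * d - \dim W)%N.

Definition evod_map f : Q := join (g (ev f)) (g (od f)).

Lemma evod_map_shlin : shlin evod_map.
Proof.
split.
- by move=> a u v; rewrite /evod_map ev_lin od_lin !(shlinP gP) join_lin.
- move=> f; apply: evodP; rewrite ?ev_sh ?od_sh /evod_map ?ev_join ?od_join ?ev_sh ?od_sh //.
  exact: shlin_sh.
- by move=> u v /join_inj[/(shlin_inj gP) eu /(shlin_inj gP) ov]; apply: evodP.
Qed.

Lemma evod_map_range f : range evod_map f <-> range g (ev f) /\ range g (od f).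
Proof.
split=> [[u _ <-]|[[u _ uE] [v _ vE]]].
  by rewrite /evod_map ev_join od_join; split; [exists (ev u)|exists (od u)].
by exists (join u v) => //; rewrite /evod_map ev_join od_join uE vE join_evod.
Qed.

Lemma evod_map_lattice : lattice (range evod_map).
Proof.
split; first by apply: shlin_image_submod; [exact: evod_map_shlin|].
exists m.*2 => f /vanish_evod[fe fo]; apply/evod_map_range.
by rewrite g_range; split; apply: vanish_preim_of.
Qed.

Lemma evod_map_codim : codim (range evod_map) (e + e).
Proof.
have : codim (range g) e by rewrite g_range; apply: codim_preim_of.
move=> [I [s [In sT sI]]].
exists (I * I)%type, (fun p => join (s p.1) (s p.2)); split.
- by rewrite card_prod In expnD.
- move=> f; have [[i iP] [j jP]] := (sT (ev f), sT (od f)); exists (i, j).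
  by apply/evod_map_range; rewrite evB odB ev_join od_join.
- move=> [i j] [i' j'] /evod_map_range; rewrite evB odB !ev_join !od_join /=.
  by move=> [/sI -> /sI ->].
Qed.

Let J0 := [set i | (0 < c i)%N]%SET.

(** Both parts of an element of N lie in D, the even part by definition and
    the odd part because X^m V^d is contained in D. So N can be pulled back
    along g acting on both, whose image has codimension 2e. *)
Lemma stratum_image n :
  [set N | order_lattices n N /\ even_part N = preim_of W] =
  (fun N => evod_map @` N) @`
    (if (e + e <= n)%N then fam (@cusp_lattice k d m c) J0 (n - (e + e)) else set0).
Proof.
have GP := evod_map_shlin.
have vE u v : vanish m (g u - g v) <-> Lam c (u - v) by rewrite -(shlinB gP) g_Lam.
have cW : codim (range evod_map) (e + e) by exact: evod_map_codim.
apply/seteqP; split=> [N [[Nlat N2 Nm Nod cN] NW]|_ [N + <-]].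
  pose N1 := evod_map @^-1` N.
  have Nsub : is_submodule N by case: Nlat.
  have NE : evod_map @` N1 = N.
    apply/seteqP; split=> [_ [f Nf <-] //|f Nf].
    have [f' _ f'E] : range evod_map f.
      apply/evod_map_range; rewrite g_range; split.
        rewrite -NW; exists f => //; rewrite subrr; case: (@vanish_submod k d m) => //.
      by apply: vanish_preim_of; apply: Nod.
    by exists f' => //; rewrite /N1 /preimage /= f'E.
  have N1lat : lattice N1 by apply: shlin_preimage_lattice.
  have [n1 cN1] := codim_ex N1lat.
  have nE : n = (e + e + n1)%N.
    apply: (codim_uniq Nsub cN); rewrite -NE; apply: codim_image => //.
  exists N1 => //; rewrite nE leq_addr addKn; apply/cusp_lattice_onto; split=> //; split=> //.
  - exact: shlin_preimage_stable.
  - exact: shlin_preimage_stable.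
  - by move=> f /Nod; rewrite /evod_map od_join => /g_Lam.
  - move=> u; have : even_part N (g u) by rewrite NW -g_range; exists u.
    move=> [f + h]; rewrite -{1}NE => -[f' Nf' f'E]; exists f' => //.
    by move: h; rewrite -f'E /evod_map ev_join => /vE.
case: ifP => // en /cusp_lattice_onto[[N1lat N12 N1m N1od N1ev] cN1]; split.
  split.
  - exact: shlin_image_lattice evod_map_lattice N1lat.
  - exact/(shlin_image_stable GP).
  - exact/(shlin_image_stable GP).
  - by move=> _ [f Nf <-]; rewrite /evod_map od_join; apply/g_Lam/N1od.
  - by rewrite -[n](subnKC en); apply: codim_image.
rewrite -g_range; apply/seteqP; split=> [u [_ [f Nf <-]]|_ [u _ <-]].
  rewrite /evod_map ev_join => h.
  have : range g (g (ev f) - u) by rewrite g_range; apply: vanish_preim_of.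
  move=> [v _ vE']; exists (ev f - v) => //.
  by rewrite (shlinB gP) vE' subKr.
have [f Nf h] := N1ev u; exists (evod_map f); first by exists f.
by rewrite /evod_map ev_join; apply/vE.
Qed.

Lemma ncard_stratum n :
  ncard [set N | order_lattices n N /\ even_part N = preim_of W] =
  (if (e + e <= n)%N then ncard (fam (@cusp_lattice k d m c) J0 (n - (e + e))) else 0)%N.
Proof.
have cl_lat N : cusp_lattice m c N -> lattice N /\ sh_stable 2 N by case.
have J0E : [set i | (0 < c i)%N]%SET = J0 by [].
rewrite stratum_image ncard_image.
- by case: ifP => // _; rewrite ncard0 // => N.
- by case: ifP => // _; apply: (@fam_finite k d _ 2).
- move=> A B _ _ eAB; have sub C D : evod_map @` C = evod_map @` D -> C `<=` D.
    move=> eCD f Cf; have : (evod_map @` C) (evod_map f) by exists f.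
    by rewrite eCD => -[f' Df' /(shlin_inj evod_map_shlin) <-].
  by apply/seteqP; split; apply: sub.
Qed.

End OneStratum.

Lemma order_module_codim : codim [set f : Q | vanish m (od f)] (m * d).
Proof.
have [I [s [In sT sI]]] := preim_of_index (0%VS : {vspace E}).
exists I, (fun i => join 0 (s i)); split; first by rewrite In dimv0 subn0.
  move=> f; have [i iP] := sT (od f); exists i; rewrite /= odB od_join.
  by apply/trunc_eq0/eqP; rewrite -memv0.
move=> i j; rewrite /= odB !od_join => /trunc_eq0 h.
by apply: sI; rewrite /preim_of /= h mem0v.
Qed.

Lemma order_lattices_ge n N : order_lattices n N -> (m * d <= n)%N.
Proof.
move=> [Nlat _ _ Nod cN]; pose Rd : set Q := [set f | vanish m (od f)].
have Rsub : is_submodule Rd.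
  have [v0 vP] := @vanish_submod k d m.
  by split=> [|a u v]; rewrite /Rd /= ?od_lin; [exact: v0|apply: vP].
have [Nsub _] := Nlat.
have := has_index_leq (submod_subgroup Nsub) (submod_subgroup Rsub) Nod cN order_module_codim.
by rewrite leq_exp2l // finNzRing_gt1.
Qed.

Lemma smith_exists (W : {vspace E}) : exists p : (Q -> Q) * ('I_d -> nat),
  stable x W -> [/\ shlin p.1, forall i, (p.2 i <= m)%N, range p.1 = preim_of W &
    forall f, vanish m (p.1 f) <-> Lam p.2 f].
Proof.
have [Wst|] := boolP (stable x W); last by exists (id, fun=> 0%N).
have [| | |g [c [gP gr gL cm]]] := @smith_form k d (\sum_(i < d) m) (fun=> m) (preim_of W)
  (preim_of_submod W).
- exact/preim_of_stable.
- by rewrite Lam_const; apply: vanish_preim_of.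
- exact: leqnn.
by exists (g, c) => _; split=> // f; rewrite -gL Lam_const.
Qed.

Variable R : comNzRingType.
Local Notation T := (fps_var R).
Local Notation qR := (#|k|%:R : fps R).

(** In the stratum of W the recursion starts from J0, which leaves prod_(j <
    |J0|) (1 - q^j T) out of the full product. The codimension is counted
    relative to R^d, of codimension md in k[[T]]^d. *)
Lemma order_gf : exists c : {vspace E} -> 'I_d -> nat,
  let SW W := S_of k m (c W) in
  [/\ forall W, stable x W -> forall i, (c W i <= m)%N,
      forall W, stable x W -> stable x (SW W),
      forall W, stable x W -> forall j, mod_type x (SW W) j = mod_cotype x fullv W j &
   \prod_(0 <= j < d) (1 - qR ^+ j * T) *
     FPS (fun n => (ncard (order_lattices (n + m * d)))%:R) =
   \sum_(W | stable x W) \sum_(B | (B <= SW W)%VS && stable x B)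
     T ^+ (m * d - \dim W) * \prod_(0 <= j < #|[set i | (0 < c W i)%N]%SET|) (1 - qR ^+ j * T)
       * (qR ^+ (d * (\dim (SW W) - \dim B)) * T ^+ (\dim (SW W) - \dim B))].
Proof.
have [p pP] := choice smith_exists.
pose c W := (p W).2; pose SW W := S_of k m (c W).
pose J0 W : {set 'I_d} := [set i | (0 < c W i)%N]%SET.
have SWst W : stable x W -> stable x (SW W).
  by move=> /pP[gP cm gr gL]; apply: S_of_stable.
have SWdim W : stable x W -> \dim (SW W) = (m * d - \dim W)%N.
  by move=> /pP[gP cm gr gL]; apply: dim_Smith gL.
exists c; split=> //.
- by move=> W /pP[gP cm gr gL].
- by move=> W /pP[gP cm gr gL] j; apply: mod_type_Smith gL j.
pose gf W : fps R := fam_gf (@cusp_lattice k d m (c W)) R (J0 W).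
have cl_lat W N : cusp_lattice m (c W) N -> lattice N /\ sh_stable 2 N by case.
have gf_prod W : stable x W -> \prod_(#|J0 W| <= j < d) (1 - qR ^+ j * T) * gf W =
    \sum_(B : {vspace E} | (B <= SW W)%VS && stable x B)
      qR ^+ (d * (\dim (SW W) - \dim B)) * T ^+ (m * d - \dim B).
  move=> /pP[gP cm gr gL].
  rewrite (fam_gf_prod (ltn0Sn 1) (@cl_lat W) (@cusp_lattice_hyp k d m (c W)) R (fintype.subxx _)).
  apply: fpsP => n; rewrite fcoef_sum; cbn [fcoef fam_gf].
  rewrite ncard_cusp_fam // natr_sum.
  under [RHS]eq_bigr do rewrite -natrX fcoef_natM fcoef_varX.
  rewrite big_mkcond [RHS]big_mkcond /=; apply: eq_bigr => B _.
  rewrite andbA; case: ifP => [/andP[-> /eqP ->]|]; first by rewrite eqxx mulr1.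
  by case: ifP => //= _ /negbT; rewrite eq_sym => /negPf ->; rewrite mulr0.
have gf_sum : FPS (fun n => (ncard (order_lattices n))%:R) =
    \sum_(W | stable x W) T ^+ (m * d - \dim W + (m * d - \dim W)) * gf W :> fps R.
  apply: fpsP => n; rewrite fcoef_sum; cbn [fcoef].
  rewrite (@ncard_partition _ {vspace E} _ (fun W =>
     [set N | order_lattices n N /\ even_part N = preim_of W])).
  - rewrite natr_sum [RHS]big_mkcond; apply: eq_bigr => W _; case: ifP => Wst.
      have [gP cm gr gL] := pP W Wst.
      rewrite (ncard_stratum gP gr gL) fcoef_varXM /J0.
      by case: ifP.
    rewrite ncard0 // => N [oN NW]; have [W' W'st W'E] := even_part_stable oN.
    by move: Wst; rewrite -(preim_of_inj (etrans (esym W'E) NW)) W'st.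
  - exact: order_lattices_finite.
  - move=> N; split=> [oN|[W []//]].
    by have [W Wst WE] := even_part_stable oN; exists W.
  - by move=> W W' N [_ e] [_ e']; apply: preim_of_inj; rewrite -e.
(* Clear the shift by md: all exponents become natural numbers. *)
apply: (@fps_varX_inj R (m * d)).
have shiftE : T ^+ (m * d) * FPS (fun n => (ncard (order_lattices (n + m * d)))%:R) =
    FPS (fun n => (ncard (order_lattices n))%:R) :> fps R.
  apply: fpsP => n; rewrite fcoef_varXM; cbn [fcoef].
  case: leqP => mn; first by rewrite subnK.
  by rewrite ncard0 // => N /order_lattices_ge; rewrite leqNgt mn.
rewrite mulrCA shiftE gf_sum !mulr_sumr; apply: eq_bigr => W Wst.
have r_le : (#|J0 W| <= d)%N by have := max_card (mem (J0 W)); rewrite card_ord.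
rewrite (@big_cat_nat _ _ _ #|J0 W|) //= mulrCA -mulrA gf_prod // !mulr_sumr.
apply: eq_bigr => B /andP[BS Bst].
have dB : (\dim B <= \dim (SW W))%N by apply: dimvS.
have dS := SWdim W Wst.
have expE : T ^+ (m * d - \dim W + (m * d - \dim W)) * T ^+ (m * d - \dim B) =
    T ^+ (m * d) * T ^+ (m * d - \dim W) * T ^+ (\dim (SW W) - \dim B) :> fps R.
  rewrite -!exprD; congr (_ ^+ _); move: dB dS; clear; lia.
exact: mul_shuffle expE.
Qed.

End Extend.

(** * Submodules as lattices *)

Section CosetIndex.
Variables (A : comNzRingType) (M : lmodType A).
Implicit Types N : set M.

Lemma submodule_subgroup N : is_submodule N -> subgroup N.
Proof.
by move=> [N0 NP]; split=> // u v Nu Nv; rewrite addrC -scaleN1r; apply: NP.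
Qed.

Lemma coset_eq N x y : subgroup N ->
  [set z | N (z - x)] = [set z | N (z - y)] <-> N (x - y).
Proof.
move=> gN; split=> [e|Nxy].
  have : [set z | N (z - x)] x by rewrite /= subrr; case: gN.
  by rewrite e.
apply/seteqP; split=> z /= h.
  by rewrite -(subrK x z) -addrA; apply: subgroupD.
have -> : z - x = (z - y) - (x - y) by rewrite opprB addrA subrK.
exact: gN.2.
Qed.

Lemma cosets_has_index N : is_submodule N -> finite_set (cosets N) ->
  has_index N (index_in N).
Proof.
move=> /submodule_subgroup gN fin; have [I [s [s_inj sr sE]]] := ncard_enum fin.
have rep i : exists x, s i = [set y | N (y - x)].
  have : cosets N (s i) by rewrite -sr; exists i.
  by move=> [x _ <-]; exists x.
have [x xP] := choice rep.
exists I, x; split=> // [y|i j Nij].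
  have : cosets N [set z | N (z - y)] by exists y.
  by rewrite -sr => -[i _]; rewrite xP => /esym/(coset_eq _ _ gN) h; exists i.
by apply: s_inj; rewrite !xP; apply/coset_eq.
Qed.

(** By finiteness two powers x^i e and x^j e with i < j agree modulo N, and 1
    - x^(j-i) is invertible. This is why submodules of finite index are open.
    *)
Lemma power_in_submodule N n (x : A) (e : M) : is_submodule N -> has_index N n ->
  (forall c, (0 < c)%N -> exists u, u * (1 - x ^+ c) = 1) ->
  exists a, N (x ^+ a *: e).
Proof.
move=> Nsub [I [s [_ sT _]]] xu; have gN := submodule_subgroup Nsub.
have [f fP] := choice (fun j : nat => sT (x ^+ j *: e)).
have : ~~ injectiveb (fun j : 'I_#|I|.+1 => f j).
  apply/negP => /injectiveP /leq_card; rewrite card_ord ltnn //.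
move=> /injectivePn[j0 [j1 + fj]].
wlog jj : j0 j1 fj / (j0 < j1)%N => [th|_].
  case: (ltngtP j0 j1) => [lt|gt|e0] ne; first exact: (th j0 j1).
    by apply: (th j1 j0) => //; rewrite eq_sym.
  by case/eqP: ne; apply: val_inj.
exists j0; have [u uE] := xu (j1 - j0)%N (ltac:(by rewrite subn_gt0)).
have Nd : N (x ^+ j0 *: e - x ^+ j1 *: e).
  have -> : x ^+ j0 *: e - x ^+ j1 *: e =
    (x ^+ j0 *: e - s (f j0)) - (x ^+ j1 *: e - s (f j1)).
    by rewrite fj opprB addrA subrK.
  by apply: gN.2.
have -> : x ^+ j0 *: e = u *: (x ^+ j0 *: e - x ^+ j1 *: e) + 0.
  rewrite addr0 -scalerBl scalerA; congr (_ *: _).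
  have -> : x ^+ j0 - x ^+ j1 = x ^+ j0 * (1 - x ^+ (j1 - j0)).
    by rewrite mulrBr mulr1 -exprD subnKC // ltnW.
  by rewrite mulrCA uE mulr1.
by case: Nsub => N0; apply.
Qed.

End CosetIndex.

Section Bridge.
Variables (k : finFieldType) (d b : nat) (A : comNzRingType) (M : lmodType A).
Local Notation Q := (nat -> 'rV[k]_d).
Variables (rho : M -> Q) (Lat : set (set Q)).
Hypothesis rhoB : forall u v, rho (u - v) = rho u - rho v.
Hypothesis rho_inj : injective rho.
Hypothesis rho_codim : codim (range rho) b.
Hypothesis Lat_lattice : forall N, Lat N -> lattice N /\ sh_stable 2 N.
Hypothesis Lat_image : forall N : set M, is_submodule N -> finite_set (cosets N) -> Lat (rho @` N).
Hypothesis Lat_preimage : forall N, Lat N -> is_submodule (rho @^-1` N) /\ N `<=` range rho.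

Lemma preimage_finite_cosets N n : has_index N n -> subgroup N ->
  is_submodule (rho @^-1` N) -> finite_set (cosets (rho @^-1` N)).
Proof.
move=> [I [s [_ sT sI]]] gN Psub; have gP := submodule_subgroup Psub.
have xex i : exists x, forall y, N (rho y - s i) -> N (rho x - s i).
  by have [[x xP]|no] := pselect (exists x, N (rho x - s i)); [exists x|exists 0 => y yP; case: no; exists y].
have [x xP] := choice xex.
apply: (@sub_finite_set _ _ ((fun i => [set y | (rho @^-1` N) (y - x i)]) @` setT)).
  move=> _ [y _ <-]; have [i Ni] := sT (rho y); exists i => //.
  apply/coset_eq => //; rewrite /preimage /= rhoB.
  have -> : rho (x i) - rho y = (rho (x i) - s i) - (rho y - s i) by rewrite opprB addrA subrK.
  by apply: gN.2 => //; apply: (xP i y).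
by apply: finite_image; apply: finite_finset.
Qed.

(** M is embedded by rho as a lattice of codimension b, so submodules of index
    q^w become lattices of codimension w + b. *)
Lemma submodules_vs_lattices : exists w : finite_index_submodule M -> nat,
  (forall N, index_in (sval N) = (#|k| ^ w N)%N) /\
  forall n, finite_set [set N | w N = n] /\
     ncard [set N | w N = n] = ncard [set N | Lat N /\ codim N (n + b)].
Proof.
have q1 : (1 < #|k|)%N := finNzRing_gt1 k.
have wex (N : finite_index_submodule M) : exists w,
    index_in (sval N) = (#|k| ^ w)%N /\ codim (rho @` sval N) (w + b).
  case: N => N /= /[dup] NP /asboolP[Nsub Nfin].
  have hN := cosets_has_index Nsub Nfin.
  have LN := Lat_image Nsub Nfin; have [c cN] := codim_ex (Lat_lattice LN).1.
  have gN := submod_subgroup (Lat_lattice LN).1.1.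
  have := has_index_uniq gN (has_index_image rhoB rho_inj hN rho_codim) cN.
  have i0 : (0 < index_in N)%N.
    by case: hN => I [s [<- sT _]]; have [i _] := sT 0; apply/card_gt0P; exists i.
  move=> e; have bc : (b <= c)%N.
    by rewrite -(leq_exp2l _ _ q1) -e leq_pmulr.
  exists (c - b)%N; rewrite subnK //; split=> //.
  apply/eqP; rewrite -(@eqn_pmul2l (#|k| ^ b)) ?expn_gt0 ?(ltnW q1) //.
  by rewrite e -expnD subnKC.
have [w wP] := choice wex; exists w; split=> [N|n]; first by case: (wP N).
have imLat (N : finite_index_submodule M) : Lat (rho @` sval N).
  by case: N => N /= /asboolP[Nsub Nfin]; apply: Lat_image.
have rr N : N `<=` range rho -> rho @` (rho @^-1` N) = N.
  move=> sub; apply/seteqP; split=> [_ [x Nx <-] //|f Nf].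
  by have [x _ xE] := sub f Nf; exists x => //; rewrite /preimage /= xE.
have fin : finite_set [set N | Lat N /\ codim N (n + b)].
  apply: sub_finite_set (@finite_lattices k d 2 (n + b) isT).
  by move=> N [/Lat_lattice[? ?] ?].
have [I [s [s_inj sr sE]]] := ncard_enum fin; rewrite -sE.
have sP i : exists N : finite_index_submodule M, rho @` sval N = s i.
  have : [set N | Lat N /\ codim N (n + b)] (s i) by rewrite -sr; exists i.
  move=> [LN cN]; have [Psub sub] := Lat_preimage LN.
  have Pfin := preimage_finite_cosets cN (submod_subgroup (Lat_lattice LN).1.1) Psub.
  have NP : `[< is_submodule (rho @^-1` s i) /\ finite_set (cosets (rho @^-1` s i)) >].
    by apply/asboolP; split.
  pose N0 : finite_index_submodule M := exist _ (rho @^-1` s i) NP.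
  by exists N0; apply: rr.
have [s' s'P] := choice sP.
have im_inj (N N' : finite_index_submodule M) : rho @` sval N = rho @` sval N' -> N = N'.
  move=> e; apply: val_inj => /=.
  have sub (B C : set M) : rho @` B = rho @` C -> B `<=` C.
    move=> eBC x Bx; have : (rho @` B) (rho x) by exists x.
    by rewrite eBC => -[y Cy /rho_inj <-].
  by apply/seteqP; split; apply: sub.
apply: (ncardE (s := s')).
  by move=> i j e; apply: s_inj; rewrite -!s'P e.
apply/seteqP; split=> [_ [i _ <-] /=|N /= wN].
  have : [set N | Lat N /\ codim N (n + b)] (s i) by rewrite -sr; exists i.
  rewrite -s'P => -[LN cN]; have [_ cw] := wP (s' i).
  by have := codim_uniq (Lat_lattice LN).1.1 cw cN => /addIn.
have : [set N | Lat N /\ codim N (n + b)] (rho @` sval N).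
  by split; [exact: imLat|rewrite -wN; case: (wP N)].
by rewrite -sr => -[i _ iE]; exists i => //; apply: im_inj; rewrite s'P.
Qed.

End Bridge.

Section SeriesRows.
Variables (k : finFieldType) (d : nat).
Local Notation Q := (nat -> 'rV[k]_d).
Implicit Types (v w : 'I_d -> fps k) (f : Q).

Definition rowseq v : Q := fun n => \row_i fcoef (v i) n.

Lemma rowseqE v n i : rowseq v n 0 i = fcoef (v i) n.
Proof. by rewrite mxE. Qed.

Lemma rowseqB v w : rowseq (fun i => v i - w i) = rowseq v - rowseq w.
Proof. by apply/funext => n; apply/rowP => i; rewrite !mxE. Qed.

Lemma rowseqD v w : rowseq (fun i => v i + w i) = rowseq v + rowseq w.
Proof. by apply/funext => n; apply/rowP => i; rewrite !mxE. Qed.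

Lemma rowseq_const (c : k) v : rowseq (fun i => fps_const c * v i) = c *: rowseq v.
Proof. by apply/funext => n; apply/rowP => i; rewrite !mxE fps_constM. Qed.

Lemma rowseq_varXM r v : rowseq (fun i => fps_var k ^+ r * v i) = iter r sh (rowseq v).
Proof.
apply/funext => n; apply/rowP => i; rewrite mxE fcoef_varXM iter_shE.
by case: ltnP => nr; rewrite mxE.
Qed.

Lemma rowseq_inj v w : rowseq v = rowseq w -> v =1 w.
Proof. by move=> e i; apply: fpsP => n; rewrite -!rowseqE e. Qed.

Lemma rowseq_surj f : exists v, rowseq v = f.
Proof.
exists (fun i => FPS (fun n => f n 0 i)).
by apply/funext => n; apply/rowP => i; rewrite mxE.
Qed.

(** Modulo T^K a power series acts like a polynomial in the shift. So an open
    shift-stable subspace is a submodule. *)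
Lemma rowseq_act K (a : fps k) v :
  vanish K (rowseq (fun i => a * v i) - \sum_(j < K) fcoef a j *: iter j sh (rowseq v)).
Proof.
move=> n nK; apply/rowP => i; rewrite ?fctE mxE [in RHS]mxE rowseqE.
have ev0 : {morph (fun f : Q => f n 0 i) : f g / f + g} by move=> f g; rewrite mxE.
rewrite mxE (big_morph _ ev0 (mxE _ _ _ _)) /=.
rewrite (big_ord_widen_cond K predT (fun j => fcoef a j * fcoef (v i) (n - j))) //.
rewrite big_mkcond /= -sumrB big1 // => j _; rewrite mxE iter_shE ltnS.
by case: ltnP => jn; rewrite ?mxE ?mulr0 ?subrr // subrr.
Qed.

Lemma divide_var (f : fps k) a : (forall n, (n < a)%N -> fcoef f n = 0) ->
  exists h, f = fps_var k ^+ a * h.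
Proof.
move=> fa; exists (FPS (fun n => fcoef f (n + a))); apply: fpsP => n.
by rewrite fcoef_varXM; case: leqP => an; [rewrite /= subnK|rewrite fa].
Qed.

Lemma one_sub_var_unit c : (0 < c)%N -> exists u : fps k, u * (1 - fps_var k ^+ c) = 1.
Proof.
move=> c0; exists (FPS (fun n => (c %| n)%:R)); apply: fpsP => n.
rewrite mulrBr mulr1 [_ * _ ^+ c]mulrC fcoefD fcoefN fcoef_varXM; cbn [fcoef].
case: leqP => cn.
  rewrite dvdn_subl // subrr /=; case: n cn => // cn; by rewrite leqNgt c0 in cn.
rewrite subr0 /=; case: n cn => [|n] cn; first by rewrite dvdn0.
by rewrite gtnNdvd.
Qed.

End SeriesRows.

Section NormalizationModule.
Variables (k : finFieldType) (d : nat).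
Local Notation Q := (nat -> 'rV[k]_d).
Local Notation A := (cusp_normalization k).
Local Notation M := ('rV[A]_d).

Definition nrho (v : M) : Q := rowseq (fun i => v 0 i : fps k).

Lemma nrhoB u v : nrho (u - v) = nrho u - nrho v.
Proof. by rewrite /nrho -rowseqB; congr rowseq; apply/funext => i; rewrite !mxE. Qed.

Lemma nrho0 : nrho 0 = 0.
Proof. by have := nrhoB 0 0; rewrite !subrr. Qed.

Lemma nrho_lin (a : A) u v : nrho (a *: u + v) = rowseq (fun i => (a : fps k) * (u 0 i : fps k)) + nrho v.
Proof. by rewrite /nrho -rowseqD; congr rowseq; apply/funext => i; rewrite !mxE. Qed.

Lemma nrho_inj : injective nrho.
Proof. by move=> u v /rowseq_inj e; apply/rowP. Qed.

Lemma nrho_range : range nrho = setT.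
Proof.
apply/seteqP; split=> // f _; have [v <-] := rowseq_surj f.
by exists (\row_i (v i : A)) => //; rewrite /nrho; congr rowseq; apply/funext => i; rewrite mxE.
Qed.

Definition normal_lattice (N : set Q) := lattice N /\ sh_stable 1 N.

Lemma nrho_image (N : set M) : is_submodule N -> finite_set (cosets N) -> normal_lattice (nrho @` N).
Proof.
move=> Nsub Nfin; have [N0 NP] := Nsub; have hN := cosets_has_index Nsub Nfin.
have Nst : sh_stable 1 (nrho @` N).
  move=> _ [u Nu <-]; exists ((fps_var k : A) *: u + 0); first exact: NP.
  rewrite nrho_lin -[fps_var k]expr1 rowseq_varXM /=.
  by rewrite nrho0 addr0.
split=> //; split.
  split; first by exists 0; rewrite ?nrho0.
  move=> a _ _ [u Nu <-] [v Nv <-]; exists ((fps_const a : A) *: u + v); first exact: NP.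
  by rewrite nrho_lin rowseq_const.
have [a aP] := choice (fun i : 'I_d => power_in_submodule (x := fps_var k : A)
  (delta_mx 0 i : M) Nsub hN (@one_sub_var_unit k)).
exists (\max_i a i) => f fK.
have : range nrho f by rewrite nrho_range.
move=> [v _ vE]; exists v => //; rewrite [v]row_sum_delta.
have sumN (I : Type) (r : seq I) (F : I -> M) : (forall i, N (F i)) -> N (\sum_(i <- r) F i).
  move=> h; elim/big_rec: _ => // i y _ Ny; rewrite -[F i]scale1r; exact: NP.
apply: sumN => i; have [h hE] : exists h, (v 0 i : fps k) = fps_var k ^+ a i * h.
  apply: divide_var => n ni; rewrite -rowseqE -[rowseq _]/(nrho v) vE fK ?mxE //.
  by apply: leq_trans ni _; apply: leq_bigmax.
have NZ (c : A) u : N u -> N (c *: u) by move=> Nu; rewrite -[_ *: u]addr0; apply: NP.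
pose x : A := fps_var k; pose h' : A := h; pose D : M := delta_mx 0 i.
have vE' : v 0 i = h' * x ^+ a i by rewrite mulrC; exact: hE.
have -> : v 0 i *: delta_mx 0 i = h' *: (x ^+ a i *: D) by rewrite scalerA -vE'.
exact: NZ.
Qed.

Lemma nrho_preimage N : normal_lattice N -> is_submodule (nrho @^-1` N) /\ N `<=` range nrho.
Proof.
move=> [[Nsub [K NK]] Nst]; split; last by rewrite nrho_range.
split; first by rewrite /preimage /= nrho0; case: Nsub.
move=> a u v; rewrite /preimage /= => Nu Nv; rewrite nrho_lin; apply: submodD => //.
have := NK _ (rowseq_act (K := K) (a : fps k) (fun i => u 0 i : fps k)) => h.
rewrite -[rowseq _](subrK (\sum_(j < K) fcoef (a : fps k) j *: iter j sh (nrho u))).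
apply: submodD => //; apply: submod_sum => // j _; apply: submodZ => //.
by rewrite -[nat_of_ord j]mul1n; apply: sh_stable_iter.
Qed.

Lemma normalization_count : exists w : finite_index_submodule M -> nat,
  (forall N, index_in (sval N) = (#|k| ^ w N)%N) /\
  forall n, finite_set [set N | w N = n] /\
     ncard [set N | w N = n] = ncard (@normal_lattices k d n).
Proof.
have rc : codim (range nrho) 0 by rewrite nrho_range; apply: codimT.
have Ll N : normal_lattice N -> lattice N /\ sh_stable 2 N.
  by move=> [Nl Ns]; split=> // f Nf; exact: (Ns _ (Ns _ Nf)).
have [w [wi wn]] := submodules_vs_lattices nrhoB nrho_inj rc Ll nrho_image nrho_preimage.
exists w; split=> // n; have [wf ->] := wn n; split=> //.
rewrite addn0; congr ncard; apply/seteqP; split=> N; first by move=> [[]].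
by move=> [].
Qed.

End NormalizationModule.

Section CuspModule.
Variables (k : finFieldType) (m d : nat).
Local Notation Q := (nat -> 'rV[k]_d).
Local Notation A := (cusp_ring k m).
Local Notation M := ('rV[A]_d).
Local Notation p := (2 * m + 1)%N.

Implicit Types (u v : M) (a : fps k).

Definition crow1 (v : M) : Q := rowseq (fun i => (crd (v 0 i)).1).
Definition crow2 (v : M) : Q := rowseq (fun i => (crd (v 0 i)).2).
(** The embedding a + bY |-> a(T^2) + T^(2m+1) b(T^2) of R in k[[T]], on each
    coordinate. *)
Definition crho (v : M) : Q := join (crow1 v) (iter m sh (crow2 v)).

Lemma crho_evod v : ev (crho v) = crow1 v /\ od (crho v) = iter m sh (crow2 v).
Proof. by rewrite /crho ev_join od_join. Qed.

Lemma crow1D u v : crow1 (u + v) = crow1 u + crow1 v.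
Proof. by rewrite /crow1 -rowseqD; congr rowseq; apply/funext => i; rewrite mxE crdD. Qed.
Lemma crow2D u v : crow2 (u + v) = crow2 u + crow2 v.
Proof. by rewrite /crow2 -rowseqD; congr rowseq; apply/funext => i; rewrite mxE crdD. Qed.
Lemma crhoD u v : crho (u + v) = crho u + crho v.
Proof.
have := join_lin 1 (crow1 u) (iter m sh (crow2 u)) (crow1 v) (iter m sh (crow2 v)).
rewrite !scale1r -[X in join _ X = _ -> _](scale1r (iter m sh (crow2 u) + _)).
rewrite scale1r /crho => <-; rewrite crow1D crow2D; congr join.
by have := iter_sh_lin m 1 (crow2 u) (crow2 v); rewrite !scale1r.
Qed.

Lemma crho0 : crho 0 = 0.
Proof. by apply: (addrI (crho 0)); rewrite -crhoD !addr0. Qed.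

Lemma crhoB u v : crho (u - v) = crho u - crho v.
Proof. by apply: (addIr (crho v)); rewrite -crhoD !subrK. Qed.

Lemma crho_inj : injective crho.
Proof.
move=> u v /join_inj[/rowseq_inj e1 /iter_sh_inj /rowseq_inj e2].
by apply/rowP => i; apply: crd_inj; rewrite [LHS]surjective_pairing e1 e2 -surjective_pairing.
Qed.

Lemma crho_range : range crho = [set f | vanish m (od f)].
Proof.
apply/seteqP; split=> [_ [v _ <-] /=|f /= /vanishP[g gE]].
  by apply/vanishP; exists (crow2 v); case: (crho_evod v).
have [a aE] := rowseq_surj (ev f); have [b bE] := rowseq_surj g.
exists (\row_i cusp_pi m (emb (a i) (b i))) => //.
have -> : f = join (ev f) (od f) by rewrite join_evod.
rewrite gE -aE -bE /crho /crow1 /crow2; congr (join (rowseq _) (iter m sh (rowseq _)));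
  by apply/funext => i; rewrite mxE crd_pi.
Qed.

Lemma crow1_cst a u : crow1 (cuspC m a *: u) = rowseq (fun i => a * (crd (u 0 i)).1).
Proof. by rewrite /crow1; congr rowseq; apply/funext => i; rewrite mxE crd_cuspCM. Qed.
Lemma crow2_cst a u : crow2 (cuspC m a *: u) = rowseq (fun i => a * (crd (u 0 i)).2).
Proof. by rewrite /crow2; congr rowseq; apply/funext => i; rewrite mxE crd_cuspCM. Qed.

Lemma crho_const (c : k) u : crho (cuspC m (fps_const c) *: u) = c *: crho u.
Proof.
apply: evodP; have [e o] := crho_evod u; have [e' o'] := crho_evod (cuspC m (fps_const c) *: u).
  by rewrite e' crow1_cst rowseq_const -[rowseq _]/(crow1 u) -e.
rewrite o' crow2_cst rowseq_const -[rowseq _]/(crow2 u); have := iter_sh_lin m c (crow2 u) 0.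
by rewrite iter_sh0 !addr0 => ->; rewrite -o.
Qed.

Lemma crho_X u : crho (cuspC m (fps_var k) *: u) = iter 2 sh (crho u).
Proof.
rewrite [in RHS]/crho sh2_join /crho crow1_cst crow2_cst -iterS iterSr.
by rewrite -{1 2}[fps_var k]expr1 !rowseq_varXM.
Qed.

Lemma crho_Y u : crho (Ygen k m *: u) = iter m.*2.+1 sh (crho u).
Proof.
have [e o] := crho_evod u; have [e' o'] := crho_evod (Ygen k m *: u).
have c1 : crow1 (Ygen k m *: u) = iter p sh (crow2 u).
  rewrite /crow1 -rowseq_varXM; congr rowseq; apply/funext => i.
  by rewrite mxE crd_YM.
have c2 : crow2 (Ygen k m *: u) = crow1 u.
  by rewrite /crow2 /crow1; congr rowseq; apply/funext => i; rewrite mxE crd_YM.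
apply: evodP; rewrite iterSr ?ev_iter ?od_iter ?ev_sh ?od_sh.
  by rewrite e' c1 o -iterS -iterD; congr (iter _ _ _); lia.
by rewrite o' c2 e.
Qed.

Definition order_lattice (N : set Q) :=
  [/\ lattice N, sh_stable 2 N, sh_stable m.*2.+1 N & forall f, N f -> vanish m (od f)].

Lemma crho_image (N : set M) : is_submodule N -> finite_set (cosets N) -> order_lattice (crho @` N).
Proof.
move=> Nsub Nfin; have [N0 NP] := Nsub; have hN := cosets_has_index Nsub Nfin.
have NZ (r : A) u : N u -> N (r *: u) by move=> Nu; rewrite -[_ *: u]addr0; apply: NP.
have ND u v : N u -> N v -> N (u + v) by move=> Nu Nv; rewrite -[u]scale1r; apply: NP.
split.
- split.
    split; first by exists 0; rewrite ?crho0.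
    move=> a _ _ [u Nu <-] [v Nv <-]; exists (cuspC m (fps_const a) *: u + v).
      by apply: ND => //; apply: NZ.
    by rewrite crhoD crho_const.
  have xu c : (0 < c)%N -> exists u : A, u * (1 - cuspC m (fps_var k) ^+ c) = 1.
    move=> /(@one_sub_var_unit k)[u uE]; exists (cuspC m u).
    by rewrite -cuspCX -(cuspC1 k m) -cuspCB -cuspCM uE.
  have [a aP] := choice (fun i : 'I_d => power_in_submodule (delta_mx 0 i : M) Nsub hN xu).
  exists (\max_i a i + m).*2 => f /vanish_evod[fe fo].
  have : range crho f.
    by rewrite crho_range => n nm; apply: fo; rewrite (leq_trans nm) // leq_addl.
  move=> [v _ vE]; exists v => //; rewrite [v]row_sum_delta.
  have [e o] := crho_evod v; rewrite vE in e o.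
  elim/big_rec: _ => // i y _ Ny; apply: ND => //.
  have ai : (a i <= \max_i a i)%N by apply: leq_bigmax.
  have [h1 h1E] : exists h, (crd (v 0 i)).1 = fps_var k ^+ a i * h.
    apply: divide_var => n ni; rewrite -[LHS](rowseqE (fun i => (crd (v 0 i)).1)).
    rewrite -[rowseq _]/(crow1 v) -e fe ?mxE //; apply: leq_trans ni _.
    by apply: leq_trans ai _; apply: leq_addr.
  have [h2 h2E] : exists h, (crd (v 0 i)).2 = fps_var k ^+ a i * h.
    apply: divide_var => n ni; rewrite -[LHS](rowseqE (fun i => (crd (v 0 i)).2)).
    rewrite -[rowseq _]/(crow2 v); have := congr1 (fun g : Q => g (n + m)%N) o.
    rewrite iter_shE ltnNge leq_addl /= addnK => <-; rewrite fo ?mxE //.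
    by rewrite ltn_add2r; apply: leq_trans ni ai.
  pose r : A := cusp_pi m (emb h1 h2); pose D : M := delta_mx 0 i.
  have vE' : v 0 i = r * cuspC m (fps_var k) ^+ a i.
    rewrite mulrC -cuspCX; apply: crd_inj; rewrite crd_cuspCM crd_pi /= -h1E -h2E.
    exact: surjective_pairing.
  have -> : v 0 i *: delta_mx 0 i = r *: (cuspC m (fps_var k) ^+ a i *: D).
    by rewrite scalerA -vE'.
  exact: NZ.
- by move=> _ [u Nu <-]; exists (cuspC m (fps_var k) *: u); [apply: NZ|rewrite crho_X].
- by move=> _ [u Nu <-]; exists (Ygen k m *: u); [apply: NZ|rewrite crho_Y].
- by move=> _ [u Nu <-]; have [_ ->] := crho_evod u; apply/vanishP; exists (crow2 u).
Qed.

(** Write r = a + bY. The power series a and b act on an open subspace like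
    polynomials in X, and Y acts as the shift by 2m+1. *)
Lemma crho_preimage N : order_lattice N -> is_submodule (crho @^-1` N) /\ N `<=` range crho.
Proof.
move=> [[Nsub [K NK]] N2 Np Nod]; split; last by rewrite crho_range.
have cstP a u : N (crho u) -> N (crho (cuspC m a *: u)).
  move=> Nu; pose s := \sum_(j < K) fcoef a j *: iter j.*2 sh (crho u).
  have Ns : N s.
    apply: submod_sum => // j _; apply: submodZ => //.
    by rewrite -mul2n; apply: sh_stable_iter.
  rewrite -[crho _](subrK s); apply: submodD => //; apply: NK; apply: (@vanish_le k d K K.*2).
    by rewrite -addnn leq_addr.
  have [e o] := crho_evod u; have [e' o'] := crho_evod (cuspC m a *: u).
  have evs : ev s = \sum_(j < K) fcoef a j *: iter j sh (crow1 u).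
    have evD : {morph (@ev k d) : f g / f + g} by [].
    rewrite /s (big_morph _ evD (erefl : ev 0 = 0)).
    by apply: eq_bigr => j _; rewrite -e -ev_iter.
  have ods : od s = iter m sh (\sum_(j < K) fcoef a j *: iter j sh (crow2 u)).
    have odD : {morph (@od k d) : f g / f + g} by [].
    rewrite /s (big_morph _ odD (erefl : od 0 = 0)).
    have shD : {morph (iter m sh : Q -> Q) : f g / f + g}.
      by move=> f g; have := iter_sh_lin m 1 f g; rewrite !scale1r.
    rewrite (big_morph _ shD (iter_sh0 k d m)); apply: eq_bigr => j _.
    have shZ c (f : Q) : iter m sh (c *: f) = c *: iter m sh f.
      by have := iter_sh_lin m c f 0; rewrite iter_sh0 !addr0.
    by rewrite shZ -iterD addnC iterD -o -od_iter.
  apply/vanish_evod; rewrite evB odB evs ods e' o' crow1_cst crow2_cst; split.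
    exact: rowseq_act.
  have := iter_sh_lin m (-1) (\sum_(j < K) fcoef a j *: iter j sh (crow2 u))
    (rowseq (fun i => a * (crd (u 0 i)).2)).
  rewrite !scaleN1r addrC [- iter m _ _ + _]addrC => <- n nK; rewrite iter_shE.
  case: ltnP => // nm; apply: rowseq_act; apply: leq_ltn_trans nK; exact: leq_subr.
split; first by rewrite /preimage /= crho0; case: Nsub.
move=> r u v; rewrite /preimage /= => Nu Nv; rewrite crhoD; apply: submodD => //.
rewrite (cuspC_Y_decomp r) scalerDl crhoD -scalerA; apply: submodD => //; apply: cstP => //.
by rewrite crho_Y; apply: Np.
Qed.

Lemma cusp_count : exists w : finite_index_submodule M -> nat,
  (forall N, index_in (sval N) = (#|k| ^ w N)%N) /\
  forall n, finite_set [set N | w N = n] /\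
     ncard [set N | w N = n] = ncard (@order_lattices k d m (n + m * d)).
Proof.
have rc : codim (range crho) (m * d) by rewrite crho_range; apply: order_module_codim.
have Ll N : order_lattice N -> lattice N /\ sh_stable 2 N by case.
have [w [wi wn]] := submodules_vs_lattices crhoB crho_inj rc Ll crho_image crho_preimage.
exists w; split=> // n; have [wf ->] := wn n; split=> //.
congr ncard; apply/seteqP; split=> N; first by move=> [[]].
by move=> [].
Qed.

End CuspModule.

Import numFieldNormedType.Exports.
Local Open Scope complex_scope.
Local Open Scope classical_set_scope.

(** * Evaluation of power series *)

Section PowerSeries.
Variable C : numFieldType.
Implicit Types (f g : fps C) (t l : C).

Definition partial f t (n : nat) : C := \sum_(j < n) fcoef f j * t ^+ j.
Definition conv_to f t l := (fun n => partial f t n : C^o) @ \oo --> (l : C^o).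

Lemma conv_unique f t l l' : conv_to f t l -> conv_to f t l' -> l = l'.
Proof. by apply: cvg_unique; apply: norm_hausdorff. Qed.

Lemma partial_varM f t n : partial (fps_var C * f) t n.+1 = t * partial f t n.
Proof.
rewrite /partial big_ord_recl fcoef_varM mul0r add0r mulr_sumr.
apply: eq_bigr => j _; rewrite lift0 fcoef_varM exprS.
by rewrite mulrCA.
Qed.

Lemma partialD f g t n : partial (f + g) t n = partial f t n + partial g t n.
Proof.
by rewrite /partial -big_split; apply: eq_bigr => j _; rewrite fcoefD mulrDl.
Qed.

Lemma partialN f t n : partial (- f) t n = - partial f t n.
Proof.
by rewrite /partial -sumrN; apply: eq_bigr => j _; rewrite fcoefN mulNr.
Qed.

Lemma partial_natM c f t n : partial (c%:R * f) t n = c%:R * partial f t n.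
Proof.
rewrite /partial mulr_sumr; apply: eq_bigr => j _.
by rewrite fcoef_natM mulrA.
Qed.

Lemma conv_toD f g t l l' : conv_to f t l -> conv_to g t l' -> conv_to (f + g) t (l + l').
Proof.
move=> fl gl; rewrite /conv_to; under eq_fun do rewrite partialD.
exact: cvgD.
Qed.

Lemma conv_toN f t l : conv_to f t l -> conv_to (- f) t (- l).
Proof.
move=> fl; rewrite /conv_to; under eq_fun do rewrite partialN.
exact: cvgN.
Qed.

Lemma conv_to_natM c f t l : conv_to f t l -> conv_to (c%:R * f) t (c%:R * l).
Proof.
move=> fl; rewrite /conv_to; under eq_fun do rewrite partial_natM.
by apply: cvgM => //; apply: cvg_cst.
Qed.

Lemma conv_to_varM f t l : conv_to f t l -> conv_to (fps_var C * f) t (t * l).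
Proof.
move=> fl; rewrite /conv_to -cvg_shiftS /=.
under eq_fun do rewrite partial_varM.
by apply: cvgM => //; apply: cvg_cst.
Qed.

Lemma conv_to1 t : conv_to 1 t 1.
Proof.
rewrite /conv_to -cvg_shiftS /=.
have -> : (fun n => partial 1 t n.+1 : C^o) = fun=> 1.
  apply/funext => n; rewrite /partial big_ord_recl mulr1 big1 ?addr0 // => j _.
  by rewrite mul0r.
exact: cvg_cst.
Qed.

Lemma conv_to_varXM e f t l : conv_to f t l -> conv_to (fps_var C ^+ e * f) t (t ^+ e * l).
Proof.
move=> fl; elim: e => [|e IHe]; first by rewrite !mul1r.
by rewrite !exprS -!mulrA; apply: conv_to_varM.
Qed.

Lemma conv_to_sum (I : Type) (r : seq I) (P : pred I) (F : I -> fps C) (v : I -> C) t :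
  (forall i, P i -> conv_to (F i) t (v i)) ->
  conv_to (\sum_(i <- r | P i) F i) t (\sum_(i <- r | P i) v i).
Proof.
move=> h; elim/big_rec2: _ => [|i l f Pi fl]; last by apply: conv_toD => //; apply: h.
by have := conv_to_natM (c := 0) (conv_to1 t); rewrite !mul0r.
Qed.

Lemma conv_to_prodM (q : nat) (a b : nat) f t l : conv_to f t l ->
  conv_to (\prod_(a <= j < b) (1 - q%:R ^+ j * fps_var C) * f) t
          (\prod_(a <= j < b) (1 - q%:R ^+ j * t) * l).
Proof.
move=> fl; elim/big_rec2: _ => [|j v g _ gl]; first by rewrite !mul1r.
rewrite -!mulrA !mulrBl !mul1r -!natrX -!mulrA.
by apply: conv_toD => //; apply: conv_toN; apply: conv_to_natM; apply: conv_to_varM.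
Qed.

Definition apartial f t (n : nat) : C := \sum_(j < n) `|fcoef f j| * `|t| ^+ j.
Definition abs_bounded f t := exists M : C, forall n, apartial f t n <= M.

Lemma apartial_ge0 f t n : 0 <= apartial f t n.
Proof. by apply: sumr_ge0 => j _; rewrite mulr_ge0 ?exprn_ge0. Qed.

Lemma apartialS f t n : apartial f t n <= apartial f t n.+1.
Proof. by rewrite /apartial big_ord_recr lerDl mulr_ge0 ?exprn_ge0. Qed.

Lemma apartial_le f t n n' : (n <= n')%N -> apartial f t n <= apartial f t n'.
Proof.
move=> /subnK <-; elim: (n' - n)%N => [|e IHe]; first by rewrite add0n.
by apply: le_trans IHe _; rewrite addSn apartialS.
Qed.

Lemma apartial_varM f t n : apartial (fps_var C * f) t n.+1 = `|t| * apartial f t n.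
Proof.
rewrite /apartial big_ord_recl fcoef_varM normr0 mul0r add0r mulr_sumr.
apply: eq_bigr => j _; rewrite lift0 fcoef_varM exprS.
by rewrite mulrCA.
Qed.

Lemma apartialD f g t n : apartial (f + g) t n <= apartial f t n + apartial g t n.
Proof.
rewrite /apartial -big_split /=; apply: ler_sum => j _; rewrite -mulrDl.
by rewrite ler_wpM2r ?exprn_ge0 ?ler_normD.
Qed.

Lemma apartial_natM c f t n : apartial (c%:R * f) t n = c%:R * apartial f t n.
Proof.
rewrite /apartial mulr_sumr; apply: eq_bigr => j _.
by rewrite fcoef_natM normrM normr_nat mulrA.
Qed.

Lemma apartialN f t n : apartial (- f) t n = apartial f t n.
Proof. by apply: eq_bigr => j _; rewrite fcoefN normrN. Qed.

Lemma abs_boundedD f g t : abs_bounded f t -> abs_bounded g t -> abs_bounded (f + g) t.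
Proof.
move=> [M hM] [M' hM']; exists (M + M') => n.
by apply: le_trans (apartialD _ _ _ _) _; rewrite lerD.
Qed.

Lemma abs_boundedN f t : abs_bounded f t -> abs_bounded (- f) t.
Proof. by move=> [M hM]; exists M => n; rewrite apartialN. Qed.

Lemma abs_bounded_natM c f t : abs_bounded f t -> abs_bounded (c%:R * f) t.
Proof. by move=> [M hM]; exists (c%:R * M) => n; rewrite apartial_natM ler_wpM2l. Qed.

Lemma abs_bounded_varM f t : abs_bounded f t -> abs_bounded (fps_var C * f) t.
Proof.
move=> [M hM]; exists (`|t| * M) => n; apply: le_trans (apartialS _ _ _) _.
by rewrite apartial_varM ler_wpM2l.
Qed.

Lemma abs_bounded1 t : abs_bounded 1 t.
Proof.
exists 1 => n; apply: le_trans (apartialS _ _ _) _; rewrite /apartial big_ord_recl big1.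
  by rewrite addr0 normr1 mulr1.
by move=> j _; rewrite /= normr0 mul0r.
Qed.

Lemma abs_bounded_varXM e f t : abs_bounded f t -> abs_bounded (fps_var C ^+ e * f) t.
Proof.
move=> fb; elim: e => [|e IHe]; first by rewrite mul1r.
by rewrite exprS -mulrA; apply: abs_bounded_varM.
Qed.

Lemma abs_bounded_sum (I : Type) (r : seq I) (P : pred I) (F : I -> fps C) t :
  (forall i, P i -> abs_bounded (F i) t) -> abs_bounded (\sum_(i <- r | P i) F i) t.
Proof.
move=> h; elim/big_rec: _ => [|i f Pi fb]; last by apply: abs_boundedD => //; apply: h.
by have := abs_bounded_natM 0 (abs_bounded1 t); rewrite !mul0r.
Qed.

Lemma abs_bounded_prodM (q : nat) (a b : nat) f t : abs_bounded f t ->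
  abs_bounded (\prod_(a <= j < b) (1 - q%:R ^+ j * fps_var C) * f) t.
Proof.
move=> fl; elim/big_rec: _ => [|j g _ gb]; first by rewrite mul1r.
rewrite -mulrA mulrBl mul1r -natrX -mulrA.
by apply: abs_boundedD => //; apply: abs_boundedN; apply: abs_bounded_natM; apply: abs_bounded_varM.
Qed.

(** With A_n the absolute partial sums of f and M the bound, the identity f =
    (1 - cT) f + cT f gives A_n <= M + c|t| A_n. *)
Lemma abs_bounded_divl (c : nat) f t : c%:R * `|t| < 1 ->
  abs_bounded ((1 - c%:R * fps_var C) * f) t -> abs_bounded f t.
Proof.
move=> ct [M hM]; exists (M / (1 - c%:R * `|t|)) => n.
rewrite ler_pdivlMr ?subr_gt0 // mulrBr mulr1 lerBlDr.
have fE : f = (1 - c%:R * fps_var C) * f + c%:R * (fps_var C * f).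
  by rewrite mulrBl mul1r -mulrA subrK.
rewrite {1}fE; apply: le_trans (apartialD _ _ _ _) _; apply: lerD => //.
rewrite apartial_natM; case: n => [|n].
  by rewrite /apartial !big_ord0 mulr0 mul0r.
rewrite apartial_varM mulrA mulrC ler_wpM2r ?mulr_ge0 //.
exact: apartialS.
Qed.

Lemma abs_bounded_divl_prod (q : nat) d f t :
  (forall j, (j < d)%N -> q%:R ^+ j * `|t| < 1) ->
  abs_bounded (\prod_(0 <= j < d) (1 - q%:R ^+ j * fps_var C) * f) t -> abs_bounded f t.
Proof.
elim: d f => [|d IHd] f qt; first by rewrite big_geq // mul1r.
rewrite big_nat_recr //= -mulrA => /IHd h; apply: (@abs_bounded_divl (q ^ d)).
  by rewrite natrX qt.
by rewrite natrX; apply: h => j jd; apply: qt; apply: ltnW.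
Qed.

End PowerSeries.

(** * Unconditional sums as power series *)

Section ComplexSeries.
Variables (Rl : realType).
Local Notation C := (Rl[i]).

Lemma complex_cvg (u : nat -> C) (a b : Rl) :
  (fun n => complex.Re (u n)) @ \oo --> a -> (fun n => complex.Im (u n)) @ \oo --> b ->
  (u : nat -> C^o) @ \oo --> (a +i* b : C^o).
Proof.
move=> /cvgrPdist_lt ha /cvgrPdist_lt hb; apply/cvgrPdist_lt => e e0.
have [e1 e1E] : exists e1 : Rl, e = e1%:C.
  by exists (complex.Re e); rewrite RRe_real // gtr0_real.
have e1_gt0 : 0 < e1 by move: e0; rewrite e1E ltcR.
have e2 : 0 < e1 / 2 by rewrite divr_gt0.
near=> n.
have an : `|a - complex.Re (u n)| < e1 / 2 by near: n; apply: ha.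
have bn : `|b - complex.Im (u n)| < e1 / 2 by near: n; apply: hb.
have -> : (a +i* b) - u n = (a - complex.Re (u n))%:C + 'i * (b - complex.Im (u n))%:C.
  by rewrite {1}[u n]complexE; simpc.
apply: le_lt_trans (ler_normD _ _) _.
have normR (x : Rl) : `|x%:C| = `|x|%:C by rewrite normc_def /= expr0n addr0 sqrtr_sqr.
rewrite normrM normR normR (_ : `|'i| = 1); last first.
  by rewrite normc_def /= expr0n add0r expr1n sqrtr1.
by rewrite mul1r e1E -rmorphD ltcR [e1]splitr ltrD.
Unshelve. all: by end_near. Qed.

(** The real and the imaginary parts converge absolutely. *)
Lemma abs_bounded_cvg (f : fps C) (t : C) : abs_bounded f t -> exists l, conv_to f t l.
Proof.
move=> [M hM].
pose v j := fcoef f j * t ^+ j.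
have vM n : \sum_(j < n) `|v j| <= M.
  apply: le_trans (hM n); rewrite le_eqVlt; apply/orP; left; apply/eqP.
  by apply: eq_bigr => j _; rewrite normrM normrX.
have real_case (pr : C -> Rl) : (forall z z', pr (z + z') = pr z + pr z') -> pr 0 = 0 ->
    (forall z, `|pr z|%:C <= `|z|) ->
    exists a : Rl, (fun n => pr (partial f t n)) @ \oo --> a.
  move=> prD pr0 prN.
  have prE : (fun n => pr (partial f t n)) = series (fun j => pr (v j)).
    apply/funext => n; rewrite /partial /series /= big_mkord.
    exact: (big_morph pr prD pr0).
  rewrite prE; suff : cvgn (series (fun j => pr (v j))) by move=> h; exists (limn (series (fun j => pr (v j)))).
  apply: normed_cvg; apply: nondecreasing_is_cvgn.
    by apply: nondecreasing_series => n _ _; rewrite normr_ge0.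
  exists (complex.Re M) => _ [n _ <-].
  have : (\sum_(j < n) `|pr (v j)|)%:C <= M.
    rewrite rmorph_sum; apply: le_trans (vM n); apply: ler_sum => j _; exact: prN.
  by rewrite lecE /= => /andP[_]; rewrite /series /= big_mkord.
have [||z|a ha] := real_case (@complex.Re Rl).
- by move=> [a b] [a' b'].
- by [].
- exact: normc_ge_Re.
have [||z|b hb] := real_case (@complex.Im Rl).
- by move=> [? ?] [? ?].
- by [].
- by rewrite normc_def lecR -sqrtr_sqr ler_wsqrtr // lerDr sqr_ge0.
by exists (a +i* b); apply: complex_cvg.
Qed.

End ComplexSeries.

Section Net.
Variables (Rl : realType) (I : choiceType) (w : I -> nat) (t : Rl[i]).
Local Notation C := (Rl[i]).
Hypothesis w_fin : forall n, finite_set [set i | w i = n].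
Let x (i : I) : C^o := t ^+ w i.
Let a : fps C := FPS (fun n => (ncard [set i | w i = n])%:R).

Lemma belowS n : [set i | (w i < n.+1)%N] = [set i | (w i < n)%N] `|` [set i | w i = n].
Proof.
apply/seteqP; split=> i /=; rewrite (_ : (w i < n.+1)%N = (w i == n) || (w i < n)%N);
  rewrite ?ltnS ?[(w i <= n)%N]leq_eqVlt //.
  by case/orP => [/eqP|]; [right|left].
by case=> [->|->]; rewrite ?orbT ?eqxx.
Qed.

Lemma below_finite n : finite_set [set i | (w i < n)%N].
Proof.
elim: n => [|n IHn]; first by rewrite (_ : [set _ | _] = set0) //; apply/seteqP; split.
by rewrite belowS finite_setU.
Qed.

Definition below n : {fset I} := fset_set [set i | (w i < n)%N].

Lemma partial_sumE (y : I -> C^o) (A : {fset I}) :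
  summability.partial_sum y A = \sum_(i <- A) y i.
Proof. by rewrite /summability.partial_sum big_seq_fsetE. Qed.

Lemma sum_fsubset (A B : {fset I}) (y : I -> C) : (A `<=` B)%fset ->
  \sum_(i <- B) y i = \sum_(i <- A) y i + \sum_(i <- (B `\` A)%fset) y i.
Proof.
move=> /fsubsetP AB; rewrite (big_fsetID _ (mem A)) /=.
congr (_ + _); apply: eq_fbigl => i; rewrite !inE /= andbC //.
by case: (boolP (i \in A)) => // /AB ->.
Qed.

Lemma sum_below (y : nat -> C) n : \sum_(i <- below n) y (w i) = \sum_(j < n) fcoef a j * y j.
Proof.
elim: n => [|n IHn].
  rewrite big_ord0 /below (_ : [set _ | _] = set0) ?fset_set0 ?big_seq_fset0 //.
  by apply/seteqP; split.
rewrite big_ord_recr /= -IHn /below.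
rewrite -!fsbig_finite; [|exact: below_finite|exact: below_finite].
rewrite belowS fsbigU0 //=; [|exact: below_finite|]; last first.
  by move=> i [/= h1 h2]; rewrite h2 ltnn in h1.
congr (_ + _); rewrite (eq_fsbigr (fun=> y n)) => [|i]; last by rewrite inE /= => ->.
by rewrite fsbig_finite // big_const_seq count_predT iter_addr_0 mulr_natl.
Qed.

(** The finite sets where w < n are cofinal among all finite sets. *)
Lemma net_to_series : cvg (summability.partial_sum x @ summability.totally) ->
  conv_to a t (summability.sum x).
Proof.
move=> h; rewrite /conv_to.
have -> : (fun n => partial a t n : C^o) = summability.partial_sum x \o below.
  by apply/funext => n; rewrite /= partial_sumE sum_below.
apply: cvg_comp h => U [A _ AU].
exists (\max_(i <- A) w i).+1 => // n /= An; apply: AU => /=.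
apply/fsubsetP => i iA; rewrite in_fset_set; last exact: below_finite.
rewrite inE /=; apply: leq_trans An; rewrite ltnS.
by apply: leq_bigmax_seq.
Qed.

(** A finite set that contains all i with w i < N has a sum that differs from
    the N-th partial sum by at most the tail of the absolute series. *)
Lemma series_to_net : abs_bounded a t -> cvg (summability.partial_sum x @ summability.totally).
Proof.
move=> ab; have [l hl] := abs_bounded_cvg ab; have [M hM] := ab.
suff h : summability.partial_sum x @ summability.totally --> (l : C^o) by apply/cvg_ex; exists l.
have apR n : apartial a t n = (complex.Re (apartial a t n))%:C.
  by rewrite RRe_real // ger0_real // apartial_ge0.
pose r n := complex.Re (apartial a t n).
have r_homo : {homo r : n n' / (n <= n')%N >-> n <= n'}.
  by move=> n n' nn'; have := apartial_le a t nn'; rewrite apR [X in _ <= X]apR lecR.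
have r_cvg : cvgn r.
  apply: nondecreasing_is_cvgn => //; exists (complex.Re M) => _ [n _ <-].
  by have := hM n; rewrite lecE => /andP[].
have r_le n : r n <= limn r by apply: nondecreasing_cvgn_le.
have FF : Filter (@summability.totally I) by apply: summability.totally_filter.
apply/cvgrPdist_lt => e e0.
have [e1 e1E] : exists e1 : Rl, e = e1%:C.
  by exists (complex.Re e); rewrite RRe_real // gtr0_real.
have e1_gt0 : 0 < e1 by move: e0; rewrite e1E ltcR.
have e2 : 0 < e1 / 2 by rewrite divr_gt0.
have e2C : 0 < (e1 / 2)%:C :> C by rewrite ltcR.
have [N1 _ N1P] := (cvgrPdist_lt r _).1 r_cvg _ e2.
have [N2 _ N2P] := (cvgrPdist_lt _ _).1 hl _ e2C.
pose N := maxn N1 N2.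
exists (below N) => // B /= NB.
(* Large enough for every element of B to have weight less than n. *)
pose n := (N + \max_(i <- B) w i).+1.
have Nn : (N <= n)%N by rewrite /n -addnS leq_addr.
have Bn : (B `<=` below n)%fset.
  apply/fsubsetP => i iB; rewrite in_fset_set; last exact: below_finite.
  rewrite inE /= /n ltnS; apply: leq_trans (leq_addl _ _).
  by apply: leq_bigmax_seq.
have splitB : summability.partial_sum x B =
    partial a t N + \sum_(i <- (B `\` below N)%fset) x i.
  by rewrite partial_sumE /partial -(sum_below (fun j => t ^+ j)) -sum_fsubset.
rewrite splitB opprD addrA; apply: le_lt_trans (ler_normB _ _) _.
rewrite e1E [e1]splitr rmorphD /=; apply: ltrD.
  by apply: N2P; rewrite /= leq_maxr.
have tail : `|\sum_(i <- (B `\` below N)%fset) x i| <= apartial a t n - apartial a t N.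
  rewrite lerBrDr addrC.
  have -> : apartial a t n = \sum_(i <- below n) `|t| ^+ w i.
    rewrite (sum_below (fun j => `|t| ^+ j)); apply: eq_bigr => j _.
    by rewrite /= normr_nat.
  have -> : apartial a t N = \sum_(i <- below N) `|t| ^+ w i.
    rewrite (sum_below (fun j => `|t| ^+ j)); apply: eq_bigr => j _.
    by rewrite /= normr_nat.
  rewrite (sum_fsubset _ Bn) (sum_fsubset _ NB) -addrA lerD2l.
  apply: le_trans (ler_norm_sum _ _ _) _.
  rewrite (eq_bigr (fun i => `|t| ^+ w i)) => [|i _]; last by rewrite normrX.
  by rewrite lerDl sumr_ge0 // => i _; rewrite exprn_ge0.
apply: le_lt_trans tail _; rewrite apR [X in _ - X]apR -rmorphB ltcR.
have := N1P N (leq_maxl _ _); rewrite /= ger0_norm ?subr_ge0 //.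
by apply: le_lt_trans; rewrite lerD2r; apply: r_le.
Qed.

End Net.

(** * Complex powers and the theorem *)

Section ComplexPower.
Variable Rl : realType.
Local Notation C := (Rl[i]).

Lemma expC0 : expC 0 = 1 :> C.
Proof. by rewrite /expC /= expR0 cos0 sin0 mulr1 mulr0. Qed.

Lemma expCD (x y : C) : expC (x + y) = expC x * expC y.
Proof.
case: x y => a b [c e]; rewrite /expC /= expRD cosD sinD; simpc.
by congr (_ +i* _); ring.
Qed.

Lemma norm_expC (x : C) : `|expC x| = (expR (complex.Re x))%:C.
Proof.
rewrite normc_def /expC /= !exprMn -mulrDr cos2Dsin2 mulr1 sqrtr_sqr.
by rewrite ger0_norm // expR_ge0.
Qed.

Lemma natpowCX (q n : nat) (s : C) : (0 < q)%N -> natpowC (q ^ n) s = natpowC q s ^+ n.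
Proof.
move=> q0; elim: n => [|n IHn].
  by rewrite /natpowC expn0 ln1 /= mulr0 expC0.
have q0' : 0 < q%:R :> Rl by rewrite ltr0n.
rewrite exprS -IHn /natpowC -expCD -mulrDr -rmorphD; congr (expC (_ * _%:C)).
by rewrite expnS natrM lnM // posrE // ltr0n expn_gt0 q0.
Qed.

(** The half-plane Re s > d - 1 is where all factors 1 - q^j t with j < d have
    |q^j t| < 1. *)
Lemma norm_natpowC_lt1 (q d j : nat) (s : C) : (1 < q)%N -> (j < d)%N ->
  d%:R - 1 < complex.Re s -> q%:R ^+ j * `|natpowC q (- s)| < 1 :> C.
Proof.
move=> q1 jd ds; have q0 : 0 < q%:R :> Rl by rewrite ltr0n ltnW.
have e : complex.Re (- s * (ln q%:R)%:C) = - complex.Re s * ln q%:R :> Rl.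
  by case: (s) => a b /=; rewrite mulr0 subr0.
have -> : q%:R ^+ j * `|natpowC q (- s)| = (expR ((j%:R - complex.Re s) * ln q%:R))%:C.
  rewrite /natpowC norm_expC e mulrBl expRD -mulNr rmorphM; congr (_ * _).
  by rewrite mulrC expRM_natr lnK ?posrE // rmorphXn /= rmorph_nat.
have -> : (1 : C) = (1 : Rl)%:C by [].
rewrite ltcR expR_lt1 pmulr_llt0 ?subr_lt0; last by rewrite ln_gt0 // ltr1n.
apply: le_lt_trans ds; rewrite lerBrDr natr1 ler_nat //.
Qed.

End ComplexPower.

Theorem proposition9p10 (Rl : realType) (k : finFieldType) (m d : nat)
    (hm : (1 <= m)%N) :
  (forall s : Rl[i], d%:R - 1 < complex.Re s ->
     zeta_converges 'rV[cusp_ring k m]_d s /\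
     zeta_converges 'rV[cusp_normalization k]_d s) /\
  (forall s : Rl[i],
     zeta_converges 'rV[cusp_ring k m]_d s ->
     zeta_converges 'rV[cusp_normalization k]_d s ->
     let q : Rl[i] := #|k|%:R in
     let t : Rl[i] := natpowC #|k| (- s) in
     zeta 'rV[cusp_normalization k]_d s != 0 /\
     nu_cusp k m d s =
       \sum_(p \in [set: int_partition * int_partition])
         let la := sval p.1 in let mu := sval p.2 in
         skew_hall (nseq d m) la q * skew_hall la mu q
         * qpoch t q (d - conj_part la m)
         * t ^+ sumn la * (q ^+ d * t) ^+ sumn mu).
Proof.
have q1 : (1 < #|k|)%N := finNzRing_gt1 k.
have [wR [wRi wRn]] := cusp_count k m d.
have [wN [wNi wNn]] := normalization_count k d.
have wRfin n : finite_set [set N | wR N = n] by case: (wRn n).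
have wNfin n : finite_set [set N | wN N = n] by case: (wNn n).
pose gfR : fps Rl[i] := FPS (fun n => (ncard [set N | wR N = n])%:R).
pose gfN : fps Rl[i] := FPS (fun n => (ncard [set N | wN N = n])%:R).
pose D : fps Rl[i] := \prod_(0 <= j < d) (1 - #|k|%:R ^+ j * fps_var _).
have DN : D * gfN = 1.
  rewrite -(normal_gf k d); congr (_ * FPS _); apply/funext => n.
  by case: (wNn n) => _ ->.
have [c [c_le SWst SWty DR]] := @order_gf k d m Rl[i].
pose SW W := S_of k m (c W).
have {}DR : D * gfR = \sum_(W | stable (sh_mx k d m) W) \sum_(B | (B <= SW W)%VS && stable (sh_mx k d m) B)
     fps_var Rl[i] ^+ (m * d - \dim W) *
     \prod_(0 <= j < #|[set i | (0 < c W i)%N]%SET|) (1 - #|k|%:R ^+ j * fps_var _)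
       * (#|k|%:R ^+ (d * (\dim (SW W) - \dim B)) * fps_var _ ^+ (\dim (SW W) - \dim B)).
  rewrite -DR; congr (_ * FPS _); apply/funext => n.
  by case: (wRn n) => _ ->.
have termR s (N : finite_index_submodule 'rV[cusp_ring k m]_d) : zeta_term s N = natpowC #|k| (- s) ^+ wR N.
  by rewrite /zeta_term wRi natpowCX // ltnW.
have termN s (N : finite_index_submodule 'rV[cusp_normalization k]_d) : zeta_term s N = natpowC #|k| (- s) ^+ wN N.
  by rewrite /zeta_term wNi natpowCX // ltnW.
split=> [s ds|s cR cN q t].
  have small j : (j < d)%N -> #|k|%:R ^+ j * `|natpowC #|k| (- s)| < 1 :> Rl[i].
    by move=> jd; apply: norm_natpowC_lt1 ds.
  split; rewrite /zeta_converges.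
    rewrite (_ : zeta_term s = fun N => natpowC #|k| (- s) ^+ wR N); last exact/funext/termR.
    apply: (series_to_net wRfin); apply: (abs_bounded_divl_prod small).
    rewrite -/gfR -/D DR; apply: abs_bounded_sum => W _; apply: abs_bounded_sum => B _.
    rewrite -mulrA; apply: abs_bounded_varXM; apply: abs_bounded_prodM.
    rewrite -natrX; apply: abs_bounded_natM; rewrite -[X in abs_bounded X](mulr1).
    by apply: abs_bounded_varXM; apply: abs_bounded1.
  rewrite (_ : zeta_term s = fun N => natpowC #|k| (- s) ^+ wN N); last exact/funext/termN.
  apply: (series_to_net wNfin); apply: (abs_bounded_divl_prod small).
  by rewrite -/gfN -/D DN; apply: abs_bounded1.
pose zR : Rl[i] := zeta 'rV[cusp_ring k m]_d s.
pose zN : Rl[i] := zeta 'rV[cusp_normalization k]_d s.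
have cvR : conv_to gfR t zR.
  rewrite /zR /zeta; move: cR; rewrite /zeta_converges.
  rewrite (_ : zeta_term s = fun N => t ^+ wR N); last exact/funext/termR.
  exact: net_to_series.
have cvN : conv_to gfN t zN.
  rewrite /zN /zeta; move: cN; rewrite /zeta_converges.
  rewrite (_ : zeta_term s = fun N => t ^+ wN N); last exact/funext/termN.
  exact: net_to_series.
pose Dt : Rl[i] := \prod_(0 <= j < d) (1 - q ^+ j * t).
have DtN : Dt * zN = 1.
  apply: (conv_unique (f := D * gfN) (t := t)); first exact: conv_to_prodM.
  by rewrite DN; apply: conv_to1.
have zN0 : zN != 0.
  by apply: contra_eq_neq DtN => ->; rewrite mulr0 eq_sym oner_eq0.
split=> //.
have -> : nu_cusp k m d s = Dt * zR.
  rewrite /nu_cusp -/zR -/zN; apply: (canLR (mulfK zN0)).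
  by rewrite mulrAC DtN mul1r.
pose Wt (la mu : seq nat) : Rl[i] :=
  qpoch t q (d - conj_part la m) * t ^+ sumn la * (q ^+ d * t) ^+ sumn mu.
pose Wt' W (B : {vspace 'M[k]_(m, d)}) : Rl[i] :=
  t ^+ (m * d - \dim W) * \prod_(0 <= j < #|[set i | (0 < c W i)%N]%SET|) (1 - q ^+ j * t)
    * (q ^+ (d * (\dim (SW W) - \dim B)) * t ^+ (\dim (SW W) - \dim B)).
transitivity (\sum_(W | stable (sh_mx k d m) W)
    \sum_(B | (B <= SW W)%VS && stable (sh_mx k d m) B) Wt' W B).
  apply: (conv_unique (f := D * gfR) (t := t)); first exact: conv_to_prodM.
  rewrite DR; apply: conv_to_sum => W _; apply: conv_to_sum => B _.
  rewrite /Wt' -!mulrA; apply: conv_to_varXM; apply: conv_to_prodM.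
  rewrite -!natrX; apply: conv_to_natM; rewrite -[fps_var _ ^+ _]mulr1 -[t ^+ _]mulr1.
  by apply: conv_to_varXM; apply: conv_to1.
rewrite -(sum_partition_cotype (sh_mx_nilp k d m) (@mod_type_full k d m hm) SWst SWty (Wt := Wt)).
  by apply: eq_fsbigr => p _; rewrite /Wt /= !mulrA.
move=> W B la mu Wst BS Bst pla pmu laW muB.
have fullst : stable (sh_mx k d m) fullv by apply: subvf.
have Snilp : img_iter (sh_mx k d m) m (SW W) = 0%VS.
  by apply/eqP; rewrite -subv0 -(sh_mx_nilp k d m); apply: img_iter_mono; apply: subvf.
have sum_la : sumn la = (m * d - \dim W)%N.
  rewrite (@sumn_conj m); last first.
    by apply/all_leq_conj => j mj; rewrite laW (mod_cotype0 _ (sh_mx_nilp k d m)).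
  under eq_bigr do rewrite laW.
  have dimE : \dim {: 'M[k]_(m, d)} = (m * d)%N by rewrite dimvf dim_matrix.
  by rewrite sum_mod_cotype // sh_mx_nilp add0v (addv_idPl (subvf W)) dimE.
have sum_mu : sumn mu = (\dim (SW W) - \dim B)%N.
  rewrite (@sumn_conj m); last first.
    by apply/all_leq_conj => j mj; rewrite muB (mod_cotype0 _ Snilp).
  under eq_bigr do rewrite muB.
  by rewrite sum_mod_cotype ?SWst // Snilp add0v (addv_idPl BS).
have conj_m : (d - conj_part la m = #|[set i | (0 < c W i)%N]%SET|)%N.
  have cW : conj_part la m = #|[set i | c W i == 0%N]%SET|.
    by rewrite -(mod_type_S_of k hm (c_le W Wst)) SWty // -laW prednK.
  rewrite cW; have := cardsC [set i | c W i == 0%N]%SET; rewrite card_ord.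
  have -> : (~: [set i | c W i == 0%N])%SET = [set i | (0 < c W i)%N]%SET.
    by apply/setP => i; rewrite !inE lt0n.
  by move/esym/(congr1 (fun n => n - #|[set i | c W i == 0%N]%SET|)%N); rewrite addKn.
rewrite /Wt /Wt' sum_la sum_mu conj_m exprMn -exprM big_mkord.
congr (_ * _); rewrite mulrC /qpoch; congr (_ * _).
by apply: eq_bigr => j _; rewrite mulrC.
Qed.
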